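(* There is a constant $C$, depending only on $\alpha$, $T$ and $\vec F$, such that the semidiscrete finite element solution $u_h$ with initial value $u_h(0)=u_{0h}\in\mathbb{S}_h$ satisfies \[ \|u_h(t)\|\le C\|u_{0h}\|\quad\text{for } 0\le t\le T. \]
   Context: Let $d\ge1$, let $\Omega\subset\mathbb{R}^d$ be a (bounded) polyhedral domain, $T>0$ and $0<\alpha<1$. Let $\vec F=\vec F(\vec x,t)$ be such that $\vec F$ and $\vec F'=\partial_t\vec F$ belong to $L_\infty(\Omega\times(0,T),\mathbb{R}^d)$. Write $\langle u,v\rangle=\int_\Omega uv$, $\langle \vec u,\vec v\rangle=\int_\Omega \vec u\cdot\vec v$, and $\|\cdot\|$ for the corresponding $L_2(\Omega)$ norms. Fractional calculus: for $\mu>0$, $\omega_\mu(t)=t^{\mu-1}/\Gamma(\mu)$, $(\mathcal{I}^\mu\phi)(t)=\int_0^t\omega_\mu(t-s)\phi(s)\,ds$, and $\partial_t^{1-\alpha}\phi=\partial_t(\mathcal{I}^\alpha\phi)$ (Riemann--Liouville derivative). Finite element space: take a shape-regular triangulation of $\Omega$ with maximum element diameter $h$. In the case of the homogeneous Dirichlet boundary condition, $\mathbb{S}_h\subseteq H^1_0(\Omega)$ is the space of continuous piecewise-linear functions vanishing on $\partial\Omega$; in the case of the zero-flux boundary condition, $\mathbb{S}_h\subseteq H^1(\Omega)$ is the space of all continuous piecewise-linear functions. The result applies in either case. The semidiscrete finite element solution with initial value $u_{0h}\in\mathbb{S}_h$ is the unique continuous function $u_h:[0,T]\to\mathbb{S}_h$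 (it is continuously differentiable on $(0,T]$) satisfying $u_h(0)=u_{0h}$ and, for $0<t<T$, \[ \langle\partial_tu_h,\chi\rangle+\langle\partial_t^{1-\alpha}\nabla u_h,\nabla\chi\rangle-\langle\vec F\,\partial_t^{1-\alpha}u_h,\nabla\chi\rangle=0\quad\text{for all }\chi\in\mathbb{S}_h . \] Dependence of $C$ on $\vec F$ is through the $L_\infty(\Omega\times(0,T))$ norms of $\vec F$ and $\vec F'$; $C$ does not depend on $h$, $t$ or $u_{0h}$. *)

(* Defs.v *)
From HB Require Import structures.
From mathcomp Require Import all_boot all_order all_algebra.
From mathcomp Require Import all_classical all_reals all_analysis.
From mathcomp Require Import ess_sup_inf.
Set Implicit Arguments.
Unset Strict Implicit.
Unset Printing Implicit Defensive.
Import Order.TTheory GRing.Theory Num.Theory.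
Import numFieldNormedType.Exports.
Local Open Scope classical_set_scope.
Local Open Scope ring_scope.

Definition rV_display : measure_display -> measure_display.
Proof. exact. Qed.

Section measurable_rV.
Context (R : realType) (d : nat).

Definition rV_coor (i : 'I_d) (v : 'rV[R]_d) : measurableTypeR R := v ord0 i.

Let rV_set0 : g_sigma_preimage rV_coor set0.
Proof. exact: sigma_algebra0. Qed.

Let rV_setC A : g_sigma_preimage rV_coor A -> g_sigma_preimage rV_coor (~` A).
Proof. exact: sigma_algebraC. Qed.

Let rV_bigcup (F : (set _)^nat) : (forall i, g_sigma_preimage rV_coor (F i)) ->
  g_sigma_preimage rV_coor (\bigcup_i (F i)).
Proof. exact: sigma_algebra_bigcup. Qed.

HB.instance Definition _ := @isMeasurable.Build
  (rV_display default_measure_display) 'rV[R]_d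
  (g_sigma_preimage rV_coor) rV_set0 rV_setC rV_bigcup.

Lemma measurable_rV_coor (i : 'I_d) : measurable_fun [set: 'rV[R]_d] (rV_coor i).
Proof.
move=> _ Y mY; rewrite setTI; apply: sub_sigma_algebra => /=.
rewrite -bigcup_seq/=; exists i => /=; first by rewrite mem_index_enum.
by exists Y => //; rewrite setTI.
Qed.

Lemma measurable_rV_fun d' (T : measurableType d') (f : T -> 'rV[R]_d) :
  (forall i, measurable_fun [set: T] (rV_coor i \o f)) ->
  measurable_fun [set: T] f.
Proof.
move=> mf _ A mA; rewrite setTI; move: mA.
pose G := [set B | measurable (f @^-1` B)] : set (set 'rV[R]_d).
suff : g_sigma_preimage rV_coor `<=` G by exact.
apply: smallest_sub.
  split; first by rewrite /G /= preimage_set0.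
  - by move=> B mB; rewrite /G /= setTD preimage_setC; exact: measurableC.
  - move=> F mF; rewrite /G /= preimage_bigcup.
    by apply: bigcup_measurable => k _; exact: mF.
rewrite -bigcup_seq; apply: bigcup_sub => i _ B [Y mY <-].
by rewrite /G /= setTI -(setTI (_ @^-1` _)) -comp_preimage; exact: mf.
Qed.

End measurable_rV.

Section lebesgue_rV.
Context (R : realType).

Definition rV_cons d (z : measurableTypeR R * 'rV[R]_d) : 'rV[R]_d.+1 :=
  \row_i (if unlift ord0 i is Some j then z.2 ord0 j else z.1).

Definition rV_uncons d (v : 'rV[R]_d.+1) : measurableTypeR R * 'rV[R]_d :=
  (v ord0 ord0, \row_j v ord0 (lift ord0 j)).

Lemma rV_consK d : cancel (@rV_cons d) (@rV_uncons d).
Proof.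
move=> [x v]; rewrite /rV_uncons /rV_cons mxE unlift_none; congr pair.
by apply/rowP => j; rewrite !mxE liftK.
Qed.

Lemma measurable_rV_cons d : measurable_fun setT (@rV_cons d).
Proof.
apply: measurable_rV_fun => i; rewrite /comp /rV_coor /rV_cons.
under eq_fun do rewrite mxE.
case: (unlift ord0 i) => [j|]; last exact: measurable_fst.
exact: (measurableT_comp (measurable_rV_coor j) measurable_snd).
Qed.

Lemma measurable_rV_uncons d : measurable_fun setT (@rV_uncons d).
Proof.
apply: measurable_fun_pair; first exact: (measurable_rV_coor ord0).
apply: measurable_rV_fun => i; rewrite /comp /rV_coor.
under eq_fun do rewrite mxE.
exact: (measurable_rV_coor (lift ord0 i)).
Qed.

Section lebesgue_rV_step.
Context d (m : {sigma_finite_measure set 'rV[R]_d -> \bar R}).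

Definition lebesgue_rV_step : set 'rV[R]_d.+1 -> \bar R :=
  pushforward (lebesgue_measure \x m)%E (@rV_cons d).

Let step0 : lebesgue_rV_step set0 = 0%E.
Proof. by rewrite /lebesgue_rV_step /pushforward preimage_set0 measure0. Qed.

Let step_ge0 A : (0 <= lebesgue_rV_step A)%E.
Proof. by rewrite /lebesgue_rV_step /pushforward; exact: measure_ge0. Qed.

Let step_sigma_additive : semi_sigma_additive lebesgue_rV_step.
Proof.
move=> F mF tF mUF; rewrite /lebesgue_rV_step /pushforward preimage_bigcup.
apply: (@measure_semi_sigma_additive _ _ _ (lebesgue_measure \x m)%E).
- by move=> n; rewrite -[X in measurable X]setTI; exact: measurable_rV_cons.
- apply/trivIsetP => /= i j _ _ ij; rewrite -preimage_setI.
  move/trivIsetP : tF => /(_ _ _ Logic.I Logic.I ij) ->.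
  by rewrite preimage_set0.
- by rewrite -preimage_bigcup -[X in measurable X]setTI; exact: measurable_rV_cons.
Qed.

HB.instance Definition _ := isMeasure.Build _ _ _ lebesgue_rV_step
  step0 step_ge0 step_sigma_additive.

Let step_sigma_finite : sigma_finite setT lebesgue_rV_step.
Proof.
have /sigma_finiteP[F [TF ndF Foo]] :=
  @sigma_finiteT _ _ _ (@lebesgue_measure R).
have /sigma_finiteP[G [TG ndG Goo]] := sigma_finiteT m.
exists (fun n => @rV_uncons d @^-1` (F n `*` G n)).
  apply/esym; rewrite -subTset => v _.
  have [n _ Fn] : (\bigcup_n F n) (rV_uncons v).1 by rewrite -TF.
  have [k _ Gk] : (\bigcup_n G n) (rV_uncons v).2 by rewrite -TG.
  exists (maxn n k) => //; split.
  - by move: Fn; exact/subsetPset/ndF/leq_maxl.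
  - by move: Gk; exact/subsetPset/ndG/leq_maxr.
move=> k; have [mF Fk] := Foo k; have [mG Gk] := Goo k.
have mFG := measurableX mF mG; split.
  by rewrite -[X in measurable X]setTI; exact: measurable_rV_uncons.
rewrite /lebesgue_rV_step /pushforward -comp_preimage.
rewrite (_ : _ \o _ = id) ?preimage_id; last by apply/funext => z; exact: rV_consK.
by rewrite product_measure1E// lte_mul_pinfty// ge0_fin_numE.
Qed.

HB.instance Definition _ := Measure_isSigmaFinite.Build _ _ _ lebesgue_rV_step
  step_sigma_finite.

End lebesgue_rV_step.

(* d-dimensional Lebesgue measure: the unit mass on R^0, and on R^(d+1) the
   image of the product of the one- and d-dimensional Lebesgue measures. *)
Fixpoint lebesgue_rV (d : nat) : {sigma_finite_measure set 'rV[R]_d -> \bar R} :=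
  if d is d'.+1 then lebesgue_rV_step (lebesgue_rV d') else \d_(0 : 'rV[R]_0).

End lebesgue_rV.

Section euclidean.
Context (R : realType) (d : nat).
Implicit Types (x y : 'rV[R]_d) (A : set 'rV[R]_d) (s : seq 'rV[R]_d).

(* The library norm on 'rV[R]_d is the sup norm; it is only used here through
   the topology it induces. *)
Definition dotv x y : R := \sum_(i < d) x ord0 i * y ord0 i.

Definition normv x : R := Num.sqrt (dotv x x).

Definition diam A : R := sup [set normv (z.1 - z.2) | z in A `*` A].

Definition convex_hull s : set 'rV[R]_d :=
  [set x | exists a : 'I_(size s) -> R,
    [/\ forall i, 0 <= a i, \sum_i a i = 1 & x = \sum_i a i *: s`_i]].

(* The condition on the interior of the closure excludes slits. *)
Definition polyhedral_domain A :=
  [/\ A !=set0, open A, connected A, bounded_set A & (closure A)° = A] /\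
  exists P : seq (seq 'rV[R]_d),
    closure A = [set x | exists2 s, s \in P & convex_hull s x].

End euclidean.

Section finite_elements.
Context (R : realType) (d : nat).

(* A triangulation is given by the list of the vertex tuples of its simplices. *)
Definition mesh := seq (d.+1.-tuple 'rV[R]_d).

Definition affinely_independent (K : d.+1.-tuple 'rV[R]_d) :=
  row_free (\matrix_(i < d) (tnth K (lift ord0 i) - tnth K ord0)).

Definition triangulation (Omega : set 'rV[R]_d) (Th : mesh) :=
  [/\ forall K, K \in Th -> affinely_independent K,
      closure Omega = [set x | exists2 K, K \in Th & convex_hull K x] &
      forall K L, K \in Th -> L \in Th ->
        convex_hull K `&` convex_hull L = convex_hull [seq x <- K | x \in L]].

Definition mesh_size (Th : mesh) : R :=
  \big[Num.max/0]_(K <- Th) diam (convex_hull K).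

(* Every element contains a ball, of radius r, whose diameter is at least
   1 / sigma times that of the element. *)
Definition shape_regular (sigma : R) (Th : mesh) :=
  forall K, K \in Th -> exists (x : 'rV[R]_d) (r : R),
    [/\ 0 < r, [set y | normv (y - x) <= r] `<=` convex_hull K &
        diam (convex_hull K) <= sigma * (r *+ 2)].

Inductive boundary_condition := Dirichlet | ZeroFlux.

(* The values of v outside the closure of Omega are irrelevant. *)
Definition fe_space (Omega : set 'rV[R]_d) (bc : boundary_condition)
    (Th : mesh) (v : 'rV[R]_d -> R) :=
  [/\ {within closure Omega, continuous v},
      forall K, K \in Th -> exists (g : 'rV[R]_d) (c : R),
        forall x, convex_hull K x -> v x = dotv g x + c &
      bc = Dirichlet -> forall x, (closure Omega `\` Omega) x -> v x = 0].

(* Pointwise gradient; for a continuous piecewise-linear function it exists off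
   the faces of the elements, and there equals the weak gradient. *)
Definition grad (v : 'rV[R]_d -> R) (x : 'rV[R]_d) : 'rV[R]_d :=
  \row_i 'D_(delta_mx ord0 i) v x.

Definition inner (Omega : set 'rV[R]_d) (v w : 'rV[R]_d -> R) : R :=
  \int[lebesgue_rV R d]_(x in Omega) (v x * w x).

Definition innerv (Omega : set 'rV[R]_d) (v w : 'rV[R]_d -> 'rV[R]_d) : R :=
  \int[lebesgue_rV R d]_(x in Omega) dotv (v x) (w x).

Definition L2norm (Omega : set 'rV[R]_d) (v : 'rV[R]_d -> R) : R :=
  Num.sqrt (inner Omega v v).

End finite_elements.

Section fractional_calculus.
Context (R : realType).
Implicit Types (mu alpha t : R) (phi : R -> R).

Definition Gamma mu : R :=
  \int[lebesgue_measure]_(t in `]0, +oo[) (t `^ (mu - 1) * expR (- t)).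

Definition omega mu t : R := t `^ (mu - 1) / Gamma mu.

Definition fracint mu phi t : R :=
  \int[lebesgue_measure]_(s in `[0, t]) (omega mu (t - s) * phi s).

(* Riemann-Liouville derivative of order 1 - alpha. *)
Definition RLderiv1m alpha phi : R -> R := derive1 (fracint alpha phi).

End fractional_calculus.

Section forcing.
Context (R : realType) (d : nat) (Omega : set 'rV[R]_d) (T : R).
Implicit Types F : 'rV[R]_d -> R -> 'rV[R]_d.

Definition space_time : set ('rV[R]_d * measurableTypeR R) :=
  [set z | Omega z.1 /\ 0 < z.2 < T].

Definition space_time_measurable F :=
  forall i, measurable_fun space_time (fun z => F z.1 z.2 ord0 i).

Definition Linfty_norm F : \bar R :=
  ess_sup (lebesgue_rV R d \x lebesgue_measure)%E
    (fun z => (\1_space_time z * normv (F z.1 z.2))%:E).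

(* F' is the time derivative of F for t in ]0, T[ in the L_infty sense: for
   almost every x, F x is the absolutely continuous representative whose
   derivative is a.e. equal to F' x. *)
Definition time_derivative F F' :=
  {ae lebesgue_rV R d, forall x, Omega x ->
    forall s t, 0 < s -> s <= t -> t < T -> forall i,
      F x t ord0 i - F x s ord0 i =
      \int[lebesgue_measure]_(r in `[s, t]) F' x r ord0 i}.

End forcing.

Section semidiscrete.
Context (R : realType) (d : nat).

(* Since the finite element space is finite-dimensional, continuity and time
   differentiability in that space amount to the same properties at each point
   of the closure of Omega. The derivative at T is one-sided, hence w. *)
Definition semidiscrete_solution (Omega : set 'rV[R]_d) (T alpha : R)
    (F : 'rV[R]_d -> R -> 'rV[R]_d) (bc : boundary_condition)
    (Th : mesh R d) (u0h : 'rV[R]_d -> R) (u : R -> 'rV[R]_d -> R) :=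
  [/\ forall t, 0 <= t <= T -> fe_space Omega bc Th (u t),
      forall x, closure Omega x -> {within `[0, T], continuous (u^~ x)},
      exists w : R -> 'rV[R]_d -> R, forall x, closure Omega x ->
        {within `]0, T], continuous (w^~ x)} /\
        forall t, 0 < t < T -> is_derive t 1 (u^~ x) (w t x),
      forall x, closure Omega x -> u 0 x = u0h x &
      forall t, 0 < t < T -> forall chi, fe_space Omega bc Th chi ->
        inner Omega (fun x => derive1 (u^~ x) t) chi
        + innerv Omega
            (fun x => \row_i RLderiv1m alpha (fun s => grad (u s) x ord0 i) t)
            (grad chi)
        - innerv Omega (fun x => RLderiv1m alpha (u^~ x) t *: F x t) (grad chi)
        = 0].

End semidiscrete.

(* Main.v *)
Require Import Defs.
From HB Require Import structures.
From mathcomp Require Import all_boot all_order all_algebra.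
From mathcomp Require Import all_classical all_reals all_analysis.
From mathcomp Require Import measurable_realfun ess_sup_inf.
From mathcomp Require Import ring lra.

(** Why the bound holds.  Expand [u] in the barycentric shape functions of the
    elements; the coordinates are the values of [u] at the vertices, and the
    scheme becomes a system of ordinary fractional equations for them, with a
    mass form [G] (the square of the L2 norm), a stiffness form [S] and a
    time-dependent drift form [B t].  All that the stability argument uses of
    space is: [G] and [S] are nonnegative, and [B t], together with its
    increments in time, is bounded by a weighted sum of [G] and [S].  The
    constants in those bounds come from [F] and [F'] alone, hence neither the
    mesh nor the dimension of the space enters the final constant
    ([fractional_system_stable]).

    The stability proof is a maximum principle in time.  Let [y] be the squared
    norm of [u].  If [y] ever exceeded a steep exponential barrier, let [t] be
    the first time at which it meets the barrier and put [q = u t].  Let [w] be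
    the Abel integral of [u] and [v = w / Gamma alpha], so that the scheme tested
    with [q] reads

      d/ds G(u(s), q) + S(v'(s), q) - B(s; v'(s), q) = 0.

    - Only [v], not the drift, is differentiated here.  Freezing the drift at a
      time [x] gives a function of [s] whose derivative vanishes at [x], so
      [G(u(s), q) + S(v(s), q) - B(s; v(s), q)] moves by no more than the
      increments of [B] allow: from [s] to [t] it grows by at most a constant
      times [t - s] ([energy_increment]), and so does the same expression [f(s)]
      with [B] taken at [t] ([f_increment]).  The constant is a multiple of
      [theta * y(t) + S(q, q) / theta], with [theta] free.
    - Apply to [f] the functional [memory], a regularisation (by a shift [delta])
      of the Caputo fractional derivative of order [alpha] at time [t].  The
      bound on the increments of [f] bounds it above ([memory_le]).
      On [G(u(s), q)], since [t] is a first touching time and the barrier halves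
      over a time [sigma], it is at least [y(t) / 4 * (2 sigma)^-alpha]
      ([memory_ge]).  On the Abel integral
      of [psi(s) = S(u(s), q) - B(t; u(s), q)] it inverts the Abel integral up to
      a constant, and so gives a positive multiple of [psi(t)] as [delta] tends
      to 0 ([abel_approximation]); and [psi(t)] is at least
      [S(q, q) / 2 - M^2 y(t) / 2].
    - The term [S(q, q)] so gained absorbs the one in the growth constant of
      [f] when [theta] is large.  What remains is [(2 sigma)^-alpha <= constant]
      ([touching_bound]), which is false for [sigma] small, that is, for a
      barrier steep enough.

    The reduction to this system ([semidiscrete_system]) works pointwise off a
    null set: the faces of the elements, and the points [x] at which [F x] is not
    a primitive of [F' x] or at which one of them exceeds its bound on a set of
    times of positive measure.  Elsewhere [F x] is bounded, and it is
    Lipschitz in time because it is a primitive of [F' x]. *)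

Set Implicit Arguments.
Unset Strict Implicit.
Unset Printing Implicit Defensive.
Import Order.TTheory GRing.Theory Num.Theory.
Import numFieldNormedType.Exports.
Local Open Scope classical_set_scope.
Local Open Scope ring_scope.

(** * Integrability of real-valued functions *)

Lemma mem_itvcc (R : realType) (a b x : R) :
  (x \in (`[a, b]%classic : set R)) = (a <= x <= b).
Proof. by rewrite mem_setE in_itv. Qed.

Lemma EFin_Rintegral d (T : measurableType d) (R : realType)
    (m : {measure set T -> \bar R}) (D : set T) (f : T -> R) :
  measurable D -> m.-integrable D (EFin \o f) ->
  ((\int[m]_(x in D) f x)%R)%:E = (\int[m]_(x in D) (f x)%:E)%E.
Proof. by move=> mD fi; rewrite fineK//; exact: integrable_fin_num. Qed.

Lemma integrable_mull d (T : measurableType d) (R : realType)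
    (m : {measure set T -> \bar R}) (D : set T) (f : T -> R) (k : R) :
  measurable D -> m.-integrable D (EFin \o f) ->
  m.-integrable D (EFin \o (fun x => k * f x)).
Proof. by move=> mD fi; exact: (@integrableZl _ _ _ m D mD k _ fi). Qed.

Lemma integrable_subr d (T : measurableType d) (R : realType)
    (m : {measure set T -> \bar R}) (D : set T) (f g : T -> R) :
  measurable D -> m.-integrable D (EFin \o f) -> m.-integrable D (EFin \o g) ->
  m.-integrable D (EFin \o (fun x => f x - g x)).
Proof. by move=> mD fi gi; exact: (@integrableB _ _ _ m D mD _ _ fi gi). Qed.

Lemma integrable_addr d (T : measurableType d) (R : realType)
    (m : {measure set T -> \bar R}) (D : set T) (f g : T -> R) :
  measurable D -> m.-integrable D (EFin \o f) -> m.-integrable D (EFin \o g) ->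
  m.-integrable D (EFin \o (fun x => f x + g x)).
Proof. by move=> mD fi gi; exact: (@integrableD _ _ _ m D mD _ _ fi gi). Qed.

Lemma eq_integrable_in d (T : measurableType d) (R : realType)
    (m : {measure set T -> \bar R}) (D : set T) (f g : T -> R) :
  measurable D -> {in D, f =1 g} -> m.-integrable D (EFin \o f) ->
  m.-integrable D (EFin \o g).
Proof. by move=> mD fg; apply: eq_integrable => // x xD; rewrite /= fg. Qed.

Lemma integrable_bounded d (T : measurableType d) (R : realType)
    (m : {measure set T -> \bar R}) (D : set T) (f : T -> R) (k : R) :
  measurable D -> (m D < +oo)%E -> measurable_fun D f ->
  (forall x, D x -> `|f x| <= k) -> m.-integrable D (EFin \o f).
Proof.
move=> mD Dfin mf fk; apply: measurable_bounded_integrable => //.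
exists k; split; first exact: num_real.
by move=> M kM x Dx /=; apply: (le_trans (fk x Dx)); exact: ltW.
Qed.

Lemma lebesgue_itvcc_lty (R : realType) (a b : R) :
  (@lebesgue_measure R `[a, b]%classic < +oo)%E.
Proof.
by rewrite lebesgue_measure_itv/=; case: ifP => _; rewrite -?EFinB ltry.
Qed.

Lemma Rintegral_itv_split (R : realType) (f : R -> R) (a c b : R) :
  a <= c -> c <= b ->
  (@lebesgue_measure R).-integrable `[a, b] (EFin \o f) ->
  \int[@lebesgue_measure R]_(x in `[a, b]) f x =
  \int[@lebesgue_measure R]_(x in `[a, c]) f x +
  \int[@lebesgue_measure R]_(x in `[c, b]) f x.
Proof.
move=> ac cb fi; apply/eqP; rewrite addrC -subr_eq; apply/eqP.
rewrite Rintegral_itvB// ?bnd_simp//.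
rewrite Rintegral_itv_obnd_cbnd//.
by apply: integrableS fi => //; apply: subset_itvr; rewrite bnd_simp.
Qed.

(** * Integrals of power functions with an endpoint singularity *)

Section singular_FTC.
Context {R : realType}.
Local Notation mu := (@lebesgue_measure R).

(** The integrand may blow up at the ends: exhaust the interval from inside and
    use monotone convergence, the primitive being continuous up to the ends. *)
Lemma ge0_improper_FTC2 (f F : R -> R) (a b : R) : a < b ->
  (forall x, a < x < b -> 0 <= f x) ->
  {within `[a, b], continuous F} ->
  (forall x, a < x < b -> is_derive x 1 F (f x)) ->
  {in `]a, b[, continuous f} ->
  (\int[mu]_(x in `[a, b]) (f x)%:E = (F b - F a)%:E)%E.
Proof.
move=> ab f0 cF dF cf.
(* The factor 3 keeps the shrunken intervals nonempty for every n. *)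
pose e (n : nat) : R := (b - a) / 3 * harmonic n.
have ba : 0 < b - a by rewrite subr_gt0.
have ba3 : 0 < (b - a) / 3 by rewrite divr_gt0.
have e0 n : 0 < e n by rewrite mulr_gt0// harmonic_gt0.
have e3 n : e n <= (b - a) / 3.
  by rewrite /e ger_pMr// /harmonic/= invf_le1// ler1n.
have e2 n : a + e n < b - e n by have := e3 n; have := e0 n; lra.
have ndecr n m : (n <= m)%N -> e m <= e n.
  by move=> nm; rewrite /e ler_pM2l// /harmonic/= lef_pV2 ?posrE// ler_nat ltnS.
have ecvg : e n @[n --> \oo] --> (0:R).
  rewrite -[X in _ --> X](mulr0 ((b - a) / 3)).
  by apply: cvgM; [exact: cvg_cst|exact: cvg_harmonic].
have [cFi Fa Fb] := (continuous_within_itvP F ab).1 cF.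
have mf : measurable_fun `]a, b[ f.
  by apply: open_continuous_measurable_fun => // x; rewrite inE/= => /cf.
pose S n := `[a + e n, b - e n]%classic.
have SU : \bigcup_n S n = `]a, b[%classic.
  apply/seteqP; split => x /=.
    move=> [n _]; rewrite /S /= !in_itv/= => /andP[h1 h2].
    by have := e0 n; lra.
  rewrite in_itv/= => /andP[ax xb].
  have m0 : 0 < Num.min (x - a) (b - x) by rewrite lt_min !subr_gt0 ax.
  have /cvgrPdist_lt /(_ _ m0)[N _ /(_ N (leqnn _))] := ecvg.
  rewrite /= sub0r normrN gtr0_norm// lt_min => /andP[h1 h2].
  by exists N => //; rewrite /S /= in_itv/=; lra.
have SI n : S n `<=` `]a, b[.
  by rewrite -SU; exact: bigcup_sup.
rewrite (@integral_itv_bndoo _ _ _ (EFin \o f)); last exact/measurable_EFinP.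
have intS n : (\int[mu]_(x in S n) (f x)%:E = (F (b - e n) - F (a + e n))%:E)%E.
  rewrite EFinB (@continuous_FTC2 _ f F)//.
  - apply: continuous_subspaceW (SI n) _.
    by apply: continuous_in_subspaceT => x; rewrite inE/= => /cf.
  - have dSF x : a < x < b -> derivable F x 1 by move=> /dF[].
    have cSF x : a < x < b -> F z @[z --> x] --> F x.
      by move=> xab; apply: cFi; rewrite in_itv.
    have := e0 n; have := e2 n => e2n e0n; split.
    + by move=> x; rewrite in_itv/= => xi; apply: dSF; lra.
    + by apply: cvg_at_right_filter; apply: cSF; lra.
    + by apply: cvg_at_left_filter; apply: cSF; lra.
  - move=> x xi; rewrite derive1E.
    have : (`]a, b[%classic : set R) x by apply: (SI n); move: xi; rewrite /S /= !in_itv/= => /andP[/ltW -> /ltW].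
    by rewrite /= in_itv/= => /dF h; rewrite derive_val.
have c1 : (\int[mu]_(x in S n) (f x)%:E)%E @[n --> \oo] -->
    (\int[mu]_(x in `]a, b[) (f x)%:E)%E.
  rewrite -SU; apply: ge0_nondecreasing_set_cvg_integral.
  - move=> n m nm; rewrite subsetEset => x; rewrite /S /= !in_itv/=.
    by have := ndecr _ _ nm; lra.
  - by move=> n; exact: measurable_itv.
  - by move=> n; apply/measurable_EFinP; apply: measurable_funS mf => //; exact: SI.
  - by move=> n x /SI; rewrite /= in_itv/= lee_fin => /f0.
have c2 : (\int[mu]_(x in S n) (f x)%:E)%E @[n --> \oo] --> (F b - F a)%:E.
  under eq_fun do rewrite intS.
  apply: cvg_EFin; first exact: nearW.
  apply: cvgB.
  - move/cvg_at_leftP : Fb => /(_ (fun n => b - e n)); apply; split.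
      by move=> n; have := e0 n; lra.
    by rewrite -[X in _ --> X]subr0; apply: cvgB => //; exact: cvg_cst.
  - move/cvg_at_rightP : Fa => /(_ (fun n => a + e n)); apply; split.
      by move=> n; have := e0 n; lra.
    by rewrite -[X in _ --> X]addr0; apply: cvgD => //; exact: cvg_cst.
by rewrite -(cvg_lim _ c1)// -(cvg_lim _ c2).
Qed.
End singular_FTC.

Section abel_kernel.
Context {R : realType}.
Local Notation mu := (@lebesgue_measure R).
Implicit Types (a t p m : R) (phi : R -> R).

Lemma cvg_powR0 {T : Type} (G : set_system T) {FG : Filter G} (f : T -> R) p :
  0 < p -> (\forall x \near G, 0 <= f x) -> f x @[x --> G] --> (0 : R) ->
  f x `^ p @[x --> G] --> (0 : R).
Proof.
move=> p0 f0 /cvgrPdist_lt f_cvg; apply/cvgrPdist_lt => e e0.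
have e'0 : 0 < e `^ p^-1 by rewrite powR_gt0.
near=> x.
have fx0 : 0 <= f x by near: x.
rewrite sub0r normrN ger0_norm ?powR_ge0//.
have -> : e = (e `^ p^-1) `^ p.
  by rewrite -powRrM mulVf ?gt_eqF// powRr1// ltW.
rewrite gt0_ltr_powR ?nnegrE// ?powR_ge0//.
rewrite -[X in X < _](ger0_norm fx0) -normrN -[X in `|X|]sub0r.
by near: x; exact: f_cvg.
Unshelve. all: by end_near. Qed.

Lemma is_derive_continuous (f : R -> R) (x df : R) :
  is_derive x 1 f df -> f z @[z --> x] --> f x.
Proof.
by case=> dfx _; apply: differentiable_continuous; exact/derivable1_diffP.
Qed.

Lemma is_derive_subl (t s : R) : is_derive s 1 (fun x : R => t - x) (-1).
Proof.
have := is_deriveB (is_derive_cst t s 1) (is_derive_id s 1).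
by rewrite sub0r.
Qed.

Lemma is_derive_subr (r s : R) : is_derive s 1 (fun x : R => x - r) 1.
Proof.
have := is_deriveB (is_derive_id s 1) (is_derive_cst r s 1).
by rewrite subr0.
Qed.

Lemma is_derive_powR_comp (g : R -> R) (x dg p : R) : 0 < g x ->
  is_derive x 1 g dg ->
  is_derive x 1 (fun s => g s `^ p) (p * g x `^ (p - 1) * dg).
Proof.
move=> g0 dgx.
have := @is_derive1_comp _ (fun y => y `^ p) g x _ _ (is_derive1_powR p g0) dgx.
by [].
Qed.

(** For [p < 1] the kernel is singular at [t], yet its primitive is continuous
    there, which is all the improper fundamental theorem asks for. *)
Lemma integral_abel_kernel p a t : 0 < p -> a <= t ->
  (\int[mu]_(s in `[a, t]) ((t - s) `^ (p - 1))%:E = ((t - a) `^ p / p)%:E)%E.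
Proof.
move=> p0; rewrite le_eqVlt => /predU1P[->|at_].
  by rewrite set_itv1 integral_set1 subrr powR0 ?gt_eqF// mul0r.
pose F s : R := - ((t - s) `^ p / p).
have dF s : s < t -> is_derive s 1 F ((t - s) `^ (p - 1)).
  move=> st; rewrite /F.
  have h2 := @is_derive_powR_comp (fun s => t - s) s _ p _ (is_derive_subl t s).
  have {}h2 := h2 ltac:(by rewrite /= subr_gt0).
  have -> : (fun s => - ((t - s) `^ p / p)) = (fun s => (- p^-1) *: ((t - s) `^ p : R)).
    by apply/funext => z; rewrite /GRing.scale/=; ring.
  apply: is_derive_eq; rewrite /GRing.scale/=.
  by field; rewrite gt_eqF.
transitivity (F t - F a)%:E; last first.
  by rewrite /F subrr powR0 ?gt_eqF// mul0r oppr0 sub0r opprK.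
apply: (@ge0_improper_FTC2 _ _ F) => //.
- by move=> *; exact: powR_ge0.
- apply/continuous_within_itvP => //; split.
  + move=> x; rewrite in_itv/= => /andP[_ xt].
    by apply: differentiable_continuous; apply/derivable1_diffP; case: (dF x xt).
  + apply: cvg_at_right_filter.
    by apply: differentiable_continuous; apply/derivable1_diffP; case: (dF a at_).
  + rewrite /F subrr powR0 ?gt_eqF//.
    apply: cvgN; apply: cvgM; last exact: cvg_cst.
    apply: cvg_powR0 => //.
      by near=> s; rewrite subr_ge0; near: s; exact: nbhs_left_le.
    rewrite -(subrr t); apply: cvgB; first exact: cvg_cst.
    by apply: cvg_at_left_filter; exact: cvg_id.
- by move=> x /andP[_]; exact: dF.
- move=> x; rewrite in_itv/= => /andP[_ xt].
  apply: differentiable_continuous; apply/derivable1_diffP.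
  by have [] := @is_derive_powR_comp (fun s => t - s) x _ (p - 1)
    ltac:(by rewrite subr_gt0) (is_derive_subl t x).
Unshelve. all: by end_near. Qed.

(** Away from the singularity any nonzero exponent is allowed, in particular the
    negative ones that occur in the derivative of the kernel. *)
Lemma integral_powR_away p a b t : p != 0 -> a <= b -> b < t ->
  (\int[mu]_(s in `[a, b]) ((t - s) `^ (p - 1))%:E =
   (((t - a) `^ p - (t - b) `^ p) / p)%:E)%E.
Proof.
move=> p0; rewrite le_eqVlt => /predU1P[->|ab] bt.
  by rewrite set_itv1 integral_set1 subrr mul0r.
pose F s : R := - ((t - s) `^ p / p).
have dF s : s < t -> is_derive s 1 F ((t - s) `^ (p - 1)).
  move=> st; rewrite /F.
  have h2 := @is_derive_powR_comp (fun s => t - s) s _ p _ (is_derive_subl t s).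
  have {}h2 := h2 ltac:(by rewrite /= subr_gt0).
  have -> : (fun s => - ((t - s) `^ p / p)) = (fun s => (- p^-1) *: ((t - s) `^ p : R)).
    by apply/funext => z; rewrite /GRing.scale/=; ring.
  by apply: is_derive_eq; rewrite /GRing.scale/=; field.
transitivity (F b - F a)%:E; last by rewrite /F; congr EFin; ring.
apply: (@ge0_improper_FTC2 _ _ F) => //.
- by move=> *; exact: powR_ge0.
- apply/continuous_within_itvP => //; split.
  + move=> x; rewrite in_itv/= => /andP[_ xt].
    exact: (is_derive_continuous (dF x (lt_trans xt bt))).
  + apply: cvg_at_right_filter.
    exact: (is_derive_continuous (dF a (lt_trans ab bt))).
  + apply: cvg_at_left_filter.
    exact: (is_derive_continuous (dF b bt)).
- by move=> x /andP[_ xb]; apply: dF; exact: lt_trans bt.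
- move=> x; rewrite in_itv/= => /andP[_ xb].
  apply: (is_derive_continuous (@is_derive_powR_comp (fun s => t - s)
     x _ (p - 1) _ (is_derive_subl t x))).
  by rewrite subr_gt0; exact: lt_trans bt.
Qed.

Lemma measurable_abel_kernel (D : set R) t p :
  measurable_fun D (fun s : R => (t - s) `^ p).
Proof.
apply: measurable_funTS; apply: (measurableT_comp (measurable_powR p)).
by apply: measurable_funB.
Qed.

Lemma integrable_abel_kernel p a t : 0 < p -> a <= t ->
  mu.-integrable `[a, t] (EFin \o (fun s => (t - s) `^ (p - 1))).
Proof.
move=> p0 at_; apply/integrableP; split.
  by apply/measurable_EFinP; exact: measurable_abel_kernel.
under eq_integral do rewrite /= ger0_norm ?powR_ge0//.
by rewrite integral_abel_kernel// ltry.
Qed.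

Lemma integrable_abel p a t m phi : 0 < p -> a <= t ->
  measurable_fun `[a, t] phi -> (forall s, a <= s <= t -> `|phi s| <= m) ->
  mu.-integrable `[a, t] (EFin \o (fun s => (t - s) `^ (p - 1) * phi s)).
Proof.
move=> p0 at_ mphi phim.
have := @integrableMl _ _ _ mu `[a, t]%classic (measurable_itv _) _ phi
  (integrable_abel_kernel p0 at_) mphi.
apply; exists m; split; first exact: num_real.
by move=> M mM s /=; rewrite in_itv/= => /phim /le_trans; apply; exact: ltW.
Qed.
End abel_kernel.

(** * Abel integrals and the approximate identity that inverts them *)

Section abel_exchange.
Context {R : realType}.
Local Notation mu := (@lebesgue_measure R).
Variables (alpha delta t : R).

Definition abel (phi : R -> R) (s : R) : R :=
  \int[mu]_(r in `[0, s]) ((s - r) `^ (alpha - 1) * phi r).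

(** This is the derivative of [s |-> (t + delta - s)^-alpha], the regularised
    kernel of the fractional derivative at time [t]. *)
Definition dker (s : R) : R := alpha * (t + delta - s) `^ (- alpha - 1).

(** The value of the Beta-type integral of the two kernels, computed in closed
    form by [integral_beta_weight]. *)
Definition beta_weight (r : R) : R :=
  (t - r) `^ alpha * delta `^ (- alpha) / (t + delta - r).

Lemma powR_pred (x p : R) : 0 < x -> x `^ p = x * x `^ (p - 1).
Proof.
move=> x0; rewrite -{2}(powRr1 (ltW x0)) -powRD; last by rewrite (gt_eqF x0) ?implybT.
by rewrite addrC subrK.
Qed.

Lemma dker_ge0 s : 0 < alpha -> 0 <= dker s.
Proof. by move=> alpha0; rewrite mulr_ge0 ?powR_ge0// ltW. Qed.

Lemma measurable_dker D : measurable_fun D dker.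
Proof. by apply: measurable_funM => //; exact: measurable_abel_kernel. Qed.

(** The closed form is possible because
    [(s - r)^alpha (t + delta - s)^-alpha / (t + delta - r)] is a primitive of
    the integrand: the exponents add up to zero. *)
Lemma integral_beta_weight r : 0 < alpha -> 0 < delta -> r <= t ->
  (\int[mu]_(s in `[r, t]) (dker s * (s - r) `^ (alpha - 1))%:E
   = (beta_weight r)%:E)%E.
Proof.
move=> alpha0 delta0; rewrite le_eqVlt => /predU1P[->|rt].
  by rewrite set_itv1 integral_set1 /beta_weight subrr powR0 ?gt_eqF// !mul0r.
have tdr : 0 < t + delta - r by lra.
pose F s : R := (s - r) `^ alpha * (t + delta - s) `^ (- alpha) / (t + delta - r).
have dF s : r < s -> s <= t -> is_derive s 1 F (dker s * (s - r) `^ (alpha - 1)).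
  move=> rs st.
  have h1 := @is_derive_powR_comp _ (fun x => x - r) s _ alpha
     ltac:(by rewrite subr_gt0) (is_derive_subr r s).
  have h2 := @is_derive_powR_comp _ (fun x => t + delta - x) s _ (- alpha)
     ltac:(by rewrite subr_gt0; lra) (is_derive_subl (t + delta) s).
  have h3 := is_deriveM h1 h2.
  have h4 := is_deriveZ (t + delta - r)^-1 h3.
  have -> : F = (t + delta - r)^-1 \*: ((fun x : R => (x - r) `^ alpha) *
      (fun x : R => (t + delta - x) `^ (- alpha))).
    by apply/funext => z; rewrite /F /= mulrC.
  apply: (is_derive_eq h4).
  have sr : 0 < s - r by lra.
  have ts : 0 < t + delta - s by lra.
  rewrite /dker /GRing.scale/= (powR_pred alpha sr) (powR_pred (- alpha) ts).
  by field; rewrite gt_eqF.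
have cF s : r < s -> s <= t -> {for s, continuous F}.
  move=> rs st.
  by apply: differentiable_continuous; apply/derivable1_diffP; case: (dF s rs st).
transitivity (F t - F r)%:E; last first.
  rewrite /F subrr powR0 ?gt_eqF// !mul0r subr0 /beta_weight.
  by have -> : t + delta - t = delta by ring.
apply: (@ge0_improper_FTC2 _ _ F) => //.
- by move=> x _; rewrite mulr_ge0 ?dker_ge0 ?powR_ge0.
- apply/continuous_within_itvP => //; split.
  + by move=> x; rewrite in_itv/= => /andP[rx /ltW]; exact: cF.
  + rewrite /F subrr powR0 ?gt_eqF// mul0r.
    apply: cvgM; last exact: cvg_cst.
    rewrite -[X in _ --> X](mul0r ((t + delta - r) `^ (- alpha))).
    apply: cvgM.
      apply: cvg_powR0 => //.
        by near=> s; rewrite subr_ge0; near: s; exact: nbhs_right_ge.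
      rewrite -(subrr r); apply: cvgB; last exact: cvg_cst.
      by apply: cvg_at_right_filter; exact: cvg_id.
    apply: cvg_at_right_filter.
    apply: (is_derive_continuous (@is_derive_powR_comp _ (fun x => t + delta - x)
     r _ (- alpha) _ (is_derive_subl (t + delta) r))).
    by rewrite subr_gt0; lra.
  + by apply: cvg_at_left_filter; exact: cF.
- by move=> x /andP[rx /ltW]; exact: dF.
- move=> x; rewrite in_itv/= => /andP[rx xt].
  apply: continuousM.
    apply: continuousM; first exact: cst_continuous.
    apply: (is_derive_continuous (@is_derive_powR_comp _ (fun x => t + delta - x)
     x _ (- alpha - 1) _ (is_derive_subl (t + delta) x))).
    by rewrite subr_gt0; lra.
  apply: differentiable_continuous; apply/derivable1_diffP.
  by have [] := @is_derive_powR_comp _ (fun z => z - r) x _ (alpha - 1)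
    ltac:(by rewrite subr_gt0) (is_derive_subr r x).
Unshelve. all: by end_near. Qed.

(** The integrand of the double integral in [abel_exchange], extended by zero
    off the triangle [0 <= r <= s <= t] so that Fubini applies on the plane. *)
Definition tri_kernel (psi : R -> R) (z : R * R) : R :=
  (dker z.1 * \1_(`]-oo, t]%classic) z.1) *
  (((z.1 - z.2) `^ (alpha - 1) * \1_(`[0, +oo[%classic) (z.1 - z.2)) *
   (psi \_ `[0, t]) z.2).

Lemma measurable_tri_kernel psi : measurable_fun `[0, t] psi ->
  measurable_fun setT (EFin \o tri_kernel psi).
Proof.
move=> mpsi; apply/measurable_EFinP; apply: measurable_funM.
  apply: (measurableT_comp (f := fun x => dker x * \1_(`]-oo, t]%classic) x)) => //.
  by apply: measurable_funM; [exact: measurable_dker|exact: measurable_indic].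
apply: measurable_funM.
  apply: (measurableT_comp (f := fun x => x `^ (alpha - 1) * \1_(`[0, +oo[%classic) x)).
    by apply: measurable_funM; [exact: measurable_powR|exact: measurable_indic].
  by apply: measurable_funB.
apply: (measurableT_comp (f := psi \_ `[0, t])) => //.
exact: (measurable_restrictT _ _).1.
Qed.

Lemma tri_kernel_row psi s :
  (fun r => (tri_kernel psi (s, r))%:E) =
  if 0 <= s <= t then
    (fun r => (dker s * ((s - r) `^ (alpha - 1) * psi r))%:E) \_ `[0, s]
  else cst 0%E.
Proof.
apply/funext => r; rewrite /tri_kernel /= /patch !indicE.
rewrite !mem_setE !in_itv /= andbT subr_ge0.
have [s0|s0] := leP 0 s; have [st|st] := leP s t => /=;
  rewrite ?(mulr0,mul0r,mulr1) //.
  rewrite in_itv/=.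
  have [r0|r0] := leP 0 r; have [rs|rs] := leP r s => /=;
    rewrite ?(mulr0,mul0r,mulr1)//.
  by rewrite (le_trans rs st).
have [r0|r0] := leP 0 r; last by rewrite !mulr0.
have [rs|rs] := leP r s => /=; last by rewrite !(mulr0, mul0r).
by have := le_lt_trans (le_trans r0 rs) s0; rewrite ltxx.
Qed.

Lemma tri_kernel_col psi r :
  (fun s => (tri_kernel psi (s, r))%:E) =
  if 0 <= r <= t then
    (fun s => (psi r * (dker s * (s - r) `^ (alpha - 1)))%:E) \_ `[r, t]
  else cst 0%E.
Proof.
apply/funext => s; rewrite /tri_kernel /= /patch !indicE.
rewrite !mem_setE !in_itv /= andbT subr_ge0.
have [r0|r0] := leP 0 r; have [rt|rt] := leP r t => /=;
  rewrite ?(mulr0,mul0r,mulr1) //.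
rewrite in_itv/=.
have [rs|rs] := leP r s; have [st|st] := leP s t => /=;
  rewrite ?(mulr0,mul0r,mulr1)//.
by congr EFin; ring.
Qed.

Lemma measurable_beta_weight : 0 < delta -> measurable_fun `[0, t] beta_weight.
Proof.
move=> delta0.
apply: (@eq_measurable_fun _ _ _ _ _
  (fun r : R => (t - r) `^ alpha * delta `^ (- alpha) * (t + delta - r) `^ (-1))).
  move=> r; rewrite inE/= in_itv/= => /andP[_ rt].
  by rewrite /beta_weight powR_inv1//; lra.
apply: measurable_funM; last exact: measurable_abel_kernel.
by apply: measurable_funM => //; exact: measurable_abel_kernel.
Qed.

Hypotheses (alpha0 : 0 < alpha) (delta0 : 0 < delta) (t0 : 0 <= t).

Lemma tri_kernel_int_row (psi : R -> R) (m s : R) : measurable_fun `[0, t] psi ->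
  (forall r, 0 <= r <= t -> `|psi r| <= m) ->
  (\int[mu]_r (tri_kernel psi (s, r))%:E =
   ((EFin \o (fun s => dker s * abel psi s)%R) \_ `[0%R, t]) s)%E.
Proof.
move=> mpsi psim; rewrite tri_kernel_row [RHS]/patch mem_itvcc.
case: ifP => [/andP[s0 st]|_]; last by rewrite integral0.
have ai : mu.-integrable `[0, s] (EFin \o (fun r => (s - r) `^ (alpha - 1) * psi r)).
  apply: (@integrable_abel _ _ _ _ m) => //.
    by apply: measurable_funS mpsi => //; apply: subset_itvl; rewrite bnd_simp.
  by move=> r /andP[r0 rs]; apply: psim; rewrite r0 (le_trans rs).
rewrite -integral_mkcond /= /abel -RintegralZl// EFin_Rintegral//.
exact: integrable_mull.
Qed.

Lemma tri_kernel_int_col psi r :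
  (\int[mu]_s (tri_kernel psi (s, r))%:E =
   ((EFin \o (fun r => beta_weight r * psi r)%R) \_ `[0%R, t]) r)%E.
Proof.
rewrite tri_kernel_col [RHS]/patch mem_itvcc.
case: ifP => [/andP[r0 rt]|_]; last by rewrite integral0.
rewrite -integral_mkcond.
under eq_integral do rewrite EFinM.
have bw := integral_beta_weight alpha0 delta0 rt.
have ai : mu.-integrable `[r, t]
    (EFin \o (fun s => dker s * (s - r) `^ (alpha - 1))).
  apply/integrableP; split.
    apply/measurable_EFinP; apply: measurable_funM; first exact: measurable_dker.
    apply: measurable_funTS; apply: (measurableT_comp (measurable_powR (alpha - 1))).
    by apply: measurable_funB.
  under eq_integral => s _ do
    rewrite /= (ger0_norm (mulr_ge0 (dker_ge0 s alpha0) (powR_ge0 _ _))).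
  by rewrite bw ltry.
by rewrite integralZl// bw -EFinM mulrC.
Qed.

Lemma beta_weight_bound r : 0 <= r <= t ->
  0 <= beta_weight r <= t `^ alpha * delta `^ (- alpha) / delta.
Proof.
move=> /andP[r0 rt]; have := alpha0; have := delta0 => dlt0 alp0.
rewrite /beta_weight; apply/andP; split.
  by rewrite !mulr_ge0 ?powR_ge0// invr_ge0; lra.
apply: ler_pM.
- by rewrite mulr_ge0 ?powR_ge0.
- by rewrite invr_ge0; lra.
- apply: ler_wpM2r; first exact: powR_ge0.
  by apply: ge0_ler_powR; rewrite ?nnegrE; lra.
- by rewrite lef_pV2 ?posrE; lra.
Qed.

Lemma tri_kernel_integrable (psi : R -> R) (m : R) : measurable_fun `[0, t] psi ->
  (forall r, 0 <= r <= t -> `|psi r| <= m) ->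
  (mu \x mu)%E.-integrable setT (EFin \o tri_kernel psi).
Proof.
move=> mpsi psim; apply/integrable21ltyP.
  exact: measurable_tri_kernel.
have nE s r : (`|(EFin \o tri_kernel psi) (s, r)|
    = (tri_kernel (fun x => `|psi x|%R) (s, r))%:E)%E.
  rewrite /= /tri_kernel /dker !normrM !(ger0_norm (powR_ge0 _ _)).
  rewrite (ger0_norm (ltW alpha0)) !indicE !normr_nat.
  by congr (_ * (_ * _))%:E; rewrite /patch; case: ifP => // _; rewrite normr0.
under eq_integral => r _.
  under eq_integral => s _ do rewrite nE.
  rewrite tri_kernel_int_col.
  over.
rewrite -integral_mkcond.
pose B := t `^ alpha * delta `^ (- alpha) / delta * m.
apply: (@le_lt_trans _ _ (\int[mu]_(r in `[0%R, t]) (cst B%:E r))%E).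
  apply: ge0_le_integral => //.
  - by move=> r; rewrite /= in_itv/= => /beta_weight_bound /andP[h _]; rewrite lee_fin mulr_ge0.
  - apply/measurable_EFinP; apply: measurable_funM.
      exact: measurable_beta_weight.
    by apply: measurableT_comp.
  - move=> r; rewrite /= in_itv/= => rt; rewrite lee_fin.
    have /andP[h1 h2] := beta_weight_bound rt.
    by apply: ler_pM => //; exact: psim.
rewrite integral_cst//=; rewrite lebesgue_measure_itv/=.
by case: ifP => _; rewrite -?EFinB -?EFinM ?mule0 ltry.
Qed.

(** Fubini on the triangle: the inner integral over [s] is explicit. *)
Lemma abel_exchange (psi : R -> R) (m : R) : measurable_fun `[0, t] psi ->
  (forall r, 0 <= r <= t -> `|psi r| <= m) ->
  mu.-integrable `[0, t] (EFin \o (fun s => dker s * abel psi s)) /\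
  \int[mu]_(s in `[0, t]) (dker s * abel psi s) =
  \int[mu]_(r in `[0, t]) (beta_weight r * psi r).
Proof.
move=> mpsi psim; have ti := tri_kernel_integrable mpsi psim.
have FE : (fun s => \int[mu]_r (tri_kernel psi (s, r))%:E)%E =
  (EFin \o (fun s => dker s * abel psi s)) \_ `[0, t].
  by apply/funext => s; exact: tri_kernel_int_row psim.
have GE : (fun r => \int[mu]_s (tri_kernel psi (s, r))%:E)%E =
  (EFin \o (fun r => beta_weight r * psi r)) \_ `[0, t].
  by apply/funext => s; exact: tri_kernel_int_col.
split.
  apply/integrable_mkcond => //; rewrite -FE.
  exact: (integrable_fubini_F ti).
have := Fubini ti.
rewrite /= FE GE -!integral_mkcond => FG.
by rewrite /Rintegral; congr fine.
Qed.

(** The kernel left after combining the endpoint term and the integral term of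
    the memory functional applied to an Abel integral. As [delta] tends to 0
    it concentrates at [r = t]. *)
Definition abel_approx (r : R) : R :=
  delta `^ (1 - alpha) * (t - r) `^ (alpha - 1) / (t + delta - r).

Lemma abel_approxE r : alpha < 1 -> r <= t ->
  abel_approx r = delta `^ (- alpha) * (t - r) `^ (alpha - 1) - beta_weight r.
Proof.
move=> alpha1; have := delta0 => dl0.
rewrite le_eqVlt => /predU1P[->|rt].
  rewrite /abel_approx /beta_weight subrr !powR0; [by rewrite !(mul0r,mulr0) subr0| |].
  - by rewrite gt_eqF.
  - by rewrite lt_eqF// subr_lt0.
have tr : 0 < t - r by lra.
rewrite /abel_approx /beta_weight (powR_pred alpha tr) (powR_pred (1 - alpha) dl0).
have -> : 1 - alpha - 1 = - alpha by ring.
by field; rewrite gt_eqF//; lra.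
Qed.

Lemma abel_approx_ge0 r : r <= t -> 0 <= abel_approx r.
Proof.
by move=> rt; have := delta0; rewrite /abel_approx => dl0;
  rewrite !mulr_ge0 ?powR_ge0// invr_ge0; lra.
Qed.

Lemma integrable_beta_mul (psi : R -> R) (m : R) : measurable_fun `[0, t] psi ->
  (forall r, 0 <= r <= t -> `|psi r| <= m) ->
  mu.-integrable `[0, t] (EFin \o (fun r => beta_weight r * psi r)).
Proof.
move=> mpsi psim; pose B := t `^ alpha * delta `^ (- alpha) / delta.
apply: (@integrable_bounded _ _ _ _ _ _ (B * m)) => //.
- exact: lebesgue_itvcc_lty.
- by apply: measurable_funM => //; exact: measurable_beta_weight.
- move=> r; rewrite /= in_itv/= => rt.
  have /andP[h1 h2] := beta_weight_bound rt.
  by rewrite normrM ger0_norm//; apply: ler_pM => //; exact: psim.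
Qed.

Lemma integrable_abel_approx (psi : R -> R) (m : R) : alpha < 1 ->
  measurable_fun `[0, t] psi -> (forall r, 0 <= r <= t -> `|psi r| <= m) ->
  mu.-integrable `[0, t] (EFin \o (fun r => abel_approx r * psi r)) /\
  delta `^ (- alpha) * abel psi t -
    \int[mu]_(s in `[0, t]) (dker s * abel psi s) =
  \int[mu]_(r in `[0, t]) (abel_approx r * psi r).
Proof.
move=> alpha1 mpsi psim.
have i1 : mu.-integrable `[0, t]
    (EFin \o (fun r => delta `^ (- alpha) * ((t - r) `^ (alpha - 1) * psi r))).
  by apply: integrable_mull => //; exact: (@integrable_abel _ _ _ _ m).
have i2 := integrable_beta_mul mpsi psim.
have E (r : R) : r \in `[0, t]%classic -> abel_approx r * psi r =
   delta `^ (- alpha) * ((t - r) `^ (alpha - 1) * psi r) - beta_weight r * psi r.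
  rewrite mem_itvcc => /andP[_ rt].
  by rewrite abel_approxE//; ring.
split.
  by apply: eq_integrable_in (integrable_subr _ i1 i2) => // r rt; rewrite /= E.
under [RHS]eq_Rintegral => r rt do rewrite (E r rt).
rewrite RintegralB// (abel_exchange mpsi psim).2.
by rewrite RintegralZl//; exact: (@integrable_abel _ _ _ _ m).
Qed.

(** Only two-sided bounds on the mass, uniform in [delta], are asked for. The part
    within [delta] of [t] carries at least half, and at most all, of
    [1 / alpha]; the tail contributes at most [1 / (1 - alpha)]. *)
Lemma abel_approx_mass : alpha < 1 -> delta <= t ->
  (2 * alpha)^-1 <= \int[mu]_(r in `[0, t]) abel_approx r
     <= alpha^-1 + (1 - alpha)^-1.
Proof.
move=> alpha1 dt.
have := delta0 => dl0.
have [iH _] := @integrable_abel_approx (cst 1) 1 alpha1 (@measurable_cst _ _ _ _ _ _)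
  (fun _ _ => ltac:(by rewrite /= normr1)).
have {}iH : mu.-integrable `[0, t] (EFin \o abel_approx).
  by apply: eq_integrable_in iH => // r _; rewrite /= mulr1.
have a_ge0 : 0 <= t - delta by lra.
have at_ : t - delta <= t by lra.
have sub1 : `[0, t - delta] `<=` (`[0, t] : set R).
  by apply: subset_itvl; rewrite bnd_simp.
have sub2 : `[t - delta, t] `<=` (`[0, t] : set R).
  by apply: subset_itvr; rewrite bnd_simp.
rewrite (Rintegral_itv_split a_ge0 at_ iH).
have iH1 : mu.-integrable `[0, t - delta] (EFin \o abel_approx).
  by apply: integrableS iH.
have iH2 : mu.-integrable `[t - delta, t] (EFin \o abel_approx).
  by apply: integrableS iH.
have dd : delta `^ (- alpha) * delta `^ alpha = 1.
  by rewrite powRN mulVf// gt_eqF// powR_gt0.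
have dd1 : delta `^ (1 - alpha) * delta `^ (alpha - 1) = 1.
  by rewrite -(opprB 1) powRN mulfV// gt_eqF// powR_gt0.
have ik := integrable_abel_kernel alpha0 at_.
have ikE k : \int[mu]_(r in `[t - delta, t]) (k * (t - r) `^ (alpha - 1)) =
   k * (delta `^ alpha / alpha).
  rewrite RintegralZl//; congr (_ * _).
  rewrite /Rintegral integral_abel_kernel//= opprB addrC subrK//.
have H2 r : t - delta <= r <= t ->
   2^-1 * delta `^ (- alpha) * (t - r) `^ (alpha - 1) <= abel_approx r
   <= delta `^ (- alpha) * (t - r) `^ (alpha - 1).
  move=> /andP[r1 r2].
  have -> : abel_approx r = delta / (t + delta - r) *
      (delta `^ (- alpha) * (t - r) `^ (alpha - 1)).
    rewrite /abel_approx (powR_pred (1 - alpha) dl0).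
    have -> : 1 - alpha - 1 = - alpha by ring.
    by ring.
  rewrite -mulrA; apply/andP; split.
    apply: ler_wpM2r; first by rewrite mulr_ge0 ?powR_ge0.
    by rewrite ler_pdivlMr; lra.
  apply: ler_piMl; first by rewrite mulr_ge0 ?powR_ge0.
  by rewrite ler_pdivrMr; lra.
have low : (2 * alpha)^-1 <= \int[mu]_(r in `[t - delta, t]) abel_approx r.
  have -> : (2 * alpha)^-1 = 2^-1 * delta `^ (- alpha) * (delta `^ alpha / alpha).
    by rewrite mulrA -(mulrA 2^-1) dd mulr1 invfM.
  rewrite -ikE; apply: le_Rintegral => //; first exact: integrable_mull.
  by move=> r; rewrite /= in_itv/= => /H2/andP[].
have upp : \int[mu]_(r in `[t - delta, t]) abel_approx r <= alpha^-1.
  have -> : alpha^-1 = delta `^ (- alpha) * (delta `^ alpha / alpha).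
    by rewrite mulrA dd mul1r.
  rewrite -ikE; apply: le_Rintegral => //; first exact: integrable_mull.
  by move=> r; rewrite /= in_itv/= => /H2/andP[].
have p1 : alpha - 1 != 0 by rewrite lt_eqF// subr_lt0.
have ik2 : mu.-integrable `[0, t - delta] (EFin \o (fun r => (t - r) `^ (alpha - 1 - 1))).
  apply/integrableP; split.
    by apply/measurable_EFinP; exact: measurable_abel_kernel.
  under eq_integral do rewrite /= ger0_norm ?powR_ge0//.
  by rewrite integral_powR_away//; [rewrite ltry|lra].
have upp2 : \int[mu]_(r in `[0, t - delta]) abel_approx r <= (1 - alpha)^-1.
  apply: (@le_trans _ _ (\int[mu]_(r in `[0, t - delta])
     (delta `^ (1 - alpha) * (t - r) `^ (alpha - 1 - 1)))).
    apply: le_Rintegral => //; first exact: integrable_mull.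
    move=> r; rewrite /= in_itv/= => /andP[r0 r1].
    rewrite /abel_approx -mulrA; apply: ler_wpM2l; first exact: powR_ge0.
    have tr : 0 < t - r by lra.
    rewrite (powR_pred (alpha - 1) tr) mulrAC.
    apply: ler_piMl; first exact: powR_ge0.
    by rewrite ler_pdivrMr; lra.
  rewrite RintegralZl// /Rintegral integral_powR_away//=; last by lra.
  have -> : t - (t - delta) = delta by ring.
  have -> : delta `^ (1 - alpha) * ((((t - 0) `^ (alpha - 1)) - delta `^ (alpha - 1)) / (alpha - 1))
     = (delta `^ (1 - alpha) * delta `^ (alpha - 1) - delta `^ (1 - alpha) * (t - 0) `^ (alpha - 1)) / (1 - alpha).
    by field; rewrite p1 gt_eqF// subr_gt0.
  rewrite dd1 -[leRHS]mul1r; apply: ler_wpM2r; first by rewrite invr_ge0; lra.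
  by rewrite gerBl mulr_ge0 ?powR_ge0.
have ge01 : 0 <= \int[mu]_(r in `[0, t - delta]) abel_approx r.
  by apply: Rintegral_ge0 => r; rewrite /= in_itv/= => /andP[_ r1]; apply: abel_approx_ge0; lra.
apply/andP; split; first by rewrite -[leLHS]add0r lerD.
by rewrite addrC lerD.
Qed.

End abel_exchange.

(** * Time differentiability of Abel integrals *)

Section affine_change.
Context {R : realType}.
Local Notation mu := (@lebesgue_measure R).

Definition affine (a l : R) (y : measurableTypeR R) : measurableTypeR R := a + l * y.

Lemma measurable_affine a l : measurable_fun setT (affine a l).
Proof. by apply: measurable_funD => //; apply: measurable_funM. Qed.

Lemma affine_preimage_itv (a l : R) (x y : R) b1 b2 : 0 < l ->
  affine a l @^-1` [set` Interval (BSide b1 x) (BSide b2 y)] =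
  [set` Interval (BSide b1 ((x - a) / l)) (BSide b2 ((y - a) / l))].
Proof.
move=> l0; apply/seteqP; rewrite /affine.
by split => z /=; rewrite !itv_boundlr; case: b1; case: b2;
  rewrite !bnd_simp ?ler_pdivrMr ?ler_pdivlMr ?ltr_pdivrMr ?ltr_pdivlMr//;
  rewrite ?lerBlDl ?lerBrDl ?ltrBlDl ?ltrBrDl (mulrC z).
Qed.

(** Uniqueness of Lebesgue measure: both sides agree on intervals. *)
Lemma lebesgue_measure_affine (a l : R) (A : set R) : 0 < l -> measurable A ->
  mu A = (l%:E * mu (affine a l @^-1` A))%E.
Proof.
move=> l0 mA; pose mf := isMeasurableFun.Build _ _ _ _ _ (measurable_affine a l).
pose g : {mfun _ >-> _} := HB.pack (affine a l) mf.
apply: (@lebesgue_measure_unique _ (mscale (NngNum (ltW l0)) (pushforward mu g))) => //.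
move=> _ [[x y]] _ <-; rewrite /= /mscale /= /pushforward.
have := affine_preimage_itv a x y false false l0; rewrite /= => ->.
rewrite !lebesgue_measure_itv/= !lte_fin ltr_pM2r ?invr_gt0// ltrD2r.
case: ifP => _; last by rewrite mule0.
by rewrite -!EFinB -EFinM; congr EFin; field; rewrite gt_eqF.
Qed.

Lemma ge0_integral_affine (a l : R) (f : R -> \bar R) : 0 < l ->
  measurable_fun `[a, a + l] f -> (forall x, 0 <= f x)%E ->
  (\int[mu]_(x in `[a, (a + l)%R]) f x =
   l%:E * \int[mu]_(y in `[0%R, 1%R]) f (a + l * y)%R)%E.
Proof.
move=> l0 mf f0; pose mg := isMeasurableFun.Build _ _ _ _ _ (measurable_affine a l).
pose g : {mfun _ >-> _} := HB.pack (affine a l) mg.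
rewrite (@eq_measure_integral _ _ _ _ (mscale (NngNum (ltW l0)) (pushforward mu g))); last first.
  by move=> A mA _; exact: lebesgue_measure_affine.
rewrite ge0_integral_mscale//; congr (_ * _)%E.
rewrite ge0_integral_pushforward//.
have := affine_preimage_itv a a (a + l) true false l0; rewrite /= => ->.
by rewrite subrr mul0r (addrC a) addrK divff// gt_eqF.
Qed.

Lemma Rintegral_affine (a l : R) (f : R -> R) : 0 < l ->
  measurable_fun `[a, a + l] f ->
  mu.-integrable `[0, 1] (EFin \o (fun y => f (a + l * y))) ->
  \int[mu]_(x in `[a, a + l]) f x = l * \int[mu]_(y in `[0, 1]) f (a + l * y).
Proof.
move=> l0 mf fi; rewrite /Rintegral.
have mfE : measurable_fun `[a, a + l] (EFin \o f) by exact/measurable_EFinP.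
have lE : l = fine l%:E by [].
rewrite {2}lE -fineM//; last exact: integrable_fin_num.
congr fine; rewrite [LHS]integralE [in RHS]integralE.
rewrite (ge0_integral_affine l0 (measurable_funepos mfE))//.
rewrite (ge0_integral_affine l0 (measurable_funeneg mfE))//.
have Ep : (fun y => (f (a + l * y))%:E)^\+%E = (fun y => (EFin \o f)^\+%E (a + l * y)).
  by apply/funext => y; rewrite !funeposE.
have En : (fun y => (f (a + l * y))%:E)^\-%E = (fun y => (EFin \o f)^\-%E (a + l * y)).
  by apply/funext => y; rewrite !funenegE.
have key (I1 I2 : \bar R) : I2 \is a fin_num ->
    (l%:E * I1 - l%:E * I2 = l%:E * (I1 - I2))%E.
  by move=> I2f; rewrite muleBr// fin_num_adde_defl// fin_numN.
rewrite -Ep -En; apply: key; exact: (integrable_neg_fin_num _ fi).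
Qed.

End affine_change.

Section abel_operator.
Context {R : realType}.
Local Notation mu := (@lebesgue_measure R).
Implicit Types (alpha delta t m T : R) (phi psi : R -> R).

Lemma Rintegral_sum d (X : measurableType d) (nu : {measure set X -> \bar R})
    (D : set X) (I : Type) (s : seq I) (f : I -> X -> R) :
  measurable D -> (forall i, nu.-integrable D (EFin \o f i)) ->
  nu.-integrable D (EFin \o (fun x => \sum_(i <- s) f i x)) /\
  \int[nu]_(x in D) (\sum_(i <- s) f i x) = \sum_(i <- s) \int[nu]_(x in D) f i x.
Proof.
move=> mD fi; elim: s => [|i s [ih1 ih2]].
  split; last by rewrite big_nil; under eq_Rintegral do rewrite big_nil; rewrite Rintegral_cst// mul0r.
  by apply: eq_integrable (integrable0 nu D) => // x _; rewrite /= big_nil.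
have E : (fun x => \sum_(j <- i :: s) f j x) = (fun x => f i x + \sum_(j <- s) f j x).
  by apply/funext => x; rewrite big_cons.
by rewrite E big_cons; split; [exact: integrable_addr|rewrite RintegralD// ih2].
Qed.

Lemma within_itvcc_bounded_measurable (a b : R) (f : R -> R) : a <= b ->
  {within `[a, b], continuous f} ->
  measurable_fun `[a, b] f /\ exists m, forall x, a <= x <= b -> `|f x| <= m.
Proof.
move=> ab cf; split; first exact: subspace_continuous_measurable_fun.
have cnf : {within `[a, b], continuous (fun x => `|f x|)}.
  by move=> x; apply: continuous_comp; [exact: cf|exact: norm_continuous].
have [c _ fc] := EVT_max ab cnf.
by exists (`|f c|) => x xab; apply: fc; rewrite in_itv.
Qed.

Lemma abel_bound alpha t m phi : 0 < alpha -> 0 <= t ->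
  measurable_fun `[0, t] phi -> (forall s, 0 <= s <= t -> `|phi s| <= m) ->
  `|abel alpha phi t| <= m * (t `^ alpha / alpha).
Proof.
move=> a0 t0 mphi phim; rewrite /abel.
have i1 := integrable_abel a0 t0 mphi phim.
apply: (le_trans (le_normr_Rintegral _ i1)) => //.
have ik := integrable_abel_kernel a0 t0.
apply: (@le_trans _ _ (\int[mu]_(s in `[0, t]) (m * (t - s) `^ (alpha - 1)))).
  apply: le_Rintegral => //; [exact: integrable_norm i1|exact: integrable_mull|].
  move=> s; rewrite /= in_itv/= => /phim ms.
  by rewrite normrM ger0_norm ?powR_ge0// mulrC ler_wpM2r// powR_ge0.
by rewrite RintegralZl// /Rintegral integral_abel_kernel//= subr0.
Qed.

Lemma abel_sum alpha t (I : Type) (s : seq I) (k : I -> R) (phi : I -> R -> R) :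
  0 < alpha -> 0 <= t ->
  (forall i, {within `[0, t], continuous (phi i)}) ->
  abel alpha (fun x => \sum_(i <- s) k i * phi i x) t =
  \sum_(i <- s) k i * abel alpha (phi i) t.
Proof.
move=> a0 t0 cphi; rewrite /abel.
have ii i : mu.-integrable `[0, t] (EFin \o (fun r => (t - r) `^ (alpha - 1) * phi i r)).
  have [mf [m fm]] := within_itvcc_bounded_measurable t0 (cphi i).
  exact: integrable_abel fm.
have E : (fun r => (t - r) `^ (alpha - 1) * (\sum_(i <- s) k i * phi i r)) =
  (fun r => \sum_(i <- s) k i * ((t - r) `^ (alpha - 1) * phi i r)).
  by apply/funext => r; rewrite mulr_sumr; apply: eq_bigr => i _; rewrite mulrCA.
rewrite E; have [||_ ->] := @Rintegral_sum _ _ mu `[0, t]%classic I s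
  (fun i r => k i * ((t - r) `^ (alpha - 1) * phi i r)).
- by [].
- by move=> i; exact: integrable_mull.
by apply: eq_bigr => i _; rewrite RintegralZl.
Qed.

(** The mass of [abel_approx] away from [t] is of order [delta^(1 - alpha)], so
    only the values of [psi] near [t] count in the limit. The factor [k] is the
    total mass and may vary with [delta] between its bounds. *)
Lemma abel_approximation alpha t m psi : 0 < alpha < 1 -> 0 < t ->
  measurable_fun `[0, t] psi -> (forall s, 0 <= s <= t -> `|psi s| <= m) ->
  psi s @[s --> t^'-] --> psi t ->
  forall e, 0 < e -> \forall delta \near 0^'+,
    exists k, (2 * alpha)^-1 <= k <= alpha^-1 + (1 - alpha)^-1 /\
      k * psi t - e <= delta `^ (- alpha) * abel alpha psi t -
        \int[mu]_(s in `[0, t]) (dker alpha delta t s * abel alpha psi s).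
Proof.
move=> /andP[a0 a1] t0 mpsi psim cpsi e e0.
have t0' := ltW t0.
pose C : R := alpha^-1 + (1 - alpha)^-1.
have C0 : 0 < C by rewrite addr_gt0// invr_gt0// subr_gt0.
have e20 : 0 < e / 2 by rewrite divr_gt0.
have e'0 : 0 < e / (2 * C) by rewrite divr_gt0// mulr_gt0.
have m0 : 0 <= m by rewrite (le_trans (normr_ge0 (psi 0)))// psim// lexx.
have [eta [eta0 etat Heta]] : exists eta, [/\ 0 < eta, eta <= t &
    forall r, t - eta < r -> r <= t -> `|psi t - psi r| <= e / (2 * C)].
  move/cvgrPdist_le : cpsi => /(_ _ e'0) [/= r r0 Hr].
  exists (Num.min r t); split; first by rewrite lt_min r0.
    by rewrite ge_min lexx orbT.
  move=> s; rewrite ltrBlDr -ltrBlDl lt_min => /andP[s1 s2].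
  rewrite le_eqVlt => /predU1P[->|st]; first by rewrite subrr normr0 ltW.
  by apply: Hr => //=; rewrite gtr0_norm ?subr_gt0.
pose B delta : R := 2 * m * t * (eta `^ (alpha - 1) / eta) * delta `^ (1 - alpha).
have Bcvg : B delta @[delta --> 0^'+] --> (0 : R).
  rewrite -[X in _ --> X](mulr0 (2 * m * t * (eta `^ (alpha - 1) / eta))).
  apply: cvgM; first exact: cvg_cst.
  by apply: powR_cvg0; rewrite subr_gt0.
near=> delta.
have d0 : 0 < delta by near: delta; exact: nbhs_right_gt.
have dt : delta <= t by near: delta; exact: nbhs_right_le.
have Be : B delta <= e / 2.
  apply: (le_trans (ler_norm _)); rewrite -normrN -sub0r.
  by near: delta; move/cvgrPdist_le : Bcvg => /(_ _ e20).
have [iH ->] := integrable_abel_approx a0 d0 t0' a1 mpsi psim.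
have kmass := abel_approx_mass a0 d0 t0' a1 dt.
set H := abel_approx alpha delta t in iH kmass *.
exists (\int[mu]_(r in `[0, t]) H r); split => //.
have iH1 : mu.-integrable `[0, t] (EFin \o H).
  have [iH1 _] := @integrable_abel_approx _ _ _ _ a0 d0 t0' (cst 1) 1 a1
    (@measurable_cst _ _ _ _ _ _) (fun _ _ => ltac:(by rewrite /= normr1)).
  by apply: eq_integrable_in iH1 => // r _; rewrite /= mulr1.
rewrite lerBlDl -lerBlDr mulrC -RintegralZl// -RintegralB//; last first.
  exact: integrable_mull.
pose b := 2 * m * (eta `^ (alpha - 1) / eta) * delta `^ (1 - alpha).
have ib : mu.-integrable `[0, t] (EFin \o cst b).
  apply: (@integrable_bounded _ _ _ _ _ _ `|b|) => //.
  exact: lebesgue_itvcc_lty.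
apply: (@le_trans _ _ (\int[mu]_(r in `[0, t]) (e / (2 * C) * H r + cst b r))).
  apply: le_Rintegral => //.
  - by apply: integrable_subr => //; exact: integrable_mull.
  - by apply: integrable_addr => //; exact: integrable_mull.
  move=> r; rewrite /= in_itv/= => /andP[r0 rt].
  have H0 : 0 <= H r by exact: abel_approx_ge0.
  have b0 : 0 <= b by rewrite !mulr_ge0 ?powR_ge0// invr_ge0 ltW.
  rewrite [X in _ - X]mulrC -mulrBl.
  have [rl|rl] := ltP (t - eta) r.
    rewrite -[leLHS]addr0; apply: lerD => //; apply: ler_wpM2r => //.
    by rewrite (le_trans (ler_norm _))// Heta.
  rewrite -[leLHS]add0r; apply: lerD.
    by rewrite mulr_ge0// ltW.
  have -> : b = (2 * m) * (delta `^ (1 - alpha) * eta `^ (alpha - 1) / eta).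
    by rewrite /b; ring.
  apply: (le_trans (ler_wpM2r H0 (ler_norm _))); apply: ler_pM => //.
  rewrite (le_trans (ler_normB _ _))// mulr2n mulrDl !mul1r.
  by rewrite lerD// psim ?r0// t0' lexx.
  rewrite /H /abel_approx; apply: ler_pM.
  - by rewrite mulr_ge0 ?powR_ge0.
  - by rewrite invr_ge0; lra.
  - apply: ler_wpM2l; first exact: powR_ge0.
    rewrite -(opprB 1) !powRN lef_pV2 ?posrE ?powR_gt0//; last by lra.
    have [h1 h2] : 0 <= t - r /\ eta <= t - r by split; lra.
    by apply: ge0_ler_powR; rewrite ?nnegrE// ?subr_ge0 ltW.
  - have h1 : eta <= t + delta - r by lra.
    by rewrite lef_pV2 ?posrE//; exact: lt_le_trans h1.
rewrite RintegralD//; last exact: integrable_mull.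
rewrite RintegralZl// Rintegral_cst//= lebesgue_measure_itv/= lte_fin t0/= subr0.
rewrite [leRHS](_ : _ = e / (2 * C) * C + e / 2); last by field; rewrite gt_eqF.
apply: lerD; first by apply: ler_wpM2l; [exact: ltW|case/andP: kmass].
by apply: le_trans Be; rewrite /b /B; nra.
Unshelve. all: by end_near. Qed.

End abel_operator.

Section abel_derivable.
Context {R : realType}.
Local Notation mu := (@lebesgue_measure R).
Implicit Types (alpha a b t x T : R) (phi : R -> R).

Lemma itvoo_inside (a b x : R) : (`]a, b[%classic : set R) x <-> a < x < b.
Proof. by rewrite /= in_itv. Qed.

(** The kernel and its singularity move with [x]. Splitting at [a] and mapping
    the singular part to the unit interval moves the [x]-dependence off the
    singularity, into a smooth kernel on [[0, a]] and into the argument of [phi]. *)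
Lemma abel_split alpha a x phi : 0 < alpha -> 0 <= a -> a < x ->
  measurable_fun `[0, x] phi -> (exists m, forall s, 0 <= s <= x -> `|phi s| <= m) ->
  abel alpha phi x =
  \int[mu]_(s in `[0, a]) ((x - s) `^ (alpha - 1) * phi s) +
  (x - a) `^ alpha * \int[mu]_(y in `[0, 1])
     ((1 - y) `^ (alpha - 1) * phi (a + (x - a) * y)).
Proof.
move=> al0 a0 ax mphi [m phim].
have xa0 : 0 < x - a by rewrite subr_gt0.
have x0 : 0 <= x by lra.
have ii := integrable_abel al0 x0 mphi phim.
have ax_s : `[a, x] `<=` (`[0, x] : set R) by apply: subset_itvr; rewrite bnd_simp.
rewrite /abel (Rintegral_itv_split a0 (ltW ax))//; congr (_ + _).
have xE : a + (x - a) = x by ring.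
have mf : measurable_fun `[a, a + (x - a)] (fun s => (x - s) `^ (alpha - 1) * phi s).
  rewrite xE.
  by apply: measurable_funM; [exact: measurable_abel_kernel|exact: measurable_funS mphi].
have E (y : R) : y \in `[0, 1]%classic ->
    (x - (a + (x - a) * y)) `^ (alpha - 1) * phi (a + (x - a) * y) =
    (x - a) `^ (alpha - 1) * ((1 - y) `^ (alpha - 1) * phi (a + (x - a) * y)).
  rewrite mem_itvcc => /andP[_ y1].
  have -> : x - (a + (x - a) * y) = (x - a) * (1 - y) by ring.
  by rewrite powRM ?mulrA// ?subr_ge0// ltW.
have i01 : mu.-integrable `[0, 1]
    (EFin \o (fun y => (1 - y) `^ (alpha - 1) * phi (a + (x - a) * y))).
  apply: (@integrable_abel _ _ _ _ m) => //.
    apply: (@measurable_comp _ _ _ _ _ _ `[a, x]%classic) => //.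
    - move=> _ [y /= + <-]; rewrite !in_itv/= => /andP[y0 y1].
      apply/andP; split; first by rewrite lerDl mulr_ge0// ltW.
      by rewrite -[leRHS]xE lerD2l ler_piMr// ltW.
    - by apply: measurable_funS mphi.
    - by apply: measurable_funTS; exact: (measurable_affine a (x - a)).
  move=> y /andP[y0 y1]; apply: phim; apply/andP; split.
    by rewrite addr_ge0// mulr_ge0// ltW.
  by rewrite -[leRHS]xE lerD2l ler_piMr// ltW.
have i01' : mu.-integrable `[0, 1] (EFin \o (fun y =>
    (x - (a + (x - a) * y)) `^ (alpha - 1) * phi (a + (x - a) * y))).
  apply: eq_integrable_in (integrable_mull ((x - a) `^ (alpha - 1)) _ i01) => //.
  by move=> y /E ->.
have := Rintegral_affine xa0 mf i01'; rewrite xE => ->.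
under eq_Rintegral => y y01 do rewrite (E y y01).
by rewrite RintegralZl// mulrA -powR_pred.
Qed.

Lemma powR_anti (p x y : R) : p <= 0 -> 0 < x -> x <= y -> y `^ p <= x `^ p.
Proof.
move=> p0 x0 xy; have y0 := lt_le_trans x0 xy.
have [q q0 ->] : exists2 q, 0 <= q & p = - q by exists (- p); rewrite ?oppr_ge0 ?opprK.
rewrite !powRN lef_pV2 ?posrE ?powR_gt0//.
by apply: ge0_ler_powR; rewrite ?nnegrE// ltW.
Qed.

Lemma is_derive_partial (f df : R -> R -> R) (x y : R) :
  is_derive x 1 (f ^~ y) (df x y) -> partial1of2 f x y = df x y.
Proof. by move=> h; rewrite partial1of2E; case: h. Qed.

Lemma near_derivable_add_mul (A f g h : R -> R) (u v t : R) : u < t < v ->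
  (forall x, u < x < v -> A x = f x + g x * h x) ->
  derivable f t 1 -> derivable g t 1 -> derivable h t 1 -> derivable A t 1.
Proof.
move=> tuv AE df dg dh.
have dgh : derivable (g * h) t 1 by exact: (derivableM dg dh).
have dfgh : derivable (f + g * h) t 1 by exact: (derivableD df dgh).
apply: near_eq_derivable dfgh => //.
have /near_in_itvoo : t \in `]u, v[ by rewrite in_itv.
by apply: filterS => x; rewrite in_itv/= => /AE ->.
Qed.

(** After [abel_split], each of the two integrals can be differentiated under
    the integral sign: the first has a smooth kernel, the second a bounded
    derivative of [phi] against an integrable kernel. *)
Lemma abel_derivable alpha T phi t : 0 < alpha < 1 -> 0 < t < T ->
  {within `[0, T], continuous phi} ->
  (forall x, 0 < x < T -> derivable phi x 1) ->
  (forall a b, 0 < a -> b < T ->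
     exists k, forall x, a <= x <= b -> `|derive1 phi x| <= k) ->
  derivable (abel alpha phi) t 1.
Proof.
move=> /andP[al0 al1] /andP[t0 tT] cphi dphi dphib.
have T0 : 0 <= T by lra.
have [mphi [m phim]] := within_itvcc_bounded_measurable T0 cphi.
have m0 : 0 <= m by rewrite (le_trans (normr_ge0 (phi 0)))// phim// lexx.
(* Split at a, and let x range over a neighbourhood of t that stays away from
   both a and T. *)
pose a := t / 2; pose u := 3 / 4 * t; pose v := (t + T) / 2.
have a0 : 0 < a by rewrite /a; lra.
have a0' := ltW a0.
have au : a < u by rewrite /a /u; lra.
have tuv : u < t < v by rewrite /u /v; lra.
have vT : v < T by rewrite /v; lra.
have tI : (`]u, v[%classic : set R) t by rewrite /= in_itv.
pose f1 (x s : R) : R := (x - s) `^ (alpha - 1) * phi s.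
pose f2 (x y : R) : R := (1 - y) `^ (alpha - 1) * phi (a + (x - a) * y).
have sub0a x : u < x -> `[0, a] `<=` (`[0, x] : set R).
  by move=> ux; apply: subset_itvl; rewrite bnd_simp; lra.
have sub0T x : x < v -> `[0, x] `<=` (`[0, T] : set R).
  by move=> ux; apply: subset_itvl; rewrite bnd_simp; lra.
have mphia : measurable_fun `[0, a] phi.
  by apply: measurable_funS mphi => //; apply: subset_itvl; rewrite bnd_simp; lra.
have d1 : derivable (fun x => \int[mu]_(s in `[0, a]) f1 x s) t 1.
  pose df1 (x s : R) : R := (alpha - 1) * (x - s) `^ (alpha - 1 - 1) * 1 * phi s.
  have hdf x s : u < x < v -> s <= a -> is_derive x 1 (f1 ^~ s) (df1 x s).
    move=> /andP[ux xv] sa; rewrite /f1 /df1.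
    have h := @is_derive_powR_comp _ (fun x => x - s) x _ (alpha - 1)
      ltac:(by rewrite subr_gt0; lra) (is_derive_subr s x).
    have -> : (fun x => (x - s) `^ (alpha - 1) * phi s) =
      phi s \*: (fun x => (x - s) `^ (alpha - 1)) by apply/funext => z; rewrite mulrC.
    by apply: is_derive_eq; rewrite /GRing.scale/= mulrC.
  have pb p x s : p <= 0 -> u < x -> s <= a -> (x - s) `^ p <= (u - a) `^ p.
    move=> p0 ux sa; have h : u - a <= x - s by lra.
    by apply: powR_anti => //; rewrite subr_gt0.
  apply: (@derivable_under_integral _ _ _ mu f1 `[0, a]%classic _ t u v tI _ _
    (cst (`|alpha - 1| * (u - a) `^ (alpha - 1 - 1) * m))).
  - exact: measurable_itv.
  - move=> x /itvoo_inside/andP[ux xv].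
    apply: (@integrable_bounded _ _ _ _ _ _ ((u - a) `^ (alpha - 1) * m)) => //.
    + exact: lebesgue_itvcc_lty.
    + by apply: measurable_funM => //; exact: measurable_abel_kernel.
    + move=> s; rewrite /= in_itv/= => /andP[s0 sa].
      rewrite normrM ger0_norm ?powR_ge0//; apply: ler_pM => //; first exact: powR_ge0.
        by apply: pb => //; lra.
      by apply: phim; lra.
  - move=> x s /itvoo_inside xuv /=; rewrite in_itv/= => /andP[_ sa].
    by case: (hdf x s xuv sa).
  - by move=> y; rewrite /= !mulr_ge0// powR_ge0.
  - apply: (@integrable_bounded _ _ _ _ _ _ (`|alpha - 1| * (u - a) `^ (alpha - 1 - 1) * m)) => //.
      exact: lebesgue_itvcc_lty.
    by move=> s _; rewrite /= ger0_norm// !mulr_ge0// powR_ge0.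
  - move=> x s /itvoo_inside xuv /=; rewrite in_itv/= => /andP[s0 sa].
    have /andP[ux xv] := xuv.
    rewrite (is_derive_partial (hdf x s xuv sa)) /df1 !normrM normr1 mulr1.
    rewrite (ger0_norm (powR_ge0 _ _)); apply: ler_pM => //.
    + by rewrite mulr_ge0// powR_ge0.
    + by apply: ler_wpM2l => //; apply: pb => //; lra.
    + by apply: phim; lra.
have [k Hk] := dphib a v a0 vT.
have k0 : 0 <= k by rewrite (le_trans (normr_ge0 (derive1 phi a)))// Hk// lexx/=; lra.
have rng x y : u < x < v -> 0 <= y <= 1 -> a <= a + (x - a) * y <= v.
  move=> /andP[ux xv] /andP[y0 y1].
  have xa : 0 <= x - a by lra.
  apply/andP; split; first by rewrite lerDl mulr_ge0.
  apply: (@le_trans _ _ (a + (x - a))); first by rewrite lerD2l ler_piMr.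
  by lra.
have d2 : derivable (fun x => \int[mu]_(y in `[0, 1]) f2 x y) t 1.
  pose df2 (x y : R) : R := (1 - y) `^ (alpha - 1) * (derive1 phi (a + (x - a) * y) * y).
  have hdf x y : u < x < v -> 0 <= y <= 1 -> is_derive x 1 (f2 ^~ y) (df2 x y).
    move=> xuv y01; rewrite /f2 /df2.
    have [r1 r2] := andP (rng x y xuv y01).
    have h1 : is_derive x 1 (fun x : R => a + (x - a) * y) y.
      have := is_deriveD (is_derive_cst a x 1) (is_deriveZ y (is_derive_subr a x)).
      rewrite add0r /GRing.scale/= mulr1 => h; apply: (is_derive_eq _ (erefl y)).
      by rewrite (_ : (fun x => _) = (cst a + y \*: (fun x0 : R => x0 - a))) //; apply/funext => z; rewrite mulrC.
    have h2 : is_derive (a + (x - a) * y) 1 phi (derive1 phi (a + (x - a) * y)).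
      by rewrite derive1E; apply/derivableP; apply: dphi; lra.
    have h3 := @is_derive1_comp _ phi (fun x => a + (x - a) * y) x _ _ h2 h1.
    by have := is_deriveZ ((1 - y) `^ (alpha - 1)) h3.
  apply: (@derivable_under_integral _ _ _ mu f2 `[0, 1]%classic _ t u v tI _ _
    (fun y => k * (1 - y) `^ (alpha - 1))).
  - exact: measurable_itv.
  - move=> x /itvoo_inside xuv.
    apply: (@integrable_abel _ _ _ _ m) => //; last first.
      by move=> y y01; have := rng x y xuv y01 => /andP[h1 h2]; apply: phim; lra.
    have [ux xv] := andP xuv.
    apply: (@measurable_comp _ _ _ _ _ _ `[0, T]%classic) => //.
    + move=> _ [y /= + <-]; rewrite !in_itv/= => /(rng x y xuv)/andP[h1 h2].
      by apply/andP; split; lra.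
    + by apply: measurable_funTS; exact: (measurable_affine a (x - a)).
  - move=> x y /itvoo_inside xuv /=; rewrite in_itv/= => y01.
    by case: (hdf x y xuv y01).
  - by move=> y; rewrite mulr_ge0// powR_ge0.
  - by apply: integrable_mull => //; exact: integrable_abel_kernel.
  - move=> x y /itvoo_inside xuv /=; rewrite in_itv/= => y01.
    rewrite (is_derive_partial (hdf x y xuv y01)) /df2 !normrM.
    rewrite (ger0_norm (powR_ge0 _ _)) mulrC ler_wpM2r ?powR_ge0//.
    have [y0 y1] := andP y01.
    rewrite (ger0_norm y0) -[leRHS]mulr1; apply: ler_pM => //.
    by apply: Hk; exact: rng.
have d3 : derivable (fun x => (x - a) `^ alpha) t 1.
  by have [] := @is_derive_powR_comp _ (fun x => x - a) t _ alpha
      ltac:(by rewrite subr_gt0; lra) (is_derive_subr a t).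
apply: (near_derivable_add_mul tuv _ d1 d3 d2) => x /andP[ux xv].
apply: abel_split => //; first by lra.
  by apply: measurable_funS mphi => //; exact: sub0T.
by exists m => s s0x; apply: phim; lra.
Qed.

End abel_derivable.

(** * One-sided increments and first zeros of continuous functions *)

Section real_lemmas.
Context {R : realType}.
Implicit Types (a b x : R) (f g : R -> R).

Lemma within_cvg a b f : {within `[a, b], continuous f} ->
  forall x, a <= x <= b -> forall e, 0 < e ->
  exists2 r, 0 < r & forall y, a <= y <= b -> `|x - y| < r -> `|f x - f y| < e.
Proof.
move=> cf x xab e e0.
have xA : (`[a, b]%classic : set R) x by rewrite /= in_itv.
move/subspace_continuousP : cf => /(_ x xA).
move=> /cvgrPdist_lt /(_ e e0); rewrite /prop_near1 /nbhs/= /within/=.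
by case=> r /= r0 Hr; exists r => // y yab xy; apply: Hr; rewrite //= in_itv.
Qed.

(** A mean value inequality that asks for a one-sided upper growth bound only;
    it is applied to a function that is a frozen differentiable function plus a
    Lipschitz perturbation. *)
Lemma dini_le a b f (k : R) : a <= b -> {within `[a, b], continuous f} ->
  (forall x, a <= x < b -> forall e, 0 < e ->
     \forall h \near 0^'+, f (x + h) <= f x + (k + e) * h) ->
  f b <= f a + k * (b - a).
Proof.
move=> ab cf Hf.
(* With the slack e, look at the last point at which the bound holds: the growth
   condition would carry the bound beyond it. *)
suff H e : 0 < e -> f b <= f a + (k + e) * (b - a).
  apply/ler_addgt0Pl => e e0.
  have ba1 : 0 < b - a + 1 by rewrite ltr_wpDl// subr_ge0.
  have := H (e / (b - a + 1)) (divr_gt0 e0 ba1).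
  move/le_trans; apply; rewrite mulrDl addrA addrC lerD2r.
  by rewrite -mulrA ger_pMr// ler_pdivrMl// mulr1 lerDl.
move=> e0; rewrite leNgt; apply/negP => fb.
pose g x := f x - f a - (k + e) * (x - a).
have cg : {within `[a, b], continuous g}.
  move=> x; apply: cvgB.
    by apply: cvgB; [exact: cf|exact: cvg_cst].
  apply: cvgM; first exact: cvg_cst.
  apply: cvgB; last exact: cvg_cst.
  exact: (continuous_subspaceT (fun x => cvg_id)).
pose A := [set x | a <= x <= b /\ g x <= 0].
have A0 : A a by split; rewrite ?lexx//= /g !subrr mulr0 subrr.
have ubA : ubound A b by move=> x [/andP[_ ->]].
have supA : has_sup A by split; [exists a|exists b].
pose c := sup A.
have ac : a <= c by apply: ub_le_sup => //; exists b.
have cb : c <= b by apply: ge_sup => //; exists a.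
have cab : a <= c <= b by rewrite ac.
have gc : g c <= 0.
  rewrite leNgt; apply/negP => gc.
  have [r r0 Hr] := within_cvg cg cab gc.
  have [x [xab gx] cx] := sup_adherent r0 supA.
  have xc : x <= c by apply: ub_le_sup => //; exists b.
  have cxr : c - x < r by rewrite -/c in cx; lra.
  have := Hr x xab; rewrite ger0_norm ?subr_ge0// => /(_ cxr).
  by rewrite ltr_norml; lra.
have {cb} cb : c < b.
  rewrite lt_neqAle cb andbT; apply/eqP => cb'.
  by move: gc; rewrite cb' /g; lra.
have ce : a <= c < b by rewrite ac.
have := Hf c ce e e0 => -[/= r r0 Hr].
pose h := Num.min (r / 2) (b - c).
have h0 : 0 < h by rewrite lt_min divr_gt0//= subr_gt0.
have hr : h < r by rewrite (@le_lt_trans _ _ (r / 2)) ?ge_min ?lexx//; lra.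
have hb : h <= b - c by rewrite /h ge_min lexx orbT.
have := Hr h; rewrite /= sub0r normrN gtr0_norm// => /(_ hr h0) fh.
have Ah : A (c + h).
  split; first by lra.
  by move: gc; rewrite /g; lra.
have : c + h <= c by apply: ub_le_sup => //; exists b.
by lra.
Qed.

Lemma first_zero b g : 0 <= b -> {within `[0, b], continuous g} ->
  g 0 < 0 -> 0 <= g b ->
  exists t, [/\ 0 < t <= b, g t = 0 & forall s, 0 <= s < t -> g s < 0].
Proof.
move=> b0 cg g0 gb.
pose A := [set x | 0 <= x <= b /\ 0 <= g x].
have A0 : A b by split; rewrite ?lexx ?b0.
have lbA : lbound A 0 by move=> x [/andP[->]].
have infA : has_inf A by split; [exists b|exists 0].
pose c := inf A.
have c0 : 0 <= c by apply: lb_le_inf => //; exists b.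
have cb : c <= b by apply: ge_inf => //; exists 0.
have cab : 0 <= c <= b by rewrite c0.
have gc : 0 <= g c.
  rewrite leNgt; apply/negP; rewrite -oppr_gt0 => gc.
  have [r r0 Hr] := within_cvg cg cab gc.
  have [x [xab gx] cx] := inf_adherent r0 infA.
  have xc : c <= x by apply: ge_inf => //; exists 0.
  have cxr : x - c < r by rewrite -/c in cx; lra.
  have := Hr x xab; rewrite distrC ger0_norm ?subr_ge0// => /(_ cxr).
  by rewrite ltr_norml; lra.
have lt s : 0 <= s < c -> g s < 0.
  move=> /andP[s0 sc]; rewrite ltNge; apply/negP => gs.
  have : c <= s by apply: ge_inf; [exists 0|split=> //; lra].
  by lra.
have {c0} c0 : 0 < c.
  by rewrite lt_neqAle c0 andbT; apply/eqP => c0'; move: gc; rewrite -c0'; lra.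
exists c; split => //; first by rewrite c0.
apply/eqP; rewrite eq_le gc andbT leNgt; apply/negP => gc'.
have [r r0 Hr] := within_cvg cg cab gc'.
pose s := Num.max 0 (c - r / 2).
have s0 : 0 <= s by rewrite le_max lexx.
have sc : s < c by rewrite gt_max c0/=; lra.
have sb : 0 <= s <= b by lra.
have csr : c - s < r.
  have hs : c - r / 2 <= s by rewrite le_max lexx orbT.
  by lra.
have := Hr s sb; rewrite ger0_norm; last by lra.
move=> /(_ csr); rewrite ltr_norml.
have gs : g s < 0 by apply: lt; rewrite s0.
by lra.
Qed.

Lemma cvg_bigsum {X : Type} {F : set_system X} {FF : Filter F} (I : Type)
    (s : seq I) (f : I -> X -> R) (l : I -> R) :
  (forall i, f i x @[x --> F] --> l i) ->
  (\sum_(i <- s) f i x) @[x --> F] --> \sum_(i <- s) l i.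
Proof.
move=> fl; elim: s => [|i s ih].
  by rewrite big_nil; under eq_fun do rewrite big_nil; exact: cvg_cst.
by rewrite big_cons; under eq_fun do rewrite big_cons; exact: cvgD.
Qed.

Lemma is_derive_bigsum (I : Type) (s : seq I) (f : I -> R -> R) (df : I -> R) (x : R) :
  (forall i, is_derive x 1 (f i) (df i)) ->
  is_derive x 1 (fun y => \sum_(i <- s) f i y) (\sum_(i <- s) df i).
Proof.
move=> fl; elim: s => [|i s ih].
  by rewrite big_nil; under eq_fun do rewrite big_nil; exact: is_derive_cst.
rewrite big_cons; under eq_fun do rewrite big_cons.
exact: is_deriveD.
Qed.

End real_lemmas.

(** * Bilinear forms in coordinates *)

Section bilinear.
Context {R : realType} {I : finType}.
Implicit Types (G : I -> I -> R) (p q : I -> R).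

(** The second argument is contracted first; [G i j] pairs coordinate [i] of the
    first argument with coordinate [j] of the second. *)
Definition bil G p q : R := \sum_i (\sum_j q j * G i j) * p i.

Lemma bilDl G p p' q : bil G (fun i => p i + p' i) q = bil G p q + bil G p' q.
Proof. by rewrite /bil -big_split; apply: eq_bigr => i _; rewrite mulrDr. Qed.

Lemma bilZl G p q (k : R) : bil G (fun i => k * p i) q = k * bil G p q.
Proof. by rewrite /bil mulr_sumr; apply: eq_bigr => i _; rewrite mulrCA. Qed.

Lemma bilB_form G G' p q : bil (fun i j => G i j - G' i j) p q = bil G p q - bil G' p q.
Proof.
rewrite /bil -sumrB; apply: eq_bigr => i _; rewrite -mulrBl -sumrB; congr (_ * _).
by apply: eq_bigr => j _; rewrite mulrBr.
Qed.

Lemma bil_sym G p q : (forall i j, G i j = G j i) -> bil G p q = bil G q p.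
Proof.
move=> Gs; rewrite /bil.
under eq_bigr do rewrite mulr_suml.
rewrite exchange_big/=; apply: eq_bigr => i _; rewrite mulr_suml.
by apply: eq_bigr => j _; rewrite Gs; ring.
Qed.

(** Expand [0 <= G(k p - q, k p - q)]. *)
Lemma bil_young G p q (k : R) : (forall i j, G i j = G j i) ->
  (forall p, 0 <= bil G p p) -> 0 < k ->
  bil G p q <= (k * bil G p p + k^-1 * bil G q q) / 2.
Proof.
move=> Gs G0 k0.
have := G0 (fun i => k * p i + (- 1) * q i).
rewrite bilDl !bilZl (bil_sym p _ Gs) (bil_sym q (fun i => _) Gs) !bilDl !bilZl.
rewrite (bil_sym q p Gs) => h.
have -> : (k * bil G p p + k^-1 * bil G q q) / 2 =
  bil G p q + k^-1 * (k * (k * bil G p p + -1 * bil G p q) +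
   -1 * (k * bil G p q + -1 * bil G q q)) / 2 by field; rewrite gt_eqF.
by rewrite lerDl !mulr_ge0// invr_ge0// ltW.
Qed.

Lemma bil_cvg {X : Type} {F : set_system X} {FF : Filter F}
    (G : X -> I -> I -> R) G' (p q : X -> I -> R) p' q' :
  (forall i j, G x i j @[x --> F] --> G' i j) ->
  (forall i, p x i @[x --> F] --> p' i) -> (forall i, q x i @[x --> F] --> q' i) ->
  bil (G x) (p x) (q x) @[x --> F] --> bil G' p' q'.
Proof.
move=> cG cp cq; apply: cvg_bigsum => i; apply: cvgM => //.
by apply: cvg_bigsum => j; exact: cvgM.
Qed.

End bilinear.

(** * A regularised fractional derivative at a fixed time *)

Section volterra_functional.
Context {R : realType}.
Local Notation mu := (@lebesgue_measure R).
Implicit Types (alpha delta t : R) (h : R -> R).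

(** An integration by parts of the integral of [(t + delta - s)^-alpha h'(s)],
    which makes sense for continuous [h]. Up to a factor it is the Caputo
    derivative of order [alpha] at [t], with its singularity shifted by [delta]. *)
Definition memory alpha delta t h : R :=
  delta `^ (- alpha) * h t - (t + delta) `^ (- alpha) * h 0 -
  \int[mu]_(s in `[0, t]) (dker alpha delta t s * h s).

Variables (alpha delta t : R).
Hypotheses (alpha01 : 0 < alpha < 1) (delta0 : 0 < delta) (t0 : 0 <= t).

Lemma integral_dker a b : a <= b -> b <= t ->
  (\int[mu]_(s in `[a, b]) (dker alpha delta t s)%:E =
   ((t + delta - b) `^ (- alpha) - (t + delta - a) `^ (- alpha))%:E)%E.
Proof.
move=> ab bt; have /andP[al0 al1] := alpha01; have d0 := delta0.
rewrite /dker; under eq_integral do rewrite EFinM.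
have bd : b < t + delta by lra.
rewrite ge0_integralZl//; last 3 first.
- by apply/measurable_EFinP; exact: measurable_abel_kernel.
- by move=> x _; rewrite lee_fin powR_ge0.
- by rewrite lee_fin ltW.
have na : - alpha != 0 by rewrite oppr_eq0 gt_eqF.
rewrite (integral_powR_away na ab bd) -EFinM; congr EFin.
by field; rewrite gt_eqF.
Qed.

Lemma integrable_dker_mul h m : measurable_fun `[0, t] h ->
  (forall s, 0 <= s <= t -> `|h s| <= m) ->
  mu.-integrable `[0, t] (EFin \o (fun s => dker alpha delta t s * h s)).
Proof.
move=> mh hm; have /andP[al0 al1] := alpha01; have d0 := delta0.
apply: (@integrable_bounded _ _ _ _ _ _ (alpha * delta `^ (- alpha - 1) * m)) => //.
- exact: lebesgue_itvcc_lty.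
- by apply: measurable_funM => //; exact: measurable_dker.
move=> s; rewrite /= in_itv/= => /andP[s0 st].
rewrite normrM (ger0_norm (dker_ge0 _ _ _ al0)); apply: ler_pM => //.
- exact: dker_ge0.
- rewrite /dker ler_pM2l//; apply: powR_anti => //; lra.
- by apply: hm; rewrite s0.
Qed.

Lemma integrable_dker a b : a <= b -> b <= t ->
  mu.-integrable `[a, b] (EFin \o dker alpha delta t).
Proof.
move=> ab bt; have /andP[al0 al1] := alpha01.
apply/integrableP; split; first by apply/measurable_EFinP; exact: measurable_dker.
under eq_integral => s _ do rewrite /= (ger0_norm (dker_ge0 _ _ _ al0)).
by rewrite integral_dker// ltry.
Qed.

Lemma memoryD (h1 h2 : R -> R) (k : R) :
  mu.-integrable `[0, t] (EFin \o (fun s => dker alpha delta t s * h1 s)) ->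
  mu.-integrable `[0, t] (EFin \o (fun s => dker alpha delta t s * h2 s)) ->
  memory alpha delta t (fun s => h1 s + k * h2 s) =
  memory alpha delta t h1 + k * memory alpha delta t h2 /\
  mu.-integrable `[0, t]
    (EFin \o (fun s => dker alpha delta t s * (h1 s + k * h2 s))).
Proof.
move=> i1 i2; have E : (fun s => dker alpha delta t s * (h1 s + k * h2 s)) =
  (fun s => dker alpha delta t s * h1 s + k * (dker alpha delta t s * h2 s)).
  by apply/funext => s; ring.
have i2k : mu.-integrable `[0, t]
    (EFin \o (fun s => k * (dker alpha delta t s * h2 s))).
  exact: integrable_mull.
split; last by rewrite E; exact: integrable_addr.
by rewrite /memory E RintegralD// RintegralZl//; ring.
Qed.

(** The form of Marchaud: only increments of [h] ending at [t] occur, and with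
    nonnegative weights, which is what makes a maximum principle possible. *)
Lemma memoryE h :
  mu.-integrable `[0, t] (EFin \o (fun s => dker alpha delta t s * h s)) ->
  memory alpha delta t h = (t + delta) `^ (- alpha) * (h t - h 0) +
    \int[mu]_(s in `[0, t]) (dker alpha delta t s * (h t - h s)) /\
  mu.-integrable `[0, t]
    (EFin \o (fun s => dker alpha delta t s * (h t - h s))).
Proof.
move=> ih; have E : (fun s => dker alpha delta t s * (h t - h s)) =
  (fun s => h t * dker alpha delta t s - dker alpha delta t s * h s).
  by apply/funext => s; ring.
have ik := integrable_dker t0 (lexx t).
have ikt : mu.-integrable `[0, t] (EFin \o (fun s => h t * dker alpha delta t s)).
  exact: integrable_mull.
split; last by rewrite E; exact: integrable_subr.
rewrite E RintegralB// RintegralZl// /memory.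
have -> : \int[mu]_(x in `[0, t]) dker alpha delta t x =
   delta `^ (- alpha) - (t + delta) `^ (- alpha).
  rewrite /Rintegral integral_dker//= subr0.
  by have -> : t + delta - t = delta by ring.
by ring.
Qed.

Lemma memory_le h (D : R) : 0 <= D ->
  mu.-integrable `[0, t] (EFin \o (fun s => dker alpha delta t s * h s)) ->
  (forall s, 0 <= s <= t -> h t - h s <= D * (t - s)) ->
  memory alpha delta t h <= D * ((t + delta) `^ (1 - alpha) / (1 - alpha)).
Proof.
move=> D0 ih hD; have [-> ihh] := memoryE ih.
have /andP[al0 al1] := alpha01; have d0 := delta0; have t0' := t0.
have td : 0 < t + delta by lra.
have q1 : 0 < 1 - alpha by rewrite subr_gt0.
have q1n : 1 - alpha != 0 by rewrite gt_eqF.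
have T1 : (t + delta) `^ (- alpha) * (h t - h 0) <= D * (t + delta) `^ (1 - alpha).
  have -> : (t + delta) `^ (1 - alpha) = (t + delta) `^ (- alpha) * (t + delta).
    by rewrite (powR_pred _ td) mulrC; congr (_ `^ _ * _); ring.
  rewrite mulrCA; apply: ler_wpM2l; first exact: powR_ge0.
  have := hD 0; rewrite lexx t0' subr0 => /(_ erefl)/le_trans; apply.
  by apply: ler_wpM2l => //; lra.
pose k2 (s : R) : R := D * alpha * (t + delta - s) `^ (1 - alpha - 1).
have E2 : (\int[mu]_(s in `[0%R, t]) ((t + delta - s) `^ (1 - alpha - 1))%:E =
   (((t + delta) `^ (1 - alpha) - delta `^ (1 - alpha)) / (1 - alpha))%:E)%E.
  have td2 : t < t + delta by lra.
  rewrite (integral_powR_away q1n t0 td2) subr0.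
  by have -> : t + delta - t = delta by ring.
have ik2 : mu.-integrable `[0, t] (EFin \o (fun s => (t + delta - s) `^ (1 - alpha - 1))).
  apply/integrableP; split.
    by apply/measurable_EFinP; exact: measurable_abel_kernel.
  under eq_integral do rewrite /= ger0_norm ?powR_ge0//.
  by rewrite E2 ltry.
have T2 : \int[mu]_(s in `[0, t]) (dker alpha delta t s * (h t - h s)) <=
   D * alpha * ((t + delta) `^ (1 - alpha) / (1 - alpha)).
  apply: (@le_trans _ _ (\int[mu]_(s in `[0, t]) k2 s)).
    apply: le_Rintegral => //; first exact: integrable_mull.
    move=> s; rewrite /= in_itv/= => /andP[s0 st].
    have tds : 0 < t + delta - s by lra.
    apply: (@le_trans _ _ (dker alpha delta t s * (D * (t + delta - s)))).
      apply: ler_wpM2l; first exact: dker_ge0.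
      have := hD s; rewrite s0 st => /(_ erefl)/le_trans; apply.
      by apply: ler_wpM2l => //; lra.
    rewrite /k2 /dker; have -> : 1 - alpha - 1 = - alpha by ring.
    by rewrite (powR_pred (- alpha) tds) le_eqVlt; apply/orP; left; apply/eqP; ring.
  rewrite RintegralZl// /Rintegral E2/=; apply: ler_wpM2l; first by rewrite mulr_ge0// ltW.
  by apply: ler_wpM2r; [rewrite invr_ge0 ltW|rewrite gerBl powR_ge0].
apply: (le_trans (lerD T1 T2)).
by rewrite le_eqVlt; apply/orP; left; apply/eqP; field.
Qed.

(** All increments are nonnegative and those from times before [t - sigma] are at
    least [D]; the weights of these add up to [(sigma + delta)^-alpha]. If
    [t <= sigma], the increment from 0 alone gives the bound. *)
Lemma memory_ge h (D sigma : R) : 0 <= D -> delta <= sigma ->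
  mu.-integrable `[0, t] (EFin \o (fun s => dker alpha delta t s * h s)) ->
  (forall s, 0 <= s <= t -> 0 <= h t - h s) ->
  (forall s, 0 <= s <= t - sigma -> D <= h t - h s) ->
  D <= h t - h 0 ->
  D * (2 * sigma) `^ (- alpha) <= memory alpha delta t h.
Proof.
move=> D0 ds ih h0 hD hD0; have [-> ihh] := memoryE ih.
have /andP[al0 al1] := alpha01; have d0 := delta0; have t0' := t0.
have al_le0 : - alpha <= 0 by lra.
have K0 : (t + delta) `^ (- alpha) * D <= (t + delta) `^ (- alpha) * (h t - h 0).
  by apply: ler_wpM2l; first exact: powR_ge0.
have [ts|ts] := leP t sigma.
  apply: (@le_trans _ _ ((t + delta) `^ (- alpha) * D)).
    rewrite mulrC; apply: ler_wpM2r => //; apply: powR_anti => //; lra.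
  rewrite -[leLHS]addr0; apply: lerD => //.
  apply: Rintegral_ge0 => s; rewrite /= in_itv/= => sI.
  by rewrite mulr_ge0 ?dker_ge0 ?h0.
have ts0 : 0 <= t - sigma by lra.
have tst : t - sigma <= t by lra.
rewrite (Rintegral_itv_split ts0 tst ihh).
have P2 : 0 <= \int[mu]_(x in `[(t - sigma), t]) (dker alpha delta t x * (h t - h x)).
  apply: Rintegral_ge0 => s; rewrite /= in_itv/= => /andP[s0 st].
  by rewrite mulr_ge0 ?dker_ge0 ?h0// st andbT; lra.
have sub1 : `[0, t - sigma] `<=` (`[0, t] : set R).
  by apply: subset_itvl; rewrite bnd_simp.
have P1 : D * ((sigma + delta) `^ (- alpha) - (t + delta) `^ (- alpha)) <=
    \int[mu]_(x in `[0, (t - sigma)]) (dker alpha delta t x * (h t - h x)).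
  have ik := integrable_dker ts0 tst.
  have -> : D * ((sigma + delta) `^ (- alpha) - (t + delta) `^ (- alpha)) =
     \int[mu]_(x in `[0, (t - sigma)]) (D * dker alpha delta t x).
    rewrite RintegralZl// /Rintegral integral_dker//= subr0.
    by have -> : t + delta - (t - sigma) = sigma + delta by ring.
  apply: le_Rintegral => //; [exact: integrable_mull|exact: integrableS ihh|].
  move=> s; rewrite /= in_itv/= => sI; rewrite mulrC; apply: ler_wpM2l; first exact: dker_ge0.
  exact: hD.
have P3 : (2 * sigma) `^ (- alpha) <= (sigma + delta) `^ (- alpha).
  by apply: powR_anti => //; lra.
apply: (@le_trans _ _ (D * (sigma + delta) `^ (- alpha))); first by apply: ler_wpM2l.
rewrite addrA -[leLHS]addr0; apply: lerD => //.
apply: le_trans (lerD K0 P1).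
by rewrite le_eqVlt; apply/orP; left; apply/eqP; ring.
Qed.

End volterra_functional.

(** * Stability of fractional systems *)

Lemma le_sub_step (R : realFieldType) (a b d l e h : R) :
  a - b <= h * e -> - (l * h) <= d -> a - d <= b + (l + e) * h.
Proof. by rewrite mulrDl (mulrC e); lra. Qed.

Lemma le_sub_double (R : realFieldType) (a b d l : R) :
  a <= b + l -> - l <= d -> a - (b + d) <= l *+ 2.
Proof. by rewrite mulr2n; lra. Qed.

Section stability.
Context {R : realType}.
Local Notation mu := (@lebesgue_measure R).
Variables (alpha T c0 M L : R).

(** The coordinate form of the semidiscrete problem: [c] the coordinates of the
    solution, [G], [S] and [B] the mass, stiffness and drift forms, [c0] the
    normalisation of the Abel integral. The fields on [B] keep a free weight [th],
    so that the gradient part can later be absorbed. *)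
Record fractional_system (I : finType) (c : I -> R -> R) (G S : I -> I -> R)
    (B : R -> I -> I -> R) : Prop := FractionalSystem {
  fs_cont : forall i, {within `[0, T], continuous (c i)};
  fs_der : forall i x, 0 < x < T -> derivable (c i) x 1;
  fs_derb : forall i a b, 0 < a -> b < T ->
     exists k, forall x, a <= x <= b -> `|derive1 (c i) x| <= k;
  fs_sym : forall i j, G i j = G j i;
  fs_G : forall p, 0 <= bil G p p;
  fs_S : forall p, 0 <= bil S p p;
  fs_B : forall t p q, 0 < t < T -> forall th, 0 < th ->
    bil (B t) p q <= (th * M ^+ 2 * bil G p p + th^-1 * bil S q q) / 2;
  fs_BL : forall s t p q, 0 < s < T -> 0 < t < T -> forall th, 0 < th ->
    bil (B t) p q - bil (B s) p q <=
      L * `|t - s| * ((th * bil G p p + th^-1 * bil S q q) / 2);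
  fs_eq : forall t tau, 0 < t < T -> 0 <= tau <= T ->
    let dc i := derive1 (c i) t in
    let dv i := derive1 (fun s => c0 * abel alpha (c i) s) t in
    bil G dc (c^~ tau) + bil S dv (c^~ tau) - bil (B t) dv (c^~ tau) = 0 }.

Section fixed_time.
Variables (I : finType) (c : I -> R -> R) (G S : I -> I -> R)
    (B : R -> I -> I -> R).
Hypothesis sys : fractional_system c G S B.
Hypotheses (alpha01 : 0 < alpha < 1) (c0_ge0 : 0 <= c0) (L0 : 0 <= L).

Let w s : I -> R := fun i => abel alpha (c i) s.

Variable t : R.
Hypotheses (t0T : 0 < t < T).
Hypothesis dom : forall s, 0 <= s <= t -> bil G (c^~ s) (c^~ s) <= bil G (c^~ t) (c^~ t).

Let q := c^~ t.
Let Y := bil G q q.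
Let A := bil S q q.

Lemma within_sub (f : R -> R) s : {within `[0, T], continuous f} -> s <= T ->
  {within `[0, s], continuous f}.
Proof.
by move=> cf sT; apply: continuous_subspaceW cf; apply: subset_itvl; rewrite bnd_simp.
Qed.

Lemma bil_abel (H : I -> I -> R) p s : 0 <= s <= T ->
  bil H (w s) p = abel alpha (fun r => bil H (c^~ r) p) s.
Proof.
have /andP[al0 _] := alpha01.
move=> /andP[s0 sT]; rewrite /bil /w abel_sum// => i.
by apply: within_sub sT; exact: (fs_cont sys).
Qed.

Lemma bil_within_cont (H : I -> I -> R) p :
  {within `[0, T], continuous (fun r => bil H (c^~ r) p)}.
Proof.
move=> x; apply: cvg_bigsum => i; apply: cvgM; first exact: cvg_cst.
exact: (fs_cont sys).
Qed.

(** As [t] is a time of maximal norm, every [c r] with [r <= t] has norm at most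
    that of [q]; test the Abel integral with itself and use Young. *)
Lemma w_bound s : 0 <= s <= t -> bil G (w s) (w s) <= (T `^ alpha / alpha) ^+ 2 * Y.
Proof.
move=> /andP[s0 st]; have /andP[al0 al1] := alpha01; have /andP[t0 tT] := t0T.
have sT : s <= T by lra.
set m := T `^ alpha / alpha; set W := bil G (w s) (w s).
have T0 : 0 < T by lra.
have m0 : 0 < m by rewrite divr_gt0// powR_gt0.
have W0 : 0 <= W by exact: (fs_G sys).
have Y0 : 0 <= Y by exact: (fs_G sys).
pose b := (m * Y + m^-1 * W) / 2.
have b0 : 0 <= b by rewrite divr_ge0// addr_ge0// mulr_ge0// ?invr_ge0 ltW.
have hb r : 0 <= r <= s -> `|bil G (c^~ r) (w s)| <= b.
  move=> /andP[r0 rs]; have rt : 0 <= r <= t by rewrite r0; lra.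
  have hp p : bil G p p <= Y -> bil G p (w s) <= b.
    move=> pY; apply: (le_trans (bil_young p (w s) (fs_sym sys) (fs_G sys) m0)).
    by rewrite ler_pM2r ?invr_gt0// lerD2r ler_pM2l.
  rewrite ler_norml; apply/andP; split; last by apply: hp; exact: dom.
  rewrite lerNl; have -> : - bil G (c^~ r) (w s) = bil G (fun i => -1 * c i r) (w s).
    by rewrite bilZl mulN1r.
  apply: hp; rewrite bilZl (bil_sym _ _ (fs_sym sys)) bilZl mulrA mulrNN !mul1r.
  exact: dom.
have cw := @bil_within_cont G (w s).
have [mw _] := within_itvcc_bounded_measurable s0 (within_sub cw sT).
have := abel_bound al0 s0 mw hb.
rewrite -bil_abel ?s0// -/W ger0_norm// => WB.
have sm : s `^ alpha / alpha <= m.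
  by rewrite ler_pM2r ?invr_gt0//; apply: ge0_ler_powR; rewrite ?nnegrE; lra.
have {}WB : W <= b * m by apply: (le_trans WB); exact: ler_wpM2l.
have E : b * m = (m ^+ 2 * Y + W) / 2 by rewrite /b; field; rewrite gt_eqF.
by lra.
Qed.

Let v s : I -> R := fun i => c0 * w s i.
Let Phi x r := bil G (c^~ r) q + bil S (v r) q - bil (B x) (v r) q.
Let E r := Phi r r.

Lemma bil_is_derive (H : I -> I -> R) (p : R -> I -> R)
    (dp p' : I -> R) (x : R) :
  (forall i, is_derive x 1 (fun r => p r i) (dp i)) ->
  is_derive x 1 (fun r => bil H (p r) p') (bil H dp p').
Proof. by move=> dpi; apply: is_derive_bigsum => i; exact: is_deriveZ. Qed.

(** With the drift frozen at [x], the derivative at [x] is exactly the equation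
    tested with [q]. *)
Lemma Phi_derive x : 0 < x < T -> is_derive x 1 (Phi x) 0.
Proof.
move=> xT; have tT : 0 <= t <= T by have := t0T; lra.
have dci i : is_derive x 1 (c i) (derive1 (c i) x).
  by rewrite derive1E; apply/derivableP; exact: (fs_der sys).
have dwi i : derivable (abel alpha (c i)) x 1.
  apply: (@abel_derivable _ _ T) => //; [exact: (fs_cont sys)|exact: (fs_der sys)|exact: (fs_derb sys)].
have dvi i : is_derive x 1 (fun r => v r i) (derive1 (fun s => c0 * abel alpha (c i) s) x).
  have dv : derivable (fun s => c0 * abel alpha (c i) s) x 1.
    by case: (is_deriveZ c0 (derivableP (dwi i))).
  by rewrite derive1E; apply/derivableP.
have d1 := bil_is_derive G q dci.
have d2 := bil_is_derive S q dvi.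
have d3 := bil_is_derive (B x) q dvi.
have := is_deriveB (is_deriveD d1 d2) d3.
by rewrite (fs_eq sys xT tT).
Qed.

Let m := T `^ alpha / alpha.

Lemma B_increment x y th : 0 < x < T -> 0 < y < T -> 0 < th ->
  forall s, 0 <= s <= t ->
  bil (B y) (v s) q - bil (B x) (v s) q <=
  c0 * (L * ((th * (m ^+ 2 * Y) + th^-1 * A) / 2)) * `|y - x|.
Proof.
move=> xT yT th0 s st; rewrite /v !bilZl -mulrBr -mulrA; apply: ler_wpM2l => //.
apply: (le_trans (fs_BL sys _ _ xT yT th0)).
rewrite mulrAC -mulrA -mulrA; apply: ler_wpM2l => //; apply: ler_wpM2r => //.
by rewrite ler_pM2r ?invr_gt0// lerD2r ler_pM2l// w_bound.
Qed.

Let Lam th := c0 * (L * ((th * (m ^+ 2 * Y) + th^-1 * A) / 2)).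

Lemma Lam_ge0 th : 0 < th -> 0 <= Lam th.
Proof.
move=> th0; have Y0 : 0 <= Y by exact: (fs_G sys).
have A0 : 0 <= A by exact: (fs_S sys).
have h1 : 0 <= th * (m ^+ 2 * Y) by rewrite mulr_ge0 ?(ltW th0)// mulr_ge0 ?sqr_ge0.
have h2 : 0 <= th^-1 * A by rewrite mulr_ge0// invr_ge0 ltW.
by rewrite /Lam mulr_ge0// mulr_ge0// divr_ge0// addr_ge0.
Qed.

Lemma Lam_bil x y th s : 0 < x < T -> 0 < y < T -> 0 < th -> 0 <= s <= t ->
  `|bil (B y) (v s) q - bil (B x) (v s) q| <= Lam th * `|y - x|.
Proof.
move=> xT yT th0 st; rewrite ler_norml lerNl opprB; apply/andP; split.
  by rewrite (distrC y); exact: B_increment.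
exact: B_increment.
Qed.

(** [E] need not be differentiable, as [B] is merely Lipschitz in time; but at
    each [x] it differs from the frozen [Phi x] by an increment of [B], and
    [Phi x] has derivative 0 at [x]. *)
Lemma energy_increment s th : 0 < s <= t -> 0 < th -> E t <= E s + Lam th * (t - s).
Proof.
move=> /andP[s0 st] th0; have /andP[t0 tT] := t0T.
have EPhi x r : E r = Phi x r - (bil (B r) (v r) q - bil (B x) (v r) q).
  by rewrite /E /Phi; ring.
have LG := Lam_ge0 th0.
apply: dini_le => //.
  apply/subspace_continuousP => x; rewrite /= in_itv/= => /andP[sx xt].
  have x0T : 0 < x < T by lra.
  apply/cvgrPdist_le => e e0.
  have e20 : 0 < e / 2 by rewrite divr_gt0.
  have cPhi := is_derive_continuous (Phi_derive x0T).
  have La : 0 < Lam th + 1 by rewrite ltr_wpDl.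
  have r0 : 0 < e / 2 / (Lam th + 1) by rewrite divr_gt0.
  have /cvgrPdist_le /(_ _ r0) hx : y @[y --> (x : R)] --> (x : R) by exact: cvg_id.
  rewrite /prop_near1 /nbhs /= /within /=.
  near=> y; rewrite in_itv/= => /andP[sy yt].
  have y0T : 0 < y < T by lra.
  have y0t : 0 <= y <= t by lra.
  change (`|E x - E y| <= e).
  rewrite (EPhi x y) opprD opprK addrA.
  have -> : e = e / 2 + e / 2 by field.
  apply: (le_trans (ler_normD _ _)); apply: lerD.
    by rewrite /E; near: y; move/cvgrPdist_le : cPhi; apply.
  apply: (le_trans (Lam_bil x0T y0T th0 y0t)).
  apply: (@le_trans _ _ ((Lam th + 1) * (e / 2 / (Lam th + 1)))).
    have xy : `|y - x| <= e / 2 / (Lam th + 1).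
      by rewrite distrC; near: y.
    by apply: ler_pM => //; rewrite lerDl.
  by rewrite mulrC divfK// gt_eqF.
move=> x /andP[sx xt] e e0.
have x0T : 0 < x < T by lra.
have [dPhi PhiD] := Phi_derive x0T.
have := dPhi; rewrite /derivable.
have : h^-1 *: ((Phi x \o shift x) h%:A - Phi x x) @[h --> 0^'] --> (0 : R).
  by rewrite -[X in _ --> X]PhiD; exact: dPhi.
move=> /cvgrPdist_le /(_ e e0) H _.
have {}H : \forall h \near 0^'+, `|0 - h^-1 *: ((Phi x \o shift x) h%:A - Phi x x)| <= e.
  case: H => r r0 Hr; exists r => // h hr h0; apply: Hr => //.
  by rewrite gt_eqF.
near=> h.
have h0 : 0 < h by near: h; exact: nbhs_right_gt.
have ht : h <= t - x by near: h; apply: nbhs_right_le; rewrite subr_gt0.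
have : `|0 - h^-1 *: ((Phi x \o shift x) h%:A - Phi x x)| <= e by near: h.
rewrite sub0r normrN /= /GRing.scale/= mulr1 normrM (gtr0_norm (_ : 0 < h^-1)) ?invr_gt0//.
rewrite ler_pdivrMl// (addrC h) => H1.
rewrite (EPhi x (x + h)).
have xh : 0 < x + h < T by lra.
have xht : 0 <= x + h <= t by lra.
have := Lam_bil x0T xh th0 xht; rewrite (addrC x) addrK (gtr0_norm h0) (addrC h).
rewrite !ler_norml => /andP[H2 _].
move: H1; rewrite ler_norml => /andP[_ H1].
exact: le_sub_step H1 H2.
Unshelve. all: by end_near. Qed.

Let C (p : I -> R) s : R := bil (fun i j => S i j - B t i j) (c^~ s) p.
Let f s : R := bil G (c^~ s) q + c0 * abel alpha (C q) s.

(** At the price of a factor 2, the drift in [E] is replaced by the drift at the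
    fixed time [t], which turns the second term into an Abel integral of one
    scalar function. The case [s = 0], where the equation is not available, is a
    limit. *)
Lemma f_increment s th : 0 <= s <= t -> 0 < th -> f t - f s <= 2 * Lam th * (t - s).
Proof.
have /andP[al0 al1] := alpha01; have /andP[t0 tT] := t0T.
have fPhi r : 0 <= r <= T -> f r = Phi t r.
  move=> r0T; rewrite /f /Phi /C -bil_abel// bilB_form /v !bilZl.
  by rewrite mulrBr addrA.
have t0T' : 0 <= t <= T by lra.
move=> + th0; rewrite -mulrA mulr_natl; move=> /andP[]; rewrite le_eqVlt => /predU1P[<-{s} _|s0 st]; last first.
  have s0T : 0 < s < T by lra.
  rewrite !fPhi//; last by lra.
  have -> : Phi t s = E s + (bil (B s) (v s) q - bil (B t) (v s) q).
    by rewrite /E /Phi; ring.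
  have st' : 0 < s <= t by rewrite s0.
  have := energy_increment st' th0.
  have st'' : 0 <= s <= t by rewrite ltW.
  have := Lam_bil t0T s0T th0 st''.
  rewrite (distrC s) (ger0_norm (_ : 0 <= t - s)) ?subr_ge0// ler_norml.
  by move=> /andP[H1 _] H2; exact: le_sub_double H2 H1.
have f_cvg : f s @[s --> 0^'+] --> f 0.
  have cwi (H : I -> I -> R) p := @bil_within_cont H p.
  have T0 : 0 < T by lra.
  apply: cvgD.
    by have /(continuous_within_itvP _ T0)[_ + _] := cwi G q.
  apply: cvgM; first exact: cvg_cst.
  have [mC [k Ck]] := within_itvcc_bounded_measurable (ltW T0) (cwi (fun i j => S i j - B t i j) q).
  have -> : abel alpha (C q) 0 = 0.
    by rewrite /abel set_itv1 Rintegral_set1.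
  have pw : k * (s `^ alpha / alpha) @[s --> 0^'+] --> (0 : R).
    rewrite -[X in _ --> X](mulr0 k); apply: cvgM; first exact: cvg_cst.
    rewrite -[X in _ --> X](mul0r alpha^-1); apply: cvgM; last exact: cvg_cst.
    exact: powR_cvg0.
  apply/cvgrPdist_le => e e0; near=> s.
  have s0 : 0 <= s by near: s; exact: nbhs_right_ge.
  have sT : s <= T by near: s; exact: nbhs_right_le.
  rewrite sub0r normrN.
  have ms : measurable_fun `[0, s] (C q).
    by apply: measurable_funS mC => //; apply: subset_itvl; rewrite bnd_simp.
  have Cs r : 0 <= r <= s -> `|C q r| <= k by move=> rs; apply: Ck; lra.
  apply: (le_trans (abel_bound al0 s0 ms Cs)).
  apply: (le_trans (ler_norm _)); rewrite -normrN -sub0r.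
  by near: s; move/cvgrPdist_le : pw; apply.
have lhs : f t - f s @[s --> 0^'+] --> f t - f 0.
  exact: (cvgB (cvg_cst _) f_cvg).
have rhs : (Lam th * (t - s)) *+ 2 @[s --> 0^'+] --> (Lam th * (t - 0)) *+ 2.
  apply: cvgMn; apply: cvgM; first exact: cvg_cst.
  apply: cvgB; first exact: cvg_cst.
  by apply: cvg_at_right_filter; exact: cvg_id.
apply: (ler_cvg_to lhs rhs); near=> s.
have s0 : 0 < s by near: s; exact: nbhs_right_gt.
have st : s <= t by near: s; exact: nbhs_right_le.
have s0T : 0 < s < T by lra.
rewrite !fPhi//; last by lra.
have -> : Phi t s = E s + (bil (B s) (v s) q - bil (B t) (v s) q).
  by rewrite /E /Phi; ring.
have st' : 0 < s <= t by rewrite s0.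
have := energy_increment st' th0.
have st'' : 0 <= s <= t by rewrite ltW.
have := Lam_bil t0T s0T th0 st''.
rewrite (distrC s) (ger0_norm (_ : 0 <= t - s)) ?subr_ge0// ler_norml.
by move=> /andP[H1 _] H2; exact: le_sub_double H2 H1.
Unshelve. all: by end_near. Qed.

Let k1 : R := (2 * alpha)^-1.
Let k2 : R := alpha^-1 + (1 - alpha)^-1.
Let S0 : R := (2 * T) `^ (1 - alpha) / (1 - alpha).

(** The value of [theta] hidden here is [2 * L * S0 / k1 + 1], the one for which
    the gained gradient term absorbs the one in the growth constant of [f]. *)
Definition growth_const : R :=
  c0 * (k2 * M ^+ 2 / 2 + 1 + (2 * L * S0 / k1 + 1) * (L * S0 * m ^+ 2)).

(** Compare the upper bound of [memory_le] for [f] with the lower bounds for its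
    two parts. The gradient terms cancel by the choice of [th], and a factor [Y]
    remains on both sides. *)
Lemma touching_bound sigma : 0 < sigma -> 0 < Y ->
  bil G (c^~ 0) (c^~ 0) <= Y / 2 ->
  (forall s, 0 <= s <= t - sigma -> bil G (c^~ s) (c^~ s) <= Y / 2) ->
  (2 * sigma) `^ (- alpha) <= 4 * growth_const.
Proof.
move=> sg0 Y0 y0 ysig; have /andP[al0 al1] := alpha01; have /andP[t0 tT] := t0T.
have t0' := ltW t0; have tT' := ltW tT.
have cwi (H : I -> I -> R) p := @bil_within_cont H p.
have [mC [k Ck]] := within_itvcc_bounded_measurable t0'
  (within_sub (cwi (fun i j => S i j - B t i j) q) tT').
have [mG [kG Gk]] := within_itvcc_bounded_measurable t0' (within_sub (cwi G q) tT').
have cC : C q s @[s --> t^'-] --> C q t.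
  by have /(continuous_within_itvP _ t0)[_ _] := within_sub (cwi (fun i j => S i j - B t i j) q) tT'.
have T0 : 0 < T by lra.
(* The error in the approximation is taken to be Y itself: any fixed multiple of
   Y is harmless on the right-hand side. *)
near ((0 : R)^'+) => delta.
have d0 : 0 < delta by near: delta; exact: nbhs_right_gt.
have dsg : delta <= sigma by near: delta; exact: nbhs_right_le.
have dT : delta <= T by near: delta; exact: nbhs_right_le.
have [kk [/andP[kk1 kk2] abel_low]] : exists kk, k1 <= kk <= k2 /\
   kk * C q t - Y <= delta `^ (- alpha) * abel alpha (C q) t -
     \int[mu]_(s in `[0, t]) (dker alpha delta t s * abel alpha (C q) s).
  by near: delta; exact: (abel_approximation alpha01 t0 mC Ck cC Y0).
have iG := integrable_dker_mul alpha01 d0 mG Gk.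
have [iC _] := abel_exchange al0 d0 mC Ck.
have [memf ifm] := memoryD c0 iG iC.
have q1 : 0 < 1 - alpha by rewrite subr_gt0.
(* Large enough for the gained gradient term k1 * A / 2 to absorb L * S0 * A / th,
   the one in the growth constant of f. *)
pose th : R := 2 * L * S0 / k1 + 1.
have S00 : 0 <= S0 by rewrite divr_ge0 ?powR_ge0// ltW.
have k10 : 0 < k1 by rewrite invr_gt0 mulr_gt0.
have th1 : 0 <= 2 * L * S0 / k1 by rewrite divr_ge0 ?(ltW k10)// mulr_ge0// mulr_ge0.
have th0 : 0 < th by rewrite ltr_wpDl.
have LG := Lam_ge0 th0.
have D0 : 0 <= 2 * Lam th by rewrite mulr_ge0.
have up : memory alpha delta t f <= 2 * Lam th * S0.
  have fi s : 0 <= s <= t -> f t - f s <= 2 * Lam th * (t - s).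
    by move=> st; exact: f_increment.
  apply: (le_trans (memory_le alpha01 d0 t0' D0 ifm fi)); apply: ler_wpM2l => //.
  apply: ler_wpM2r; first by rewrite invr_ge0 ltW.
  by apply: ge0_ler_powR; rewrite ?nnegrE; lra.
have young s : 0 <= s <= t -> Y - bil G (c^~ s) q >= (Y - bil G (c^~ s) (c^~ s)) / 2.
  move=> st; have := bil_young (c^~ s) q (fs_sym sys) (fs_G sys) (@ltr01 R).
  by rewrite mul1r invr1 mul1r -/Y; lra.
have Y4 : 0 <= Y / 4 by rewrite divr_ge0// ltW.
have low : Y / 4 * (2 * sigma) `^ (- alpha) <=
    memory alpha delta t (fun s => bil G (c^~ s) q).
  apply: memory_ge => //.
  - move=> s st; have := young s st; have := dom st; rewrite -/q -/Y.
    by lra.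
  - move=> s sts; have st : 0 <= s <= t by lra.
    by have := young s st; have := ysig s sts; rewrite -/q -/Y; lra.
  - have st : (0 : R) <= 0 <= t by rewrite lexx.
    by have := young 0 st; have := y0; rewrite -/q -/Y; lra.
have memC : kk * C q t - Y <= memory alpha delta t (abel alpha (C q)).
  rewrite /memory; have -> : abel alpha (C q) 0 = 0.
    by rewrite /abel set_itv1 Rintegral_set1.
  by rewrite mulr0 subr0.
have Ct : A / 2 - M ^+ 2 * Y / 2 <= C q t.
  rewrite /C bilB_form -/q -/A.
  have := fs_B sys q q t0T (@ltr01 R); rewrite -/Y -/A mul1r invr1 mul1r.
  by lra.
have A0 : 0 <= A by exact: (fs_S sys).
have kkC : k1 * (A / 2) - k2 * (M ^+ 2 * Y / 2) <= kk * C q t.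
  have kk0 : 0 <= kk by exact: le_trans (ltW k10) kk1.
  apply: le_trans (ler_wpM2l kk0 Ct); rewrite mulrBr; apply: lerB.
    by apply: ler_wpM2r => //; rewrite divr_ge0.
  by apply: ler_wpM2r => //; rewrite divr_ge0// mulr_ge0 ?sqr_ge0 ?ltW.
have total : Y / 4 * (2 * sigma) `^ (- alpha) +
    c0 * (k1 * (A / 2) - k2 * (M ^+ 2 * Y / 2) - Y) <= 2 * Lam th * S0.
  apply: le_trans up; rewrite memf; apply: lerD => //.
  by apply: ler_wpM2l => //; apply: le_trans memC; rewrite lerD2r.
have thS : L * S0 * th^-1 <= k1 / 2.
  rewrite ler_pdivrMr// /th.
  have -> : k1 / 2 * (2 * L * S0 / k1 + 1) = L * S0 + k1 / 2 by field; rewrite gt_eqF.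
  by rewrite lerDl divr_ge0// ltW.
have LamE : 2 * Lam th * S0 <= c0 * (L * S0 * th * m ^+ 2 * Y + k1 / 2 * A).
  have -> : 2 * Lam th * S0 = c0 * (L * S0 * th * m ^+ 2 * Y + L * S0 * th^-1 * A).
    by rewrite /Lam; field; rewrite gt_eqF.
  by apply: ler_wpM2l => //; rewrite lerD2l; apply: ler_wpM2r.
have fin : Y * ((2 * sigma) `^ (- alpha)) <= Y * (4 * growth_const).
  have -> : Y * (4 * growth_const) = 4 * (c0 * (L * S0 * th * m ^+ 2 * Y + k1 / 2 * A) -
     c0 * (k1 * (A / 2) - k2 * (M ^+ 2 * Y / 2) - Y)).
    by rewrite /growth_const -/th; ring.
  have h : Y / 4 * (2 * sigma) `^ (- alpha) = Y * (2 * sigma) `^ (- alpha) / 4 by ring.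
  by move: total LamE; rewrite h; lra.
by rewrite ler_pM2l in fin.
Unshelve. all: by end_near. Qed.

End fixed_time.

(** The barrier is [(2 y(0) + eta) exp(lam s)], with [lam * sigma = ln 2] so that
    it halves over a time [sigma], and [sigma] so small that [touching_bound]
    fails. The constants are fixed before the system is. *)
Theorem fractional_system_stable : 0 < alpha < 1 -> 0 < T -> 0 <= c0 -> 0 <= L ->
  exists2 K : R, 0 <= K & forall (I : finType) (c : I -> R -> R) G S B,
    fractional_system c G S B -> forall t, 0 <= t <= T ->
    bil G (c^~ t) (c^~ t) <= K * bil G (c^~ 0) (c^~ 0).
Proof.
move=> alpha01 T0 c00 L0; have /andP[al0 al1] := alpha01.
(* sigma solves (2 * sigma)^-alpha = N, a value that touching_bound excludes. *)
pose N : R := Num.max 0 (4 * growth_const) + 1.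
have N0 : 0 < N by rewrite ltr_wpDl// le_max lexx.
have N1 : 4 * growth_const < N by rewrite /N ltr_pwDr// le_max lexx orbT.
pose sigma : R := N `^ (- alpha^-1) / 2.
have sg0 : 0 < sigma by rewrite divr_gt0// powR_gt0.
have sgN : (2 * sigma) `^ (- alpha) = N.
  have -> : 2 * sigma = N `^ (- alpha^-1) by rewrite /sigma; field.
  by rewrite -powRrM mulrNN mulVf ?gt_eqF// powRr1// ltW.
pose lam : R := ln 2 / sigma.
have ln20 : 0 < ln (2 : R) by rewrite ln_gt0// ltr1n.
have lam0 : 0 < lam by rewrite divr_gt0.
have elam : expR (- (lam * sigma)) = 2^-1.
  by rewrite /lam divfK ?gt_eqF// expRN lnK// posrE.
exists (2 * expR (lam * T)); first by rewrite mulr_ge0// expR_ge0.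
move=> I c G S B sys.
have G0 := fs_G sys; set y0 := bil G (c^~ 0) (c^~ 0).
have y00 : 0 <= y0 by exact: G0.
pose y s := bil G (c^~ s) (c^~ s).
have cy : {within `[0, T], continuous y}.
  move=> x; apply: bil_cvg; first by move=> i j; exact: cvg_cst.
    by move=> i; exact: (fs_cont sys).
  by move=> i; exact: (fs_cont sys).
suff main eta : 0 < eta -> forall t, 0 <= t < T -> y t <= (2 * y0 + eta) * expR (lam * T).
  have main' t : 0 <= t < T -> y t <= 2 * expR (lam * T) * y0.
    move=> tT; apply/ler_addgt0Pr => e e0.
    have := main (e / expR (lam * T)) (divr_gt0 e0 (expR_gt0 _)) t tT.
    by rewrite mulrDl divfK ?gt_eqF ?expR_gt0// mulrAC.
  move=> t /andP[t0]; rewrite le_eqVlt => /predU1P[->|tT]; last by apply: main'; rewrite t0.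
  have /(continuous_within_itvP _ T0)[_ _ yT] := cy.
  apply: (ler_cvg_to yT (cvg_cst (2 * expR (lam * T) * y0))).
  near=> s; apply: main'; apply/andP; split; last by near: s; exact: nbhs_left_lt.
  by near: s; exact: nbhs_left_ge.
move=> eta0 t1 /andP[t10 t1T].
pose z s : R := (2 * y0 + eta) * expR (lam * s).
have z0 s : 0 < z s by rewrite mulr_gt0 ?expR_gt0// ltr_wpDl// mulr_ge0.
have z_mono s s' : s <= s' -> z s <= z s'.
  move=> ss; apply: ler_wpM2l; first by rewrite addr_ge0 ?mulr_ge0// ltW.
  by rewrite ler_expR ler_pM2l.
suff : y t1 <= z t1 by move/le_trans; apply; apply: z_mono; exact: ltW.
rewrite leNgt; apply/negP => yz.
have cgT : {within `[0, T], continuous (fun s => y s - z s)}.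
  move=> x; apply: cvgB; first exact: cy.
  apply: (continuous_subspaceT (f := z)) => {}x.
  apply: cvgM; first exact: cvg_cst.
  apply: continuous_comp; last exact: continuous_expR.
  by apply: cvgM; [exact: cvg_cst|exact: cvg_id].
have cg : {within `[0, t1], continuous (fun s => y s - z s)}.
  by apply: continuous_subspaceW cgT; apply: subset_itvl; rewrite bnd_simp ltW.
have g0 : y 0 - z 0 < 0.
  by rewrite /z mulr0 expR0 mulr1 -/y0 subr_lt0 /y -/y0; lra.
have g1 : 0 <= y t1 - z t1 by rewrite subr_ge0 ltW.
have [t [/andP[t0 tt1] gt gs]] := first_zero t10 cg g0 g1.
have t0T : 0 < t < T by lra.
have yt : y t = z t by apply/eqP; rewrite -subr_eq0 gt.
have ys s : 0 <= s <= t -> y s <= z s.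
  move=> /andP[s0]; rewrite le_eqVlt => /predU1P[->|st]; first by rewrite yt.
  by have := gs s ltac:(by rewrite s0); rewrite subr_lt0 => /ltW.
have dom s : 0 <= s <= t -> bil G (c^~ s) (c^~ s) <= bil G (c^~ t) (c^~ t).
  move=> st; apply: (le_trans (ys s st)); rewrite -/(y t) yt; apply: z_mono.
  by case/andP: st.
have zhalf s : s <= t - sigma -> z s <= z t / 2.
  move=> st; apply: (@le_trans _ _ (z (t - sigma))); first exact: z_mono.
  by rewrite /z mulrBr expRD elam mulrA.
have Ypos : 0 < bil G (c^~ t) (c^~ t) by rewrite -/(y t) yt.
have := touching_bound sys alpha01 c00 L0 t0T dom sg0 Ypos.
rewrite sgN -/(y t) yt => /(_ _ _)/= H.
suff : N <= 4 * growth_const by rewrite leNgt N1.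
apply: H.
  have : z 0 <= z t by apply: z_mono; exact: ltW.
  by rewrite {1}/z mulr0 expR0 mulr1 -/y0; lra.
move=> s /andP[s0 st]; apply: le_trans (zhalf s st); apply: ys.
by rewrite s0/=; lra.
Unshelve. all: by end_near. Qed.

End stability.

(** * Removing null sets from domains of integration *)

Section null_set_removal.
Import HBNNSimple.
Context d (T : measurableType d) (R : realType) (mu : {measure set T -> \bar R}).
Local Open Scope ereal_scope.

(** The integral of a nonnegative function is a supremum over simple functions
    below it, hence is monotone whether or not the functions are measurable. *)
Lemma le_integral_nonmeasurable (f g : T -> \bar R) :
  (forall x, 0 <= f x) -> (forall x, f x <= g x) ->
  \int[mu]_x f x <= \int[mu]_x g x.
Proof.
move=> f0 fg; have g0 x : 0 <= g x by exact: le_trans (fg x).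
rewrite !ge0_integralTE//; apply: ge_ereal_sup => _ [h hf <-].
by apply: ereal_sup_ubound; exists h => // x; exact: le_trans (fg x).
Qed.

Lemma ge0_integral_setC_null (N : set T) (f : T -> \bar R) :
  measurable N -> mu N = 0 -> (forall x, 0 <= f x) ->
  \int[mu]_x f x = \int[mu]_x (f \_ (~` N)) x.
Proof.
move=> mN N0 f0; apply/eqP; rewrite eq_le; apply/andP; split; last first.
  apply: le_integral_nonmeasurable => [x|x]; first exact: erestrict_ge0.
  by rewrite /patch; case: ifP.
rewrite [leLHS]ge0_integralTE//; apply: ge_ereal_sup => _ [h hf <-].
have mh : measurable_fun setT (EFin \o h) by exact/measurable_EFinP.
have h0 x : setT x -> 0 <= (EFin \o h) x by rewrite lee_fin.
rewrite -integralT_nnsfun (ge0_negligible_integral mN measurableT mh h0 N0)//.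
rewrite setTD integral_mkcond; apply: le_integral_nonmeasurable => x.
  by apply: erestrict_ge0 => y _; rewrite lee_fin.
by rewrite /patch; case: ifP => // _; exact: hf.
Qed.

(** Stated for arbitrary [f], since the integrands of the scheme are known only off
    a null set; the positive and negative parts are compared as suprema over
    simple functions. *)
Lemma integral_setD_null (D N : set T) (f : T -> \bar R) :
  measurable N -> mu N = 0 ->
  \int[mu]_(x in D) f x = \int[mu]_(x in D `\` N) f x.
Proof.
move=> mN N0; rewrite [LHS]integralE [RHS]integralE.
have key (g : T -> \bar R) : (forall x, 0 <= g x) ->
    \int[mu]_(x in D) g x = \int[mu]_(x in D `\` N) g x.
  move=> g0; rewrite integral_mkcond (ge0_integral_setC_null mN N0); last first.
    by move=> x; exact: erestrict_ge0.
  by rewrite setDE [RHS]integral_mkcond setIC -patch_setI.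
by rewrite !key.
Qed.

Lemma Rintegral_setD_null (D N : set T) (f : T -> R) :
  measurable N -> mu N = 0 ->
  (\int[mu]_(x in D) f x)%R = (\int[mu]_(x in D `\` N) f x)%R.
Proof. by move=> mN N0; rewrite /Rintegral (integral_setD_null _ _ mN N0). Qed.

End null_set_removal.

Section product_sections.
Context d1 d2 (T1 : measurableType d1) (T2 : measurableType d2) (R : realType).
Variables (m1 : {sigma_finite_measure set T1 -> \bar R})
          (m2 : {sigma_finite_measure set T2 -> \bar R}).
Local Open Scope ereal_scope.

Lemma product_measure_null_xsection (A : set (T1 * T2)) : measurable A ->
  (forall x, m2 (xsection A x) = 0) -> (m1 \x m2) A = 0.
Proof.
move=> mA A0; rewrite /product_measure1 /=.
by under eq_integral do rewrite A0; rewrite integral0.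
Qed.

(** The product measure is defined by integrating the other sections; uniqueness
    of the product measure gives the symmetric statement. *)
Lemma product_measure_null_ysection (A : set (T1 * T2)) : measurable A ->
  (forall y, m1 (ysection A y) = 0) -> (m1 \x m2) A = 0.
Proof.
move=> mA A0; rewrite (@product_measure_unique _ _ _ _ _ m1 m2 (m1 \x^ m2))//.
  change (\int[m2]_y (m1 \o ysection A) y = 0).
  by apply: integral0_eq => y _; exact: A0.
by move=> B C mB mC; exact: (product_measure2E m1 m2 mB mC).
Qed.

(** The sections of a null set have measure zero for almost every point, since
    the integral of their measures vanishes. *)
Lemma ae_product_section (P : T1 * T2 -> Prop) :
  {ae (m1 \x m2), forall z, P z} ->
  {ae m1, forall x, {ae m2, forall y, P (x, y)}}.
Proof.
move=> [N [mN N0 PN]].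
have ms := measurable_fun_xsection m2 mN.
have : ae_eq m1 setT (m2 \o xsection N) (cst 0).
  apply/ae_eq_integral_abs => //.
  under eq_integral do rewrite /= gee0_abs//.
  exact: N0.
apply: filterS => x /(_ Logic.I) xN0.
exists (xsection N x); split => //; first exact: measurable_xsection.
by move=> y Py; rewrite /xsection /= inE; apply: PN.
Qed.

End product_sections.

(** * Lebesgue measure on row vectors *)

Section rV_measure.
Context (R : realType).
Implicit Types (d : nat).

Lemma measurable_coor d (i : 'I_d) :
  measurable_fun [set: 'rV[R]_d] (fun x : 'rV[R]_d => x ord0 i).
Proof. exact: measurable_rV_coor. Qed.

Lemma measurable_dotv d (g : 'rV[R]_d) :
  measurable_fun [set: 'rV[R]_d] (fun x => dotv g x).
Proof.
apply: measurable_sum => i.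
by apply: measurable_funM => //; exact: measurable_coor.
Qed.

(** An open cube, described by coordinates so that its measurability is visible. *)
Definition rbox d (q : 'rV[R]_d) (e : R) : set 'rV[R]_d :=
  [set x | forall i, `|q ord0 i - x ord0 i| < e].

Lemma measurable_rbox d (q : 'rV[R]_d) (e : R) : measurable (rbox q e).
Proof.
have -> : rbox q e =
    \big[setI/setT]_(i : 'I_d) [set x : 'rV[R]_d | `|q ord0 i - x ord0 i| < e].
  apply/seteqP; split => [x xq|x].
    by rewrite -bigcap_seq => i _ /=; exact: xq.
  by rewrite -bigcap_seq => xq i; apply: xq; rewrite /= mem_index_enum.
apply: bigsetI_measurable => i _.
have mf : measurable_fun setT (fun x : 'rV[R]_d => `|q ord0 i - x ord0 i|).
  by apply: measurableT_comp => //; apply: measurable_funB => //; exact: measurable_coor.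
have -> : [set x : 'rV[R]_d | `|q ord0 i - x ord0 i| < e] =
  setT `&` (fun x : 'rV[R]_d => `|q ord0 i - x ord0 i|) @^-1` `]-oo, e[.
  by rewrite setTI; apply/seteqP; split => x /=; rewrite in_itv.
by apply: mf.
Qed.

(** The sigma-algebra is generated by the coordinates, so an open set is written
    as a countable union of cubes with rational centres and radii [1 / n]. *)
Lemma open_rV_measurable d (A : set 'rV[R]_d) : open A -> measurable A.
Proof.
move=> oA.
(* A box is kept only if it fits into A, so that the union is over a countable
   type. *)
pose F (z : 'rV[rat]_d * nat) : set 'rV[R]_d :=
  if `[< rbox (map_mx ratr z.1) (z.2.+1%:R^-1) `<=` A >]
  then rbox (map_mx ratr z.1) (z.2.+1%:R^-1) else set0.
have -> : A = \bigcup_z F z.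
  apply/seteqP; split => [x Ax|x [z _]]; last first.
    by rewrite /F; case: asboolP => // + ; apply.
  have := oA x Ax; rewrite /= => /nbhs_ballP[e /= e0 xe].
  have [n ne] : exists n : nat, (n.+1%:R^-1 : R) < e / 2.
    have /cvgrPdist_lt /(_ _ (divr_gt0 e0 (ltr0n _ 2)))[N _ /(_ N (leqnn _))] :=
      @cvg_harmonic R.
    by rewrite /= sub0r normrN gtr0_norm ?harmonic_gt0//; exists N.
  have n0 : (0 : R) < n.+1%:R^-1 by rewrite invr_gt0.
  have hq i : exists q : rat, x ord0 i - n.+1%:R^-1 < ratr q < x ord0 i + n.+1%:R^-1.
    have : x ord0 i - n.+1%:R^-1 < x ord0 i + n.+1%:R^-1.
      by rewrite ltrD2l; apply: (lt_trans _ n0); rewrite oppr_lt0.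
    by move=> /rat_in_itvoo[q]; rewrite in_itv; exists q.
  have [q hq'] := choice hq.
  have box y : rbox (map_mx ratr (\row_i q i)) (n.+1%:R^-1) y ->
      forall i, `|x ord0 i - y ord0 i| < e.
    move=> yb i; have := yb i; have := hq' i; rewrite !mxE !ltr_norml.
    by move: (n.+1%:R^-1) ne n0 => u ne n0; lra.
  exists (\row_i q i, n) => //; rewrite /F /=; case: asboolP => [_|[]].
    move=> i; rewrite !mxE; have := hq' i; rewrite ltr_norml.
    by move: (n.+1%:R^-1) n0 => u n0; lra.
  move=> y yb; apply: xe; split => // i j; rewrite (ord1 i).
  by rewrite /ball /=; exact: box yb j.
apply: countable_bigcupT_measurable => //.
by move=> z; rewrite /F; case: asboolP => _ //; exact: measurable_rbox.
Qed.

Definition hyperplane d (g : 'rV[R]_d) (c : R) : set 'rV[R]_d :=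
  [set x | dotv g x = c].

Lemma measurable_hyperplane d (g : 'rV[R]_d) (c : R) : measurable (hyperplane g c).
Proof.
have -> : hyperplane g c = setT `&` (fun x => dotv g x) @^-1` [set c].
  by rewrite setTI.
exact: (measurable_dotv g).
Qed.

Lemma dotv_cons d (g : 'rV[R]_d.+1) (z : R * 'rV[R]_d) :
  dotv g (rV_cons z) = g ord0 ord0 * z.1 + dotv (\row_j g ord0 (lift ord0 j)) z.2.
Proof.
rewrite /dotv big_ord_recl /rV_cons !mxE unlift_none; congr (_ + _).
by apply: eq_bigr => i _; rewrite !mxE liftK.
Qed.

(** Induction on the dimension: if the leading coefficient of [g] vanishes, the
    sections over the first coordinate are hyperplanes of lower dimension,
    otherwise the sections over the others are single points. *)
Lemma hyperplane_null d (g : 'rV[R]_d) (c : R) : g != 0 ->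
  lebesgue_rV R d (hyperplane g c) = 0%E.
Proof.
elim: d g c => [g c|d IH g c].
  by rewrite [g]thinmx0 eqxx.
move=> g0; change ((lebesgue_measure \x lebesgue_rV R d)%E
  (@rV_cons R d @^-1` hyperplane g c) = 0%E).
set A := _ @^-1` _.
have mA : measurable A.
  rewrite /A -[X in measurable X]setTI.
  by apply: (@measurable_rV_cons R d) => //; exact: measurable_hyperplane.
pose g' : 'rV[R]_d := \row_j g ord0 (lift ord0 j).
have AE z : A z <-> g ord0 ord0 * z.1 + dotv g' z.2 = c.
  by rewrite /A /hyperplane /= dotv_cons.
have [g00|g00] := eqVneq (g ord0 ord0) 0.
  have g'0 : g' != 0.
    apply: contra_neq g0 => g'0; apply/rowP => j; rewrite mxE.
    case: (unliftP ord0 j) => [k|] ->; last exact: g00.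
    by move/rowP : g'0 => /(_ k); rewrite !mxE.
  apply: product_measure_null_xsection => // x.
  rewrite (_ : xsection A x = hyperplane g' c); first exact: IH.
  apply/seteqP; split => y; rewrite /xsection /= inE AE g00 mul0r add0r //.
apply: product_measure_null_ysection => // y.
rewrite (_ : ysection A y = [set (c - dotv g' y) / g ord0 ord0]).
  exact: lebesgue_measure_set1.
apply/seteqP; split => x; rewrite /ysection /= inE AE /=.
  by move=> <-; rewrite addrK mulrC mulKf.
by move=> ->; rewrite mulrC divfK// subrK.
Qed.

Definition cube d (k : R) : set 'rV[R]_d := [set x | forall i, `|x ord0 i| <= k].

Lemma measurable_cube d (k : R) : measurable (@cube d k).
Proof.
have -> : @cube d k =
    \big[setI/setT]_(i : 'I_d) [set x : 'rV[R]_d | `|x ord0 i| <= k].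
  apply/seteqP; split => [x xq|x].
    by rewrite -bigcap_seq => i _ /=; exact: xq.
  by rewrite -bigcap_seq => xq i; apply: xq; rewrite /= mem_index_enum.
apply: bigsetI_measurable => i _.
have mf : measurable_fun setT (fun x : 'rV[R]_d => `|x ord0 i|).
  by apply: measurableT_comp => //; exact: measurable_coor.
have -> : [set x : 'rV[R]_d | `|x ord0 i| <= k] =
  setT `&` (fun x : 'rV[R]_d => `|x ord0 i|) @^-1` `]-oo, k].
  by rewrite setTI; apply/seteqP; split => x /=; rewrite in_itv.
by apply: mf.
Qed.

Lemma cube_lty d (k : R) : (lebesgue_rV R d (@cube d k) < +oo)%E.
Proof.
elim: d => [|d IH].
  rewrite /= diracE; case: (_ \in _); exact: ltry.
change ((lebesgue_measure \x lebesgue_rV R d)%E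
  (@rV_cons R d @^-1` @cube d.+1 k) < +oo)%E.
have -> : @rV_cons R d @^-1` @cube d.+1 k = `[- k, k]%classic `*` @cube d k.
  apply/seteqP; split => [[x v]|[x v]] /=.
    move=> h; split => /=.
      by have := h ord0; rewrite /rV_cons mxE unlift_none /= in_itv/= ler_norml.
    by move=> j; have := h (lift ord0 j); rewrite /rV_cons mxE liftK.
  rewrite in_itv/= -ler_norml => -[xk vk] i; rewrite /rV_cons mxE.
  by case: unliftP => [j _|_] //=; exact: vk.
rewrite product_measure1E//; last exact: measurable_cube.
by apply: lte_mul_pinfty => //; rewrite ge0_fin_numE//; exact: lebesgue_itvcc_lty.
Qed.

Lemma bounded_rV_lty d (A : set 'rV[R]_d) : measurable A -> bounded_set A ->
  (lebesgue_rV R d A < +oo)%E.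
Proof.
move=> mA [M [_ HM]].
have Mlt : M < M + 1 by rewrite ltrDl.
apply: (le_lt_trans _ (@cube_lty d (M + 1))).
apply: le_measure; rewrite ?inE//; first exact: measurable_cube.
move=> x Ax i; apply: le_trans (HM _ Mlt x Ax).
by rewrite [leRHS]mx_normrE; apply: (le_trans _ (le_bigmax _ _ (ord0, i))).
Qed.

End rV_measure.

(** * Pointwise bounds on the drift field *)

Section forcing_bounds.
Context (R : realType) (d : nat).
Implicit Types (x y g : 'rV[R]_d) (k : R).
Local Notation mu := (@lebesgue_measure R).

Lemma dotvC x y : dotv x y = dotv y x.
Proof. by apply: eq_bigr => i _; rewrite mulrC. Qed.

Lemma dotvDl x y g : dotv (x + y) g = dotv x g + dotv y g.
Proof. by rewrite /dotv -big_split; apply: eq_bigr => i _; rewrite mxE mulrDl. Qed.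

Lemma dotvZl k x g : dotv (k *: x) g = k * dotv x g.
Proof. by rewrite /dotv mulr_sumr; apply: eq_bigr => i _; rewrite mxE mulrA. Qed.

Lemma dotv_ge0 x : 0 <= dotv x x.
Proof. by apply: sumr_ge0 => i _; rewrite -expr2 sqr_ge0. Qed.

(** Expand [0 <= dotv (k x - y) (k x - y)]. *)
Lemma dotv_young x y k : 0 < k ->
  dotv x y <= (k * dotv x x + k^-1 * dotv y y) / 2.
Proof.
move=> k0; have := dotv_ge0 (k *: x + (-1) *: y).
rewrite dotvDl !dotvZl (dotvC x) (dotvC y) !dotvDl !dotvZl (dotvC y x) => h.
have -> : (k * dotv x x + k^-1 * dotv y y) / 2 =
  dotv x y + k^-1 * (k * (k * dotv x x + -1 * dotv x y) +
   -1 * (k * dotv x y + -1 * dotv y y)) / 2 by field; rewrite gt_eqF.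
by rewrite lerDl !mulr_ge0// invr_ge0// ltW.
Qed.

Lemma dotv_normv x : dotv x x = normv x ^+ 2.
Proof. by rewrite /normv sqr_sqrtr// dotv_ge0. Qed.

Lemma normv_coor x i : `|x ord0 i| <= normv x.
Proof.
rewrite -(@ler_pXn2r _ 2)// ?nnegrE ?sqrtr_ge0// -dotv_normv real_normK ?num_real//.
rewrite /dotv (bigD1 i)//= expr2 lerDl; apply: sumr_ge0 => j _.
by rewrite -expr2 sqr_ge0.
Qed.

Lemma measurable_space_time (Omega : set 'rV[R]_d) (T : R) :
  open Omega -> measurable (space_time Omega T).
Proof.
move=> oO; have -> : space_time Omega T = Omega `*` `]0, T[%classic.
  by apply/seteqP; split => -[x t] /=; rewrite in_itv.
by apply: measurableX => //; exact: open_rV_measurable.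
Qed.

Lemma measurable_time_slice (Omega : set 'rV[R]_d) (T : R) F x i :
  open Omega -> space_time_measurable Omega T F -> Omega x ->
  measurable_fun `]0, T[ (fun t => F x t ord0 i).
Proof.
move=> oO mF Ox.
apply: (@measurable_comp _ _ _ _ _ _ (space_time Omega T) (fun z => F z.1 z.2 ord0 i)
  _ (fun t : measurableTypeR R => (x, t))).
- exact: measurable_space_time.
- by move=> _ [t /= tT <-]; split => //=; rewrite in_itv in tT.
- exact: mF.
- by apply: measurable_funTS; exact: pair1_measurable.
Qed.

Lemma measurable_space_slice (Omega : set 'rV[R]_d) (T : R) F t i :
  open Omega -> space_time_measurable Omega T F -> 0 < t < T ->
  measurable_fun Omega (fun x => F x t ord0 i).
Proof.
move=> oO mF tT.
apply: (@measurable_comp _ _ _ _ _ _ (space_time Omega T) (fun z => F z.1 z.2 ord0 i)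
  _ (fun x : 'rV[R]_d => (x, t : measurableTypeR R))).
- exact: measurable_space_time.
- by move=> _ [x /= Ox <-].
- exact: mF.
- by apply: measurable_funTS; exact: pair2_measurable.
Qed.

(** The essential bound on space-time, sliced at almost every [x]. *)
Lemma Linfty_bound (Omega : set 'rV[R]_d) (T M : R) F :
  Linfty_norm Omega T F = M%:E ->
  {ae lebesgue_rV R d, forall x, Omega x ->
    {ae mu, forall t, 0 < t < T -> normv (F x t) <= M}}.
Proof.
move=> FM.
have : (Linfty_norm Omega T F <= M%:E)%E by rewrite FM.
rewrite /Linfty_norm => /ess_supP h.
have := ae_product_section h; apply: filterS => x + Ox; apply: filterS => t + tT.
by rewrite lee_fin indicE mem_set ?mul1r//; split.
Qed.

(** Test the increment [e = f t - f s] with itself: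
    [e . e] is the integral of [f' r . e], and Young with weight [t - s] bounds
    it by [(M'^2 (t - s)^2 + e . e) / 2]. This gives the Euclidean bound without
    a vector-valued triangle inequality for integrals. *)
Lemma lipschitz_of_derivative (T M' : R) (f f' : R -> 'rV[R]_d) :
  (forall i, measurable_fun `]0, T[ (fun t => f' t ord0 i)) ->
  {ae mu, forall t, 0 < t < T -> normv (f' t) <= M'} ->
  (forall s t, 0 < s -> s <= t -> t < T -> forall i,
     f t ord0 i - f s ord0 i = \int[mu]_(r in `[s, t]) f' r ord0 i) ->
  forall s t, 0 < s -> s <= t -> t < T ->
    dotv (f t - f s) (f t - f s) <= (M' * (t - s)) ^+ 2.
Proof.
move=> mf' [N [mN N0 fN]] ff' s t s0; rewrite le_eqVlt => /predU1P[<-|st] tT.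
  rewrite !subrr mulr0 expr0n/= /dotv big1// => i _; by rewrite mxE mul0r.
have bd r : (`[s, t]%classic `\` N) r -> normv (f' r) <= M'.
  move=> [/=]; rewrite in_itv/= => /andP[sr rt] nN.
  apply: contrapT => h; apply: nN; apply: fN => /(_ ltac:(lra)); exact: h.
pose D := `[s, t]%classic `\` N.
have mD : measurable D by apply: measurableD.
have Dlty : (mu D < +oo)%E.
  by apply: le_lt_trans (lebesgue_itvcc_lty s t); apply: le_measure; rewrite ?inE//; exact: subDsetl.
have muD : fine (mu D) = t - s.
  rewrite /D measureD//=; last exact: lebesgue_itvcc_lty.
  rewrite (_ : mu (_ `&` N) = 0%E); last first.
    by apply: (subset_measure0 _ mN _ N0); [exact: measurableI|exact: subIsetr].
  by rewrite sube0 lebesgue_measure_itv/= lte_fin st.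
have fi i : mu.-integrable D (EFin \o (fun r => f' r ord0 i)).
  apply: (@integrable_bounded _ _ _ _ _ _ M') => //.
    apply: measurable_funS (mf' i) => // r [/=]; rewrite !in_itv/= => /andP[? ?] _.
    by apply/andP; split; lra.
  by move=> r /bd; apply: le_trans; exact: normv_coor.
have ffD i : f t ord0 i - f s ord0 i = \int[mu]_(r in D) f' r ord0 i.
  by rewrite ff'//; [rewrite (Rintegral_setD_null _ _ mN N0)|exact: ltW].
set e := f t - f s.
have eE : dotv e e = \int[mu]_(r in D) dotv (f' r) e.
  have [|_ ->] := @Rintegral_sum _ _ _ mu D _ (index_enum 'I_d) (fun i r => f' r ord0 i * e ord0 i) mD.
    move=> i; under eq_fun do rewrite mulrC; exact: integrable_mull.
  apply: eq_bigr => i _; rewrite RintegralZr//; congr (_ * _).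
  by rewrite !mxE ffD.
have ts : 0 < t - s by rewrite subr_gt0.
have ie : mu.-integrable D (EFin \o (fun r => dotv (f' r) e)).
  have [|+ _] := @Rintegral_sum _ _ _ mu D _ (index_enum 'I_d) (fun i r => f' r ord0 i * e ord0 i) mD.
    by move=> i; under eq_fun do rewrite mulrC; exact: integrable_mull.
  by [].
(* The constant integrand to which Young reduces the integral of f' . e. *)
pose K : R := ((t - s) * M' ^+ 2 + (t - s)^-1 * dotv e e) / 2.
have le1 : dotv e e <= \int[mu]_(r in D) K.
  rewrite {1}eE; apply: le_Rintegral.
  - exact: mD.
  - exact: ie.
  - by apply: (@integrable_bounded _ _ _ _ _ _ `|K|).
  move=> r Dr; apply: (le_trans (dotv_young _ _ ts)).
  rewrite ler_pM2r ?invr_gt0// lerD2r ler_pM2l// dotv_normv.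
  by rewrite ler_pXn2r ?nnegrE ?sqrtr_ge0 ?bd// (le_trans _ (bd _ Dr)) ?sqrtr_ge0.
rewrite Rintegral_cst// muD in le1.
have KE : K * (t - s) = ((M' * (t - s)) ^+ 2 + dotv e e) / 2.
  by rewrite /K; field; rewrite gt_eqF.
by rewrite KE in le1; lra.
Qed.

(** At some time the norm is at most [M], since almost every time qualifies; the
    Lipschitz bound carries this to all times. *)
Lemma bound_of_lipschitz (T M M' : R) (f : R -> 'rV[R]_d) : 0 < T ->
  {ae mu, forall t, 0 < t < T -> normv (f t) <= M} ->
  (forall s t, 0 < s -> s <= t -> t < T ->
    dotv (f t - f s) (f t - f s) <= (M' * (t - s)) ^+ 2) ->
  forall t, 0 < t < T -> dotv (f t) (f t) <= 2 * M ^+ 2 + 2 * (M' * T) ^+ 2.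
Proof.
move=> T0 [N [mN N0 fN]] fl t tT.
have [r rT fr] : exists2 r, 0 < r < T & normv (f r) <= M.
  apply: contrapT => h.
  have : (mu `]0%R, T[%classic <= mu N)%E.
    apply: le_measure; rewrite ?inE//.
    move=> r /=; rewrite in_itv/= => rT; apply: fN => /(_ rT) hr; apply: h; by exists r.
  by rewrite [X in (_ <= X)%E]N0 lebesgue_measure_itv/= lte_fin T0 sube0 lee_fin leNgt T0.
have M0 : 0 <= M by rewrite (le_trans _ fr)// sqrtr_ge0.
have frM : dotv (f r) (f r) <= M ^+ 2.
  by rewrite dotv_normv ler_pXn2r ?nnegrE ?sqrtr_ge0.
have dl : dotv (f t - f r) (f t - f r) <= (M' * T) ^+ 2.
  have sq (a b : R) : 0 <= a <= b -> (M' * a) ^+ 2 <= (M' * b) ^+ 2.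
    move=> /andP[a0 ab]; rewrite !exprMn; apply: ler_wpM2l; first exact: sqr_ge0.
    by rewrite ler_pXn2r ?nnegrE// (le_trans a0).
  have [rt|tr] := leP r t.
    by apply: le_trans (fl r t _ _ _) (sq _ _ _); lra.
  have -> : dotv (f t - f r) (f t - f r) = dotv (f r - f t) (f r - f t).
    by rewrite /dotv; apply: eq_bigr => i _; rewrite !mxE; ring.
  by apply: le_trans (fl t r _ _ _) (sq _ _ _); lra.
have -> : dotv (f t) (f t) = dotv (f r) (f r) + 2 * dotv (f r) (f t - f r) +
    dotv (f t - f r) (f t - f r).
  rewrite /dotv mulr_sumr -!big_split/=; apply: eq_bigr => i _; rewrite !mxE; ring.
have := dotv_young (f r) (f t - f r) (@ltr01 R); rewrite mul1r invr1 mul1r.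
by lra.
Qed.

(** The almost everywhere bounds on space-time become bounds at all times, so that
    the drift form can be estimated, and compared, at any two times. *)
Lemma forcing_regular (Omega : set 'rV[R]_d) (T M M' : R) F F' :
  open Omega -> 0 < T -> space_time_measurable Omega T F' ->
  Linfty_norm Omega T F = M%:E -> Linfty_norm Omega T F' = M'%:E ->
  time_derivative Omega T F F' ->
  {ae lebesgue_rV R d, forall x, Omega x ->
    (forall t, 0 < t < T -> dotv (F x t) (F x t) <= 2 * M ^+ 2 + 2 * (M' * T) ^+ 2) /\
    (forall s t, 0 < s < T -> 0 < t < T ->
      dotv (F x t - F x s) (F x t - F x s) <= (M' * (t - s)) ^+ 2)}.
Proof.
move=> oO T0 mF' FM FM' FF'.
have bF := Linfty_bound FM; have bF' := Linfty_bound FM'.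
have := FF'; rewrite /time_derivative; move: bF bF'; apply: filterS3 => x h1 h2 h3 Ox.
have lip := lipschitz_of_derivative
  (fun i => measurable_time_slice i oO mF' Ox) (h2 Ox) (h3 Ox).
split; first exact: (bound_of_lipschitz T0 (h1 Ox) lip).
move=> s t /andP[s0 sT] /andP[t0 tT]; have [st|ts] := leP s t; first exact: lip.
have -> : dotv (F x t - F x s) (F x t - F x s) = dotv (F x s - F x t) (F x s - F x t).
  by rewrite /dotv; apply: eq_bigr => i _; rewrite !mxE; ring.
have -> : (M' * (t - s)) ^+ 2 = (M' * (s - t)) ^+ 2 by ring.
by apply: lip => //; exact: ltW.
Qed.

End forcing_bounds.

(** * Affine functions and barycentric coordinates *)

Section affine_functions.
Context (R : realType) (d : nat).
Implicit Types (x y g : 'rV[R]_d).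

Lemma dotvDr g x y : dotv g (x + y) = dotv g x + dotv g y.
Proof. by rewrite dotvC dotvDl !(dotvC g). Qed.

Lemma dotvZr g (k : R) x : dotv g (k *: x) = k * dotv g x.
Proof. by rewrite dotvC dotvZl dotvC. Qed.

Lemma dotvBr g x y : dotv g (x - y) = dotv g x - dotv g y.
Proof. by rewrite dotvDr -scaleN1r dotvZr mulN1r. Qed.

Lemma dotv_sumr g (I : Type) (s : seq I) (f : I -> 'rV[R]_d) :
  dotv g (\sum_(i <- s) f i) = \sum_(i <- s) dotv g (f i).
Proof.
elim/big_rec2: _ => [|i y1 y2 _ <-]; last by rewrite dotvDr.
by rewrite /dotv big1// => i _; rewrite mxE mulr0.
Qed.

Lemma dotv_suml g (I : Type) (s : seq I) (f : I -> 'rV[R]_d) :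
  dotv (\sum_(i <- s) f i) g = \sum_(i <- s) dotv (f i) g.
Proof. by rewrite dotvC dotv_sumr; apply: eq_bigr => i _; exact: dotvC. Qed.

Lemma continuous_dotv g : continuous (dotv g).
Proof.
move=> x; apply: (@cvg_bigsum _ _ _ (nbhs_filter x)) => i.
apply: cvgM; first exact: cvg_cst.
exact: coord_continuous.
Qed.

Lemma dotv_delta g i : dotv g (delta_mx ord0 i) = g ord0 i.
Proof.
rewrite /dotv (bigD1 i)//= big1 ?addr0 ?mxE ?eqxx ?mulr1// => j ji.
by rewrite mxE (negPf ji) mulr0.
Qed.

(** The gradient is a limit of difference quotients, so it depends on the values
    near [x] only. *)
Lemma grad_affine (v : 'rV[R]_d -> R) g (c : R) x :
  (\forall y \near x, v y = dotv g y + c) -> grad v x = g.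
Proof.
move=> vE; apply/rowP => i; rewrite mxE.
have -> : 'D_(delta_mx ord0 i) v x = 'D_(delta_mx ord0 i) (fun y => dotv g y + c) x.
  exact: near_eq_derive.
rewrite /derive; apply: cvg_lim => //.
apply: (cvg_trans _ (@cvg_cst _ (g ord0 i) _ _ (dnbhs_filter (0 : R)))).
apply: (@near_eq_cvg _ _ _ (dnbhs_filter (0 : R))).
have := @nbhs_dnbhs_neq R 0.
apply: (@filterS _ _ (dnbhs_filter (0 : R))) => h h0.
rewrite /= /shift/= dotvDr dotvZr dotv_delta.
have -> : h * g ord0 i + dotv g x + c - (dotv g x + c) = h * g ord0 i by ring.
by rewrite /GRing.scale/= mulKf.
Qed.

End affine_functions.

Section barycentric.
Context (R : realType) (d : nat) (K : d.+1.-tuple 'rV[R]_d).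
Implicit Types (x y : 'rV[R]_d).

Lemma convex_hull_tuple x : convex_hull K x <-> exists a : 'I_d.+1 -> R,
  [/\ forall i, 0 <= a i, \sum_i a i = 1 & x = \sum_i a i *: tnth K i].
Proof.
have sK := size_tuple K; split=> -[a [a0 a1 ->]].
  have bij : bijective (cast_ord (esym sK)).
    by exists (cast_ord sK) => i; rewrite ?cast_ordK ?cast_ordKV.
  exists (fun i => a (cast_ord (esym sK) i)); split => //.
    by rewrite -a1 [RHS](reindex _ (onW_bij _ bij)).
  rewrite [LHS](reindex _ (onW_bij _ bij)).
  by apply: eq_bigr => i _; rewrite (tnth_nth 0).
have bij : bijective (cast_ord sK).
  by exists (cast_ord (esym sK)) => i; rewrite ?cast_ordK ?cast_ordKV.
exists (fun i => a (cast_ord sK i)); split => //.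
  by rewrite -a1 [RHS](reindex _ (onW_bij _ bij)).
rewrite [LHS](reindex _ (onW_bij _ bij)).
by apply: eq_bigr => i _; rewrite (tnth_nth 0).
Qed.

Lemma convex_hull_vertex i : convex_hull K (tnth K i).
Proof.
apply/convex_hull_tuple; exists (fun j => (j == i)%:R); split=> [j||].
- by rewrite ler0n.
- by rewrite (bigD1 i)//= eqxx big1 ?addr0// => j /negPf ->.
- by rewrite (bigD1 i)//= eqxx scale1r big1 ?addr0// => j /negPf ->; rewrite scale0r.
Qed.

Let A := \matrix_(i < d) (tnth K (lift ord0 i) - tnth K ord0).

(** The columns of the inverse edge matrix are the gradients of the coordinates
    belonging to all vertices but the first; the sum of all gradients is zero. *)
Definition bary_grad (i : 'I_d.+1) : 'rV[R]_d :=
  if unlift ord0 i is Some j then (col j (invmx A))^T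
  else - \sum_(j < d) (col j (invmx A))^T.

Definition bary (i : 'I_d.+1) x : R :=
  dotv (bary_grad i) x + ((i == ord0)%:R - dotv (bary_grad i) (tnth K ord0)).

Lemma baryE i x : bary i x = (i == ord0)%:R + dotv (bary_grad i) (x - tnth K ord0).
Proof. by rewrite /bary dotvBr; ring. Qed.

Lemma bary_grad_sum : \sum_i bary_grad i = 0.
Proof.
rewrite big_ord_recl {1}/bary_grad unlift_none.
have -> : \sum_(j < d) bary_grad (lift ord0 j) = \sum_j (col j (invmx A))^T.
  by apply: eq_bigr => j _; rewrite /bary_grad liftK.
exact: addNr.
Qed.

Lemma bary_sum x : \sum_i bary i x = 1.
Proof.
under eq_bigr do rewrite baryE.
rewrite big_split/= -dotv_suml bary_grad_sum.
rewrite big_ord_recl eqxx big1 ?addr0//.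
by rewrite /dotv big1 ?addr0// => i _; rewrite mxE mul0r.
Qed.

Lemma bary_lift j x : bary (lift ord0 j) x = ((x - tnth K ord0) *m invmx A) ord0 j.
Proof.
rewrite baryE /bary_grad liftK add0r mxE /dotv.
by apply: eq_bigr => k _; rewrite !mxE mulrC.
Qed.

Lemma affine_combination (a : 'I_d.+1 -> R) : \sum_i a i = 1 ->
  \sum_i a i *: tnth K i = tnth K ord0 + (\row_j a (lift ord0 j)) *m A.
Proof.
move=> a1.
have -> : (\row_j a (lift ord0 j)) *m A =
    \sum_(j < d) a (lift ord0 j) *: (tnth K (lift ord0 j) - tnth K ord0).
  rewrite mulmx_sum_row; apply: eq_bigr => j _; rewrite mxE; congr (_ *: _).
  by apply/rowP => k; rewrite !mxE.
rewrite big_ord_recl; under [in RHS]eq_bigr do rewrite scalerBr.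
rewrite sumrB -scaler_suml.
move: a1; rewrite big_ord_recl => /eqP; rewrite eq_sym -subr_eq => /eqP <-.
by rewrite scalerBl scale1r addrCA addrC.
Qed.

Hypothesis indepK : affinely_independent K.

Let unitA : A \in unitmx.
Proof. by rewrite -row_free_unit. Qed.

Lemma bary_combination x : \sum_i bary i x *: tnth K i = x.
Proof.
rewrite affine_combination ?bary_sum//.
have -> : \row_j bary (lift ord0 j) x = (x - tnth K ord0) *m invmx A.
  by apply/rowP => j; rewrite mxE bary_lift.
by rewrite mulmxKV// addrC subrK.
Qed.

(** Subtracting the first vertex turns affine combinations into linear ones, which
    the inverse edge matrix undoes. *)
Lemma bary_unique (a : 'I_d.+1 -> R) i : \sum_i a i = 1 ->
  bary i (\sum_i a i *: tnth K i) = a i.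
Proof.
move=> a1; have lft j : bary (lift ord0 j) (\sum_i a i *: tnth K i) = a (lift ord0 j).
  by rewrite bary_lift affine_combination// [tnth K ord0 + _]addrC addrK mulmxK// mxE.
case: (unliftP ord0 i) => [j ->|->]; first exact: lft.
have := bary_sum (\sum_i a i *: tnth K i).
rewrite -[X in _ = X]a1; move: (\sum_i a i *: tnth K i) lft => y lft.
rewrite !big_ord_recl.
have -> : \sum_(j < d) bary (lift ord0 j) y = \sum_(j < d) a (lift ord0 j).
  by apply: eq_bigr => j _; exact: lft.
by move=> /addIr.
Qed.

(** A constant coordinate would take the values 0 and 1 at two different vertices,
    which exist because [0 < d]. It follows that the faces lie in hyperplanes. *)
Lemma bary_grad_neq0 i : (0 < d)%N -> bary_grad i != 0.
Proof.
move=> d0; apply/eqP => gi0.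
have cst x y : bary i x = bary i y.
  by rewrite /bary gi0 /dotv !big1// => j _; rewrite mxE mul0r.
have vertex j : bary i (tnth K j) = (i == j)%:R.
  have := @bary_unique (fun k => (k == j)%:R) i.
  rewrite (bigD1 j)//= eqxx big1 ?addr0 => [|k /negPf -> //].
  rewrite (bigD1 j)//= eqxx scale1r big1 ?addr0; first by apply.
  by move=> k /negPf ->; rewrite scale0r.
have [j ij] : exists j, i != j.
  have [->|i0] := eqVneq i ord0; last by exists ord0.
  by exists (lift ord0 (Ordinal d0)); exact: neq_lift.
have := cst (tnth K i) (tnth K j); rewrite !vertex eqxx (negPf ij).
by move/eqP; rewrite oner_eq0.
Qed.

Definition open_simplex : set 'rV[R]_d := [set x | forall i, 0 < bary i x].

Lemma continuous_bary i : continuous (bary i).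
Proof. move=> x; apply: (@cvgD _ _ _ _ (nbhs_filter x)); last exact: cvg_cst.
exact: continuous_dotv. Qed.

Lemma open_open_simplex : open open_simplex.
Proof.
rewrite openE => x x0; rewrite /interior.
have : \forall y \near nbhs x, forall i, 0 < bary i y.
  apply: (@filter_forall _ _ _ _ (nbhs_filter x)) => i; apply: (@cvgr_gt _ _ _ (nbhs_filter x) _ (bary i x)).
    exact: continuous_bary.
  exact: x0.
by [].
Qed.

Lemma open_simplex_hull : open_simplex `<=` convex_hull K.
Proof.
move=> x x0; apply/convex_hull_tuple; exists (bary^~ x); split.
- by move=> i; exact: ltW.
- exact: bary_sum.
- by rewrite bary_combination.
Qed.

Lemma convex_hull_bary x : convex_hull K x -> forall i, 0 <= bary i x.
Proof. by move=> /convex_hull_tuple[a [a0 a1 ->]] i; rewrite bary_unique. Qed.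

Lemma affine_interpolation (v : 'rV[R]_d -> R) :
  (exists g c, forall x, convex_hull K x -> v x = dotv g x + c) ->
  forall x, convex_hull K x -> v x = \sum_i v (tnth K i) * bary i x.
Proof.
move=> [g [c vE]] x Kx.
under eq_bigr => i _ do rewrite (vE _ (convex_hull_vertex i)) mulrDl.
rewrite big_split/= -mulr_sumr bary_sum mulr1 vE//; congr (_ + _).
rewrite -{1}(bary_combination x) dotv_sumr.
by apply: eq_bigr => i _; rewrite dotvZr mulrC.
Qed.

(** Near a point of the open simplex the function agrees with its affine
    interpolant. *)
Lemma grad_interpolation (v : 'rV[R]_d -> R) :
  (exists g c, forall x, convex_hull K x -> v x = dotv g x + c) ->
  forall x, open_simplex x -> grad v x = \sum_i v (tnth K i) *: bary_grad i.
Proof.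
move=> va x xK.
apply: (@grad_affine _ _ _ _
  (\sum_i v (tnth K i) * ((i == ord0)%:R - dotv (bary_grad i) (tnth K ord0)))).
have : open_nbhs x open_simplex by split => //; exact: open_open_simplex.
move/open_nbhs_nbhs; apply: filterS => y /open_simplex_hull Ky.
rewrite (affine_interpolation va Ky) dotv_suml -big_split/=.
by apply: eq_bigr => i _; rewrite dotvZl /bary mulrDr.
Qed.

End barycentric.

(** * Mass, stiffness and drift forms *)

Section energy_forms.
Context {R : realType} {disp : measure_display} {X : measurableType disp}.
Variables (mu : {measure set X -> \bar R}) (D : set X).
Hypotheses (mD : measurable D) (Dlty : (mu D < +oo)%E).

(** A class of integrable functions closed under sums and products, so that every
    integral below exists. *)
Definition bounded_measurable (f : X -> R) :=
  measurable_fun D f /\ exists k, forall x, D x -> `|f x| <= k.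

Lemma bounded_measurableD f g : bounded_measurable f -> bounded_measurable g ->
  bounded_measurable (fun x => f x + g x).
Proof.
move=> [mf [k fk]] [mg [l gl]]; split; first exact: measurable_funD.
exists (k + l) => x Dx; apply: (le_trans (ler_normD _ _)).
by apply: lerD; [exact: fk|exact: gl].
Qed.

Lemma bounded_measurableM f g : bounded_measurable f -> bounded_measurable g ->
  bounded_measurable (fun x => f x * g x).
Proof.
move=> [mf [k fk]] [mg [l gl]]; split; first exact: measurable_funM.
exists (k * l) => x Dx; rewrite normrM.
by apply: ler_pM => //; [exact: fk|exact: gl].
Qed.

Lemma bounded_measurable_cst k : bounded_measurable (cst k).
Proof. by split; [exact: measurable_cst|exists `|k|]. Qed.

Lemma bounded_measurable_sum (I : Type) (s : seq I) (f : I -> X -> R) :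
  (forall i, bounded_measurable (f i)) ->
  bounded_measurable (fun x => \sum_(i <- s) f i x).
Proof.
move=> bf; elim: s => [|i s IH].
  have -> : (fun x => \sum_(i <- [::]) f i x) = cst 0.
    by apply/funext => x; rewrite big_nil.
  exact: bounded_measurable_cst.
have -> : (fun x => \sum_(j <- i :: s) f j x) = (fun x => f i x + \sum_(j <- s) f j x).
  by apply/funext => x; rewrite big_cons.
exact: bounded_measurableD.
Qed.

Lemma bounded_measurable_integrable f : bounded_measurable f ->
  mu.-integrable D (EFin \o f).
Proof. by move=> [mf [k fk]]; apply: (@integrable_bounded _ _ _ _ _ _ k). Qed.

Context {I : finType}.
Implicit Types (p q : I -> R).

Lemma bil_Rintegral (E : I -> I -> X -> R) p q :
  (forall i j, bounded_measurable (E i j)) ->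
  bil (fun i j => \int[mu]_(x in D) E i j x) p q =
  \int[mu]_(x in D) bil (fun i j => E i j x) p q.
Proof.
move=> bE; rewrite /bil.
have bEj i j : bounded_measurable (fun x => q j * E i j x).
  by apply: bounded_measurableM => //; exact: bounded_measurable_cst.
have bEi i : bounded_measurable (fun x => \sum_j q j * E i j x).
  exact: bounded_measurable_sum.
have [|_ ->] := @Rintegral_sum _ _ _ mu D _ (index_enum I)
    (fun i x => (\sum_j q j * E i j x) * p i) mD.
  move=> i; apply: bounded_measurable_integrable; apply: bounded_measurableM => //.
  exact: bounded_measurable_cst.
apply: eq_bigr => i _; rewrite RintegralZr//; last exact: bounded_measurable_integrable.
congr (_ * _).
have [|_ ->] := @Rintegral_sum _ _ _ mu D _ (index_enum I) (fun j x => q j * E i j x) mD.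
  by move=> j; exact: bounded_measurable_integrable.
by apply: eq_bigr => j _; rewrite RintegralZl//; exact: bounded_measurable_integrable.
Qed.

Lemma bil_mul (f h : I -> R) p q :
  bil (fun i j => f i * h j) p q = (\sum_i p i * f i) * (\sum_j q j * h j).
Proof.
rewrite /bil mulr_suml; apply: eq_bigr => i _.
rewrite mulr_suml mulr_sumr; apply: eq_bigr => j _; ring.
Qed.

Context {d : nat}.

Lemma bil_dotv (f h : I -> 'rV[R]_d) p q :
  bil (fun i j => dotv (f i) (h j)) p q =
  dotv (\sum_i p i *: f i) (\sum_j q j *: h j).
Proof.
rewrite /bil dotv_suml; apply: eq_bigr => i _.
rewrite dotv_sumr mulr_suml; apply: eq_bigr => j _.
by rewrite dotvZl dotvZr; ring.
Qed.

Definition bounded_measurable_field (H : X -> 'rV[R]_d) :=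
  forall k, bounded_measurable (fun x => H x ord0 k).

Lemma bounded_measurable_dotv (H H' : X -> 'rV[R]_d) :
  bounded_measurable_field H -> bounded_measurable_field H' ->
  bounded_measurable (fun x => dotv (H x) (H' x)).
Proof. by move=> bH bH'; apply: bounded_measurable_sum => k; exact: bounded_measurableM. Qed.

Variables (e : I -> X -> R) (ge : I -> X -> 'rV[R]_d).
Hypotheses (be : forall i, bounded_measurable (e i))
  (bge : forall i, bounded_measurable_field (ge i)).

Definition mass i j : R := \int[mu]_(x in D) (e i x * e j x).
Definition stiffness i j : R := \int[mu]_(x in D) dotv (ge i x) (ge j x).
Definition drift (H : X -> 'rV[R]_d) i j : R :=
  \int[mu]_(x in D) (e i x * dotv (H x) (ge j x)).

Lemma bil_mass p q : bil mass p q =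
  \int[mu]_(x in D) ((\sum_i p i * e i x) * (\sum_j q j * e j x)).
Proof.
rewrite /mass bil_Rintegral; last by move=> i j; exact: bounded_measurableM.
by apply: eq_Rintegral => x _; rewrite bil_mul.
Qed.

Lemma bil_stiffness p q : bil stiffness p q =
  \int[mu]_(x in D) dotv (\sum_i p i *: ge i x) (\sum_j q j *: ge j x).
Proof.
rewrite /stiffness bil_Rintegral; last by move=> i j; exact: bounded_measurable_dotv.
by apply: eq_Rintegral => x _; rewrite bil_dotv.
Qed.

Lemma bil_drift H p q : bounded_measurable_field H -> bil (drift H) p q =
  \int[mu]_(x in D) ((\sum_i p i * e i x) * dotv (H x) (\sum_j q j *: ge j x)).
Proof.
move=> bH; rewrite /drift bil_Rintegral; last first.
  by move=> i j; apply: bounded_measurableM => //; exact: bounded_measurable_dotv.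
apply: eq_Rintegral => x _; rewrite bil_mul; congr (_ * _).
by rewrite dotv_sumr; apply: eq_bigr => j _; rewrite dotvZr.
Qed.

Lemma mass_ge0 p : 0 <= bil mass p p.
Proof.
by rewrite bil_mass; apply: Rintegral_ge0 => x _; rewrite -expr2 sqr_ge0.
Qed.

Lemma stiffness_ge0 p : 0 <= bil stiffness p p.
Proof. by rewrite bil_stiffness; apply: Rintegral_ge0 => x _; exact: dotv_ge0. Qed.

(** Young inequality under the integral, with [V] the scalar and [Q] the gradient
    part: [V H . Q <= (k V^2 H . H + Q . Q / k) / 2]. *)
Lemma drift_young H p q (k a : R) : 0 < k -> bounded_measurable_field H ->
  (forall x, D x -> dotv (H x) (H x) <= a) ->
  bil (drift H) p q <= (k * a * bil mass p p + k^-1 * bil stiffness q q) / 2.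
Proof.
move=> k0 bH Ha; rewrite bil_drift// bil_mass bil_stiffness.
pose V x := \sum_i p i * e i x; pose Q x := \sum_j q j *: ge j x.
have bV : bounded_measurable V.
  apply: bounded_measurable_sum => i; apply: bounded_measurableM => //.
  exact: bounded_measurable_cst.
have bQ : bounded_measurable_field Q.
  move=> l; have -> : (fun x => Q x ord0 l) = (fun x => \sum_j q j * ge j x ord0 l).
    by apply/funext => x; rewrite summxE; apply: eq_bigr => j _; rewrite mxE.
  apply: bounded_measurable_sum => j; apply: bounded_measurableM; last exact: bge.
  exact: bounded_measurable_cst.
have iVV : mu.-integrable D (EFin \o (fun x => V x * V x)).
  by apply: bounded_measurable_integrable; exact: bounded_measurableM.
have iQQ : mu.-integrable D (EFin \o (fun x => dotv (Q x) (Q x))).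
  by apply: bounded_measurable_integrable; exact: bounded_measurable_dotv.
have iVV' := integrable_mull (k * a / 2) mD iVV.
have iQQ' := integrable_mull (k^-1 / 2) mD iQQ.
have -> : (k * a * \int[mu]_(x in D) (V x * V x) +
    k^-1 * \int[mu]_(x in D) dotv (Q x) (Q x)) / 2 =
    \int[mu]_(x in D) (k * a / 2 * (V x * V x) + k^-1 / 2 * dotv (Q x) (Q x)).
  by rewrite RintegralD// RintegralZl// RintegralZl//; ring.
apply: le_Rintegral.
- exact: mD.
- apply: bounded_measurable_integrable; apply: bounded_measurableM => //.
  exact: bounded_measurable_dotv.
- exact: integrable_addr.
move=> x Dx; have := dotv_young (V x *: H x) (Q x) k0.
rewrite !dotvZl dotvZr => /le_trans; apply.
have -> : k * a / 2 * (V x * V x) + k^-1 / 2 * dotv (Q x) (Q x) =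
  (k * (V x * (V x * a)) + k^-1 * dotv (Q x) (Q x)) / 2 by ring.
rewrite ler_pM2r ?invr_gt0// lerD2r ler_pM2l// !mulrA ler_wpM2l//.
  by rewrite -expr2 sqr_ge0.
exact: Ha.
Qed.

(** The bound on the increments of the drift form is [drift_young] for the field
    [F t - F s], with a weight scaled by [L |t - s|] so that both terms carry one
    factor [L |t - s|]. *)
Lemma energy_forms_system (alpha T c0 M L : R) (c : I -> R -> R)
    (F : X -> R -> 'rV[R]_d) : 0 < L ->
  (forall i, {within `[0, T], continuous (c i)}) ->
  (forall i x, 0 < x < T -> derivable (c i) x 1) ->
  (forall i a b, 0 < a -> b < T ->
     exists k, forall x, a <= x <= b -> `|derive1 (c i) x| <= k) ->
  (forall t, 0 < t < T -> bounded_measurable_field (F^~ t)) ->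
  (forall x t, D x -> 0 < t < T -> dotv (F x t) (F x t) <= M ^+ 2) ->
  (forall x s t, D x -> 0 < s < T -> 0 < t < T ->
     dotv (F x t - F x s) (F x t - F x s) <= (L * `|t - s|) ^+ 2) ->
  (forall t tau, 0 < t < T -> 0 <= tau <= T ->
    let dc i := derive1 (c i) t in
    let dv i := derive1 (fun s => c0 * abel alpha (c i) s) t in
    bil mass dc (c^~ tau) + bil stiffness dv (c^~ tau)
      - bil (drift (F^~ t)) dv (c^~ tau) = 0) ->
  fractional_system alpha T c0 M L c mass stiffness (fun t => drift (F^~ t)).
Proof.
move=> L0 cc dc dcb bF FM FL eqc; split => //.
- by move=> i j; apply: eq_Rintegral => x _; rewrite mulrC.
- exact: mass_ge0.
- exact: stiffness_ge0.
- by move=> t p q tT th th0; apply: drift_young => //; [exact: bF|move=> x Dx; exact: FM].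
move=> s t p q sT tT th th0.
have [->|st] := eqVneq s t; first by rewrite !subrr normr0 mulr0 mul0r.
have ts0 : 0 < `|t - s| by rewrite normr_gt0 subr_eq0 eq_sym.
have bH : bounded_measurable_field (fun x => F x t - F x s).
  move=> k; have -> : (fun x => (F x t - F x s) ord0 k) =
      (fun x => F x t ord0 k + (-1) * F x s ord0 k).
    by apply/funext => x; rewrite !mxE mulN1r.
  apply: bounded_measurableD; first exact: bF.
  by apply: bounded_measurableM; [exact: bounded_measurable_cst|exact: bF].
have -> : bil (drift (F^~ t)) p q - bil (drift (F^~ s)) p q =
    bil (drift (fun x => F x t - F x s)) p q.
  rewrite -bilB_form; congr (bil _ p q); apply/funext => i; apply/funext => j.
  have i1 r : 0 < r < T -> mu.-integrable D (EFin \o (fun x => e i x * dotv (F x r) (ge j x))).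
    move=> rT; apply: bounded_measurable_integrable; apply: bounded_measurableM => //.
    by apply: bounded_measurable_dotv => //; exact: bF.
  rewrite /drift -RintegralB//; [|exact: i1|exact: i1].
  apply: eq_Rintegral => x _; rewrite -mulrBr; congr (_ * _).
  by rewrite [RHS]dotvC dotvBr !(dotvC (ge j x)).
have Lts : 0 < L * `|t - s| by rewrite mulr_gt0.
have := @drift_young _ p q (th / (L * `|t - s|)) _ (divr_gt0 th0 Lts) bH
  (fun x Dx => FL x s t Dx sT tT).
move/le_trans; apply; rewrite invf_div.
move: (bil mass p p) (bil stiffness q q) => a b.
by rewrite le_eqVlt; apply/orP; left; apply/eqP; field; rewrite !gt_eqF.
Qed.

End energy_forms.

(** * Riemann-Liouville derivatives of finite expansions *)

Section fractional_derivative.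
Context {R : realType}.
Implicit Types (alpha T t : R) (phi : R -> R).

Lemma fracint_abel alpha t phi : 0 < alpha -> 0 <= t ->
  {within `[0, t], continuous phi} ->
  fracint alpha phi t = (Gamma alpha)^-1 * abel alpha phi t.
Proof.
move=> a0 t0 cphi.
have [mphi [m phim]] := within_itvcc_bounded_measurable t0 cphi.
rewrite /fracint /abel -RintegralZl//; last exact: integrable_abel phim.
by apply: eq_Rintegral => s _; rewrite /omega -mulrA mulrCA.
Qed.

(** The Abel integral is linear, so both sides are derivatives of functions that
    agree near [t]; the Abel integral of each [c i] is differentiable there. *)
Lemma RLderiv1m_sum (I : finType) alpha T t (k : I -> R) (c : I -> R -> R) phi :
  0 < alpha < 1 -> 0 < t < T ->
  (forall i, {within `[0, T], continuous (c i)}) ->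
  (forall i x, 0 < x < T -> derivable (c i) x 1) ->
  (forall i a b, 0 < a -> b < T ->
     exists k, forall x, a <= x <= b -> `|derive1 (c i) x| <= k) ->
  (forall s, 0 <= s <= T -> phi s = \sum_i k i * c i s) ->
  RLderiv1m alpha phi t =
  \sum_i k i * derive1 (fun s => (Gamma alpha)^-1 * abel alpha (c i) s) t.
Proof.
move=> al01 tT cc dc dcb phiE; have /andP[al0 al1] := al01.
have dabel i : derivable (fun s => (Gamma alpha)^-1 * abel alpha (c i) s) t 1.
  apply: derivableM; first exact: derivable_cst.
  exact: (abel_derivable al01 tT (cc i) (dc i) (dcb i)).
have dsum : is_derive t 1
    (fun s => \sum_i k i * ((Gamma alpha)^-1 * abel alpha (c i) s))
    (\sum_i k i * derive1 (fun s => (Gamma alpha)^-1 * abel alpha (c i) s) t).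
  apply: is_derive_bigsum => i; apply: is_deriveZ.
  by rewrite derive1E; exact: derivableP.
have sub s : 0 <= s <= T -> forall f : R -> R, {within `[0, T], continuous f} ->
    {within `[0, s], continuous f}.
  move=> /andP[s0 sT] f; apply: continuous_subspaceW.
  by apply: subset_itvl; rewrite bnd_simp.
have E s : 0 < s < T -> \sum_i k i * ((Gamma alpha)^-1 * abel alpha (c i) s) =
    fracint alpha phi s.
  move=> /andP[s0 sT]; have s0' := ltW s0; have sT' := ltW sT.
  have s0T : 0 <= s <= T by rewrite s0'.
  have -> : fracint alpha phi s = fracint alpha (fun r => \sum_i k i * c i r) s.
    apply: eq_Rintegral => r; rewrite mem_itvcc => /andP[r0 rs].
    by rewrite phiE// r0 (le_trans rs).
  have csum : {within `[0, s], continuous (fun r => \sum_i k i * c i r)}.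
    move=> x; apply: cvg_bigsum => i; apply: cvgM; first exact: cvg_cst.
    exact: (sub s s0T _ (cc i)).
  rewrite fracint_abel// abel_sum//; last by move=> i; exact: sub.
  by rewrite mulr_sumr; apply: eq_bigr => i _; rewrite mulrCA.
rewrite /RLderiv1m derive1E.
apply: derive_val; apply: near_eq_is_derive dsum.
have /near_in_itvoo : t \in `]0, T[ by rewrite in_itv.
by apply: filterS => s; rewrite in_itv/= => /E.
Qed.

Lemma derive1_sum (I : finType) T t (k : I -> R) (c : I -> R -> R) phi :
  0 < t < T -> (forall i x, 0 < x < T -> derivable (c i) x 1) ->
  (forall s, 0 <= s <= T -> phi s = \sum_i k i * c i s) ->
  derive1 phi t = \sum_i k i * derive1 (c i) t.
Proof.
move=> tT dc phiE.
have dsum : is_derive t 1 (fun s => \sum_i k i * c i s) (\sum_i k i * derive1 (c i) t).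
  apply: is_derive_bigsum => i; apply: is_deriveZ.
  by rewrite derive1E; apply: derivableP; exact: dc.
rewrite derive1E; apply: derive_val; apply: near_eq_is_derive dsum.
have /near_in_itvoo : t \in `]0, T[ by rewrite in_itv.
apply: filterS => s; rewrite in_itv/= => /andP[s0 sT].
by rewrite phiE// !ltW.
Qed.

End fractional_derivative.

(** * Shape functions of a mesh *)

Section shape_functions.
Context {R : realType} {d : nat}.
Variables (Omega : set 'rV[R]_d) (Th : mesh R d).
Hypothesis triTh : triangulation Omega Th.
Local Notation idx := ('I_(size Th) * 'I_d.+1)%type.

Definition simplex k : d.+1.-tuple 'rV[R]_d := nth [tuple of nseq d.+1 0] Th k.

Definition vertex (j : idx) : 'rV[R]_d := tnth (simplex j.1) j.2.

(** Neighbouring closed elements overlap in faces; the open simplices miss the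
    faces, a null set. *)
Definition cell k : set 'rV[R]_d :=
  if (k < size Th)%N then open_simplex (simplex k) else set0.

(** The value at [x] of the hat function of one vertex within one element, and 0
    outside it. A function that is continuous and piecewise linear is expanded
    element by element, without identifying the vertices that elements share.
    Taking differences of the cells makes them disjoint by construction. *)
Definition shape (j : idx) x : R :=
  \1_(seqDU cell j.1) x * bary (simplex j.1) j.2 x.

Definition shape_grad (j : idx) x : 'rV[R]_d :=
  \1_(seqDU cell j.1) x *: bary_grad (simplex j.1) j.2.

Lemma simplex_mesh (k : 'I_(size Th)) : simplex k \in Th.
Proof. exact: mem_nth. Qed.

Lemma simplex_indep (k : 'I_(size Th)) : affinely_independent (simplex k).
Proof. by case: triTh => h _ _; apply: h; exact: simplex_mesh. Qed.

Lemma simplex_closure (k : 'I_(size Th)) :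
  convex_hull (simplex k) `<=` closure Omega.
Proof.
by case: triTh => _ -> _ x Kx; exists (simplex k) => //; exact: simplex_mesh.
Qed.

Lemma vertex_closure j : closure Omega (vertex j).
Proof. by apply: simplex_closure; exact: convex_hull_vertex. Qed.

Lemma cell_measurable k : measurable (cell k).
Proof.
rewrite /cell; case: ifP => // _.
by apply: open_rV_measurable; exact: open_open_simplex.
Qed.

Lemma sum_one_cell (V : nmodType) (k0 : 'I_(size Th)) (f : idx -> V) :
  (forall j, j.1 != k0 -> f j = 0) -> \sum_j f j = \sum_i f (k0, i).
Proof.
move=> f0; have -> : \sum_j f j = \sum_k \sum_i f (k, i).
  by rewrite pair_big; apply: eq_bigr => -[].
rewrite (bigD1 k0)//= [X in _ + X]big1 ?addr0// => k kk0.
by rewrite big1// => i _; exact: f0.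
Qed.

Lemma cover_cell x : (exists k, cell k x) ->
  exists k : 'I_(size Th), seqDU cell k x /\ open_simplex (simplex k) x.
Proof.
move=> [k kx]; have : (\bigcup_k cell k) x by exists k.
rewrite seqDU_bigcup_eq => -[l _ lx].
have := subset_seqDU lx; rewrite /cell; case: ifP => // lTh xl.
by exists (Ordinal lTh).
Qed.

Lemma shape_off x (k0 : 'I_(size Th)) (j : idx) : seqDU cell k0 x -> j.1 != k0 ->
  \1_(seqDU cell j.1) x = 0 :> R.
Proof.
move=> k0x jk; rewrite indicE memNset// => jx.
move/eqP: jk; apply; apply: val_inj.
by apply: (@trivIset_seqDU _ cell) => //; exists x.
Qed.

(** Only the one cell that contains [x] contributes, and in it the function equals
    its interpolant. *)
Lemma shape_expansion bc v x : fe_space Omega bc Th v -> (exists k, cell k x) ->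
  v x = \sum_j v (vertex j) * shape j x /\
  grad v x = \sum_j v (vertex j) *: shape_grad j x.
Proof.
move=> [_ vaff _] /cover_cell[k [kx xk]].
have va := vaff _ (simplex_mesh k).
have one : \1_(seqDU cell k) x = 1 :> R by rewrite indicE mem_set.
split.
  rewrite (sum_one_cell (k0 := k)); last first.
    by move=> j jk; rewrite /shape (shape_off kx jk) mul0r mulr0.
  rewrite {1}(affine_interpolation (simplex_indep k) va); last exact: open_simplex_hull (simplex_indep k) _ xk.
  by apply: eq_bigr => i _; rewrite /shape one mul1r.
rewrite (sum_one_cell (k0 := k)); last first.
  by move=> j jk; rewrite /shape_grad (shape_off kx jk) scale0r scaler0.
rewrite (grad_interpolation (simplex_indep k) va)//.
by apply: eq_bigr => i _; rewrite /shape_grad one scale1r.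
Qed.

(** A point of an element with no vanishing barycentric coordinate is interior to
    it; the others lie on finitely many hyperplanes. *)
Lemma ae_cell : (0 < d)%N ->
  {ae lebesgue_rV R d, forall x, Omega x -> exists k, cell k x}.
Proof.
move=> d0.
have : {ae lebesgue_rV R d, forall x, forall k : nat, (k < size Th)%N ->
    forall i, bary (simplex k) i x != 0}.
  apply: ae_foralln => k.
  have [kTh|kTh] := ltnP k (size Th); last by apply: aeW.
  suff : {ae lebesgue_rV R d, forall x, forall i, bary (simplex k) i x != 0}.
    by apply: filterS.
  apply: filter_forall => i.
  exists (hyperplane (bary_grad (simplex k) i)
    (- ((i == ord0)%:R - dotv (bary_grad (simplex k) i) (tnth (simplex k) ord0)))).
  split; first exact: measurable_hyperplane.
    by apply: hyperplane_null; apply: bary_grad_neq0 => //; exact: (simplex_indep (Ordinal kTh)).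
  by move=> x /= /negP; rewrite negbK => /eqP; rewrite /hyperplane /= /bary => /eqP; rewrite addr_eq0 => /eqP.
apply: filterS => x xN Ox.
have : closure Omega x by exact: subset_closure.
case: triTh => indep -> _ [K KTh Kx].
have iTh : (index K Th < size Th)%N by rewrite index_mem.
have KE : simplex (index K Th) = K by rewrite /simplex nth_index.
exists (index K Th); rewrite /cell iTh KE => i.
have := xN _ iTh i; rewrite KE => b0.
by rewrite lt_neqAle eq_sym b0 (convex_hull_bary (indep _ KTh)).
Qed.

Lemma shape_bounded_measurable (D : set 'rV[R]_d) j : measurable D -> bounded_set D ->
  bounded_measurable D (shape j).
Proof.
move=> mD [M [_ DM]].
have bind : bounded_measurable D (\1_(seqDU cell j.1)).
  split.
    by apply: measurable_indic; apply: seqDU_measurable => k; exact: cell_measurable.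
  by exists 1 => x _; rewrite indicE; case: (_ \in _); rewrite ?normr1 ?normr0.
apply: bounded_measurableM => //; apply: bounded_measurableD; last exact: bounded_measurable_cst.
apply: bounded_measurable_sum => k; apply: bounded_measurableM.
  exact: bounded_measurable_cst.
split; first by apply: measurable_funTS; exact: measurable_coor.
have Mlt : M < M + 1 by rewrite ltrDl.
exists (M + 1) => x Dx; apply: le_trans (DM _ Mlt x Dx).
by rewrite [leRHS]mx_normrE; apply: (le_trans _ (le_bigmax _ _ (ord0, k))).
Qed.

Lemma shape_grad_bounded_measurable (D : set 'rV[R]_d) j : measurable D ->
  bounded_measurable_field D (shape_grad j).
Proof.
move=> mD k.
have -> : (fun x => shape_grad j x ord0 k) =
    (fun x => \1_(seqDU cell j.1) x * bary_grad (simplex j.1) j.2 ord0 k).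
  by apply/funext => x; rewrite /shape_grad mxE.
apply: bounded_measurableM => //; last exact: bounded_measurable_cst.
split.
  by apply: measurable_indic; apply: seqDU_measurable => l; exact: cell_measurable.
by exists 1 => x _; rewrite indicE; case: (_ \in _); rewrite ?normr1 ?normr0.
Qed.

End shape_functions.

(** * Reduction to a fractional system and conclusion *)

Lemma Gamma_ge0 (R : realType) (x : R) : 0 <= Gamma x.
Proof.
by apply: Rintegral_ge0 => t _; rewrite mulr_ge0 ?powR_ge0 ?expR_ge0.
Qed.

(** The coordinates are the values of [u] at the vertices of the elements. The
    equations are tested with [u tau], which is a finite element function, while
    the single shape functions, being discontinuous, are not. *)
Lemma semidiscrete_system (R : realType) (alpha T M M' : R) (d : nat)
    (Omega : set 'rV[R]_d) (F F' : 'rV[R]_d -> R -> 'rV[R]_d)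
    (bc : boundary_condition) (Th : mesh R d)
    (u0h : 'rV[R]_d -> R) (u : R -> 'rV[R]_d -> R) :
  0 < alpha < 1 -> 0 < T -> (1 <= d)%N -> open Omega -> bounded_set Omega ->
  space_time_measurable Omega T F -> Linfty_norm Omega T F = M%:E ->
  space_time_measurable Omega T F' -> Linfty_norm Omega T F' = M'%:E ->
  time_derivative Omega T F F' -> triangulation Omega Th ->
  semidiscrete_solution Omega T alpha F bc Th u0h u ->
  exists (I : finType) (c : I -> R -> R) G S B,
    fractional_system alpha T (Gamma alpha)^-1
      (Num.sqrt (2 * M ^+ 2 + 2 * (M' * T) ^+ 2)) (`|M'| + 1) c G S B /\
    forall t, 0 <= t <= T -> inner Omega (u t) (u t) = bil G (c^~ t) (c^~ t).
Proof.
move=> al01 T0 d0 oO bO mF FM mF' FM' FF' tri [ufe cu [w hw] u0 eqn].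
have mO := open_rV_measurable oO.
have [N [mN N0 HN]] : {ae lebesgue_rV R d, forall x, Omega x ->
    (exists k, cell Th k x) /\
    (forall t, 0 < t < T -> dotv (F x t) (F x t) <= 2 * M ^+ 2 + 2 * (M' * T) ^+ 2) /\
    (forall s t, 0 < s < T -> 0 < t < T ->
      dotv (F x t - F x s) (F x t - F x s) <= (M' * (t - s)) ^+ 2)}.
  have := forcing_regular oO T0 mF' FM FM' FF'; have := ae_cell tri d0.
  by apply: filterS2 => x h1 h2 Ox; split; [exact: h1|exact: h2].
pose D := Omega `\` N.
have mD : measurable D by exact: measurableD.
have DO : D `<=` Omega by exact: subDsetl.
have bD : bounded_set D.
  by case: bO => m [mr Om]; exists m; split=> // e /Om Oe x /DO; exact: Oe.
have Dlty := bounded_rV_lty mD bD.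
have DP x : D x -> (exists k, cell Th k x) /\
    (forall t, 0 < t < T -> dotv (F x t) (F x t) <= 2 * M ^+ 2 + 2 * (M' * T) ^+ 2) /\
    (forall s t, 0 < s < T -> 0 < t < T ->
      dotv (F x t - F x s) (F x t - F x s) <= (M' * (t - s)) ^+ 2).
  move=> [Ox nNx]; apply: contrapT => h; apply: nNx; apply: HN => /(_ Ox); exact: h.
have restr (f : 'rV[R]_d -> R) : \int[lebesgue_rV R d]_(x in Omega) f x =
    \int[lebesgue_rV R d]_(x in D) f x by exact: Rintegral_setD_null.
pose c (j : 'I_(size Th) * 'I_d.+1) t := u t (vertex j).
have cc j : {within `[0, T], continuous (c j)}.
  exact: (cu _ (@vertex_closure _ _ _ _ tri j)).
have wc j t : 0 < t < T -> is_derive t 1 (c j) (w t (vertex j)).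
  by move=> tT; have [_] := hw _ (@vertex_closure _ _ _ _ tri j); apply.
have dc j t : 0 < t < T -> derivable (c j) t 1 by move=> /(wc j)[].
have dcb j a b : 0 < a -> b < T ->
    exists k, forall x, a <= x <= b -> `|derive1 (c j) x| <= k.
  move=> a0 bT; have [ab|ba] := leP a b; last by exists 0 => x /andP[ax /(le_trans ax)]; rewrite leNgt ba.
  have [cw _] := hw _ (@vertex_closure _ _ _ _ tri j).
  have [|_ [k wk]] := @within_itvcc_bounded_measurable _ a b (w^~ (vertex j)) ab.
    apply: continuous_subspaceW cw => x /=; rewrite !in_itv/=.
    by move=> /andP[ax xb]; apply/andP; split; lra.
  exists k => x /andP[ax xb].
  have := wc j x ltac:(lra); rewrite derive1E => h; rewrite derive_val.
  by apply: wk; rewrite ax.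
have ux x t : D x -> 0 <= t <= T -> u t x = \sum_j shape j x * c j t.
  move=> /DP[cx _] tT; have [-> _] := shape_expansion tri (ufe t tT) cx.
  by apply: eq_bigr => j _; exact: mulrC.
have ugx x t : D x -> 0 <= t <= T -> grad (u t) x = \sum_j c j t *: shape_grad j x.
  by move=> /DP[cx _] tT; have [_ ->] := shape_expansion tri (ufe t tT) cx.
have be j := shape_bounded_measurable j mD bD.
have bge j := shape_grad_bounded_measurable j mD.
exists _, c, (mass (lebesgue_rV R d) D (@shape _ _ Th)),
  (stiffness (lebesgue_rV R d) D (@shape_grad _ _ Th)),
  (fun t => drift (lebesgue_rV R d) D (@shape _ _ Th) (@shape_grad _ _ Th) (F^~ t)).
have bF t : 0 < t < T -> bounded_measurable_field D (F^~ t).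
  move=> tT k; split.
    by apply: measurable_funS (measurable_space_slice k oO mF tT).
  exists (Num.sqrt (2 * M ^+ 2 + 2 * (M' * T) ^+ 2)) => x /DP[_ [Fx _]].
  by apply: (le_trans (normv_coor _ _)); apply: ler_wsqrtr; exact: Fx.
split; last first.
  move=> t tT; rewrite /inner restr bil_mass//.
  apply: eq_Rintegral => x; rewrite inE => Dx; rewrite (ux _ _ Dx tT).
  by congr (_ * _); apply: eq_bigr => j _; exact: mulrC.
apply: energy_forms_system => //.
- move=> x t Dx tT; rewrite sqr_sqrtr; last first.
    by rewrite addr_ge0// mulr_ge0// sqr_ge0.
  by have [_ [Fx _]] := DP _ Dx; exact: Fx.
- move=> x s t Dx sT tT; have [_ [_ Fx]] := DP _ Dx.
  apply: (le_trans (Fx s t sT tT)).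
  rewrite -[leLHS]real_normK ?num_real// normrM ler_pXn2r ?nnegrE ?mulr_ge0//.
  by apply: ler_wpM2r => //; rewrite lerDl.
move=> t tau tT tauT dcx dv.
have := eqn t tT (u tau) (ufe tau tauT).
rewrite /inner /innerv !restr bil_mass// bil_stiffness// bil_drift//; last exact: bF.
move=> eq0; rewrite -[RHS]eq0; congr (_ + _ - _); apply: eq_Rintegral => x; rewrite inE => Dx.
- congr (_ * _); last by rewrite ux//; apply: eq_bigr => j _; exact: mulrC.
  rewrite (derive1_sum tT dc (fun s sT => ux x s Dx sT)).
  by apply: eq_bigr => j _; exact: mulrC.
- rewrite ugx//; congr dotv; apply/rowP => k; rewrite mxE summxE.
  rewrite (RLderiv1m_sum (k := fun j => shape_grad j x ord0 k) al01 tT cc dc dcb).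
    by apply: eq_bigr => j _; rewrite mxE mulrC.
  by move=> s sT; rewrite ugx// summxE; apply: eq_bigr => j _; rewrite mxE mulrC.
rewrite ugx// dotvZl; congr (_ * _).
rewrite (RLderiv1m_sum al01 tT cc dc dcb (fun s sT => ux x s Dx sT)).
by apply: eq_bigr => j _; exact: mulrC.
Qed.

Theorem theorem1 (R : realType) (alpha T M M' : R) :
  0 < alpha < 1 -> 0 < T ->
  exists C : R,
  forall (d : nat) (Omega : set 'rV[R]_d) (F F' : 'rV[R]_d -> R -> 'rV[R]_d)
    (bc : boundary_condition) (sigma h : R) (Th : mesh R d)
    (u0h : 'rV[R]_d -> R) (u : R -> 'rV[R]_d -> R),
  (1 <= d)%N ->
  polyhedral_domain Omega ->
  space_time_measurable Omega T F -> Linfty_norm Omega T F = M%:E ->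
  space_time_measurable Omega T F' -> Linfty_norm Omega T F' = M'%:E ->
  time_derivative Omega T F F' ->
  triangulation Omega Th -> shape_regular sigma Th -> mesh_size Th = h ->
  fe_space Omega bc Th u0h ->
  semidiscrete_solution Omega T alpha F bc Th u0h u ->
  forall t, 0 <= t <= T -> L2norm Omega (u t) <= C * L2norm Omega u0h.
Proof.
move=> alpha01 T0.
have c00 : 0 <= (Gamma alpha)^-1 by rewrite invr_ge0 Gamma_ge0.
have L0 : 0 <= `|M'| + 1 by rewrite addr_ge0.
have [K K0 stable] := fractional_system_stable
  (Num.sqrt (2 * M ^+ 2 + 2 * (M' * T) ^+ 2)) alpha01 T0 c00 L0.
exists (Num.sqrt K) => d Omega F F' bc sigma h Th u0h u d0 [[_ oO _ bO _] _].
move=> mF FM mF' FM' FF' tri _ _ _ sol t tT.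
have [I [c [G [S [B [sys uE]]]]]] :=
  semidiscrete_system alpha01 T0 d0 oO bO mF FM mF' FM' FF' tri sol.
have [_ _ _ u0 _] := sol.
have -> : L2norm Omega u0h = L2norm Omega (u 0).
  rewrite /L2norm /inner; congr Num.sqrt; apply: eq_Rintegral => x; rewrite inE => Ox.
  by rewrite u0//; exact: subset_closure.
have T00 : 0 <= (0 : R) <= T by rewrite lexx ltW.
rewrite /L2norm (uE t tT) (uE 0 T00) -sqrtrM//.
by apply: ler_wsqrtr; exact: (stable _ _ _ _ _ sys).
Qed.
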